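(* For any complex numbers $s,x,t$ satisfying $\operatorname{Im}(t)>0$, $\operatorname{Im}(x)\geq 0$ and $x\notin(-\infty,0]$, the Lerch zeta function satisfies \[ L(t,x,s)=(2\pi)^s\exp\left[-i\pi\left(\tfrac{s}{2}+2tx\right)\right]\,{}_{t}D_{\infty}^{-s}\left(\frac{e^{2\pi i t x}}{1-e^{2\pi i t}}\right), \] where the Weyl differintegral is taken with respect to the variable $t$.
   Context: The Lerch zeta function is defined by $L(t,x,s)=\sum_{m=0}^{\infty}(m+x)^{-s}e^{2\pi i t m}$ for $\operatorname{Re}(s)>1$, $\operatorname{Re}(x)>0$, $\operatorname{Im}(t)\geq 0$, and by analytic continuation in $(t,x,s)$ elsewhere. Complex powers are taken on the principal branch. The Weyl (right-handed, with endpoint $b=\infty$) fractional integral is ${}_{t}I^{\nu}_{\infty}f(t)=\frac{1}{\Gamma(\nu)}\int_t^{\infty}(\tau-t)^{\nu-1}f(\tau)\,\mathrm{d}\tau$ for $\operatorname{Re}(\nu)>0$; the Weyl fractional derivative is ${}_{t}D^{\nu}_{\infty}f(t)=(-1)^n\frac{\mathrm{d}^n}{\mathrm{d}t^n}\,{}_{t}I^{n-\nu}_{\infty}f(t)$ for $\operatorname{Re}(\nu)\geq 0$, $n-1<\operatorname{Re}(\nu)\leq n$, $n\in\mathbb{N}$; and by convention ${}_{t}D^{-\nu}_{\infty}={}_{t}I^{\nu}_{\infty}$, so ${}_{t}D^{\nu}_{\infty}$ is defined for all $\nu\in\mathbb{C}$.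
   Formalization: For real x>0, where the Weyl integral can diverge (e.g. x=s=1), its Abel value is used whenever it diverges; a Weyl integral of order with real part 0, left undefined, is taken as minus the t-derivative of the integral of order one higher; for complex t it runs along a horizontal ray. *)

(* Defs.v *)
From Stdlib Require Import Reals.
From Coquelicot Require Import Coquelicot.
Open Scope R_scope.

Definition Cexp (z : C) : C :=
  (exp (Re z) * cos (Im z), exp (Re z) * sin (Im z)).

(* Principal argument, with values in (-PI, PI]; junk at z = 0. *)
Definition Carg (z : C) : R :=
  if Rle_dec 0 (Im z) then acos (Re z / Cmod z) else - acos (Re z / Cmod z).

Definition Clog (z : C) : C := (ln (Cmod z), Carg z).

Definition Cpower (z w : C) : C := Cexp (w * Clog z)%C.

(* The ray (-oo, 0] on which the principal branch is cut. *)
Definition on_cut (z : C) : Prop := Im z = 0 /\ Re z <= 0.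

Definition sum_n_C (a : nat -> C) (N : nat) : C :=
  @sum_n C_AbelianMonoid a N.

(* Joint analyticity at (t0, x0, s0): near that point, f is the sum of an
   absolutely convergent power series in three variables.  The triple series
   is summed over the cubes {0, ..., N}^3. *)
Definition analytic3_at (f : C -> C -> C -> C) (t0 x0 s0 : C) : Prop :=
  exists (r : R) (a : nat -> nat -> nat -> C), 0 < r /\
    forall t x s : C,
      Cmod (t - t0) < r -> Cmod (x - x0) < r -> Cmod (s - s0) < r ->
      let term i j k :=
        (a i j k * Cpow (t - t0) i * Cpow (x - x0) j * Cpow (s - s0) k)%C in
      (exists M : R, forall N : nat,
         sum_n (fun i => sum_n (fun j => sum_n (fun k =>
           Cmod (term i j k)) N) N) N <= M) /\
      filterlim
        (fun N => sum_n_C (fun i => sum_n_C (fun j => sum_n_C (fun k =>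
           term i j k) N) N) N)
        eventually (locally (f t x s)).

(* L is the Lerch zeta function on Im t > 0, x off (-oo, 0], s arbitrary: it is
   analytic on this connected domain and is given by the defining series
   whenever Re s > 1, Re x > 0 and Im t >= 0.  By the identity theorem these
   conditions determine L on the domain. *)
Definition is_lerch_zeta (L : C -> C -> C -> C) : Prop :=
  (forall t x s : C, 1 < Re s -> 0 < Re x -> 0 <= Im t ->
     @is_series C_AbsRing C_NormedModule
       (fun m : nat =>
          (Cpower (RtoC (INR m) + x) (- s)
           * Cexp (2 * RtoC PI * Ci * t * RtoC (INR m)))%C)
       (L t x s)) /\
  (forall t x s : C, 0 < Im t -> ~ on_cut x -> analytic3_at L t x s).

Definition is_improper_RInt (g : R -> C) (J : C) : Prop :=
  @is_RInt_gen C_R_NormedModule g (at_right 0) (Rbar_locally p_infty) J.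

(* Abel value of an integral over (0, oo). *)
Definition is_abel_RInt (g : R -> C) (J : C) : Prop :=
  exists G : R -> C,
    (forall eps : R, 0 < eps ->
       is_improper_RInt (fun u => (RtoC (exp (- eps * u)) * g u)%C) (G eps)) /\
    filterlim G (at_right 0) (locally J).

(* The improper integral over (0, oo), possibly conditionally convergent; its
   Abel value is used only when the improper integral diverges. *)
Definition is_RInt_0_oo (g : R -> C) (J : C) : Prop :=
  is_improper_RInt g J \/
  ((~ exists J' : C, is_improper_RInt g J') /\ is_abel_RInt g J).

(* Euler's integral, meaningful for Re nu > 0 only. *)
Definition CGamma (nu : C) : C :=
  @RInt_gen C_R_CompleteNormedModule
    (fun u : R => (Cpower (RtoC u) (nu - 1) * Cexp (- RtoC u))%C)
    (at_right 0) (Rbar_locally p_infty).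

(* The Weyl integral of order nu, Re nu > 0, along the horizontal ray
   tau = t + u, u > 0, from t to infinity. *)
Definition is_weyl_integral (nu : C) (f : C -> C) (t v : C) : Prop :=
  exists J : C,
    is_RInt_0_oo (fun u : R => (Cpower (RtoC u) (nu - 1) * f (t + RtoC u))%C) J
    /\ v = (/ CGamma nu * J)%C.

(* The order n - nu in the Weyl derivative may have real part 0, where the
   integral is not available (at order 0 it should be the identity); there the
   integral of order mu is minus the derivative of the integral of order
   mu + 1. *)
Definition is_weyl_I (nu : C) (f : C -> C) (t v : C) : Prop :=
  (0 < Re nu /\ is_weyl_integral nu f t v) \/
  (Re nu = 0 /\ exists g : C -> C,
     locally t (fun w => is_weyl_integral (nu + 1) f w (g w)) /\
     @is_derive C_AbsRing C_NormedModule g t (- v)%C).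

Fixpoint is_Cderive_n (n : nat) (g : C -> C) (t d : C) : Prop :=
  match n with
  | O => d = g t
  | S m => exists h : C -> C,
      locally t (fun w => is_Cderive_n m g w (h w)) /\
      @is_derive C_AbsRing C_NormedModule h t d
  end.

(* v is the Weyl differintegral of order nu of f at t, for any complex nu; the
   bounds on n determine it. *)
Definition is_weyl_D (nu : C) (f : C -> C) (t v : C) : Prop :=
  (Re nu < 0 /\ is_weyl_I (- nu)%C f t v) \/
  (0 <= Re nu /\ exists (n : nat) (g : C -> C) (d : C),
     INR n - 1 < Re nu <= INR n /\
     locally t (fun w => is_weyl_I (RtoC (INR n) - nu)%C f w (g w)) /\
     is_Cderive_n n g t d /\
     v = (Cpow (- (1)) n * d)%C).

(* Main.v *)
Require Import Defs.
From Stdlib Require Import Reals Lra Lia Psatz Classical Factorial.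
From Coquelicot Require Import Coquelicot.
Open Scope R_scope.

(** Every complex-analytic argument is reduced to functions of one real variable. Euler's integral
    at a complex parameter [p] is not obtained by rotating a contour: [p] is joined to 1 by the path
    [e^(th Log p)], along which the suitably scaled integral has increments of second order and is
    therefore constant. The sum over [m] is never interchanged with an integral; geometric terms are
    peeled off one at a time and the integral of the remainder decays like [q^N], with
    [q = e^(-2 pi Im t)].

    The factor [1 / Gamma(s)] has to be cancelled, so Gamma must not vanish. A zero at [s] would
    propagate to [s + n] by the functional equation, and for large real part it is excluded by
    comparing three real gamma integrals.

    The passage [eps -> 0] is made under the sum, because [Im t > 0] gives a majorant in [m] uniform
    in [eps]. The shift relation in [x] spares any analyticity of the series in [x]: only [L] and
    [x^(-s)] have to be analytic there. A horizontal line with [Im x > 0] misses the cut, while a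
    real [x] off the cut is positive and needs no continuation in [x]. *)

(** With [c_m = - 2 pi i (m + x)], of nonnegative real part, the kernel is the
    geometric series [sum_m e^(- c_m t)], and Euler's integral turns the Weyl
    integral of order [s] into [sum_m c_m^(-s) e^(- c_m t)].  For real [x] the
    integral is not absolutely convergent, but multiplying by [e^(- eps u)]
    replaces [c_m] by [eps + c_m], so its Abel value is always available; by
    Abel's theorem it is also the value of the improper integral when the latter
    converges, so no convergence has to be decided.  Differentiating in [t] maps
    the sum for [s] to minus the sum for [s - 1], which gives the orders with
    [Re s <= 0].  Since [Re c_m >= 0], the principal branch satisfies
    [c_m^(-s) = (2 pi)^(-s) e^(i pi s / 2) (m + x)^(-s)].  Finally [L] equals the
    series [sum_m (m + x)^(-s) e^(2 pi i m t)] by the identity theorem along real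
    lines: first in [s], for [Re x > 0], then in [x], applied to
    [L(t, x, s) - x^(-s) - e^(2 pi i t) L(t, x + 1, s)]. *)

(** * Complex exponential, logarithm and derivatives along the real line *)

Lemma C_ext (z w : C) : Re z = Re w -> Im z = Im w -> z = w.
Proof. destruct z, w; simpl; congruence. Qed.

Lemma Re_mult (z w : C) : Re (z * w) = Re z * Re w - Im z * Im w.
Proof. reflexivity. Qed.

Lemma Im_mult (z w : C) : Im (z * w) = Re z * Im w + Im z * Re w.
Proof. reflexivity. Qed.

Lemma Re_plus (z w : C) : Re (z + w) = Re z + Re w.
Proof. reflexivity. Qed.

Lemma Im_plus (z w : C) : Im (z + w) = Im z + Im w.
Proof. reflexivity. Qed.

Lemma Re_opp (z : C) : Re (- z) = - Re z.
Proof. reflexivity. Qed.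

Lemma Im_opp (z : C) : Im (- z) = - Im z.
Proof. reflexivity. Qed.

Lemma Re_RtoC (r : R) : Re (RtoC r) = r.
Proof. reflexivity. Qed.

Lemma Im_RtoC (r : R) : Im (RtoC r) = 0.
Proof. reflexivity. Qed.

Lemma im_le_Cmod (z : C) : Rabs (Im z) <= Cmod z.
Proof.
  eapply Rle_trans; [|apply Rmax_Cmod]. destruct z; simpl. apply Rmax_r.
Qed.

Lemma Re_le_Cmod (z : C) : Re z <= Cmod z.
Proof. eapply Rle_trans; [apply Rle_abs|apply re_le_Cmod]. Qed.

Lemma Im_le_Cmod (z : C) : Im z <= Cmod z.
Proof. eapply Rle_trans; [apply Rle_abs|apply im_le_Cmod]. Qed.

Lemma Cmod_le_abs (z : C) : Cmod z <= Rabs (Re z) + Rabs (Im z).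
Proof.
  replace z with (RtoC (Re z) + Ci * RtoC (Im z))%C at 1.
  - eapply Rle_trans; [apply Cmod_triangle|].
    rewrite Cmod_mult, Cmod_Ci, !Cmod_R. lra.
  - apply C_ext; simpl; ring.
Qed.

Lemma Cmod_minus_sym (z w : C) : Cmod (z - w) = Cmod (w - z).
Proof. rewrite <- Cmod_opp. f_equal. ring. Qed.

Lemma Cmod_triangle_rev (z w : C) : Cmod z - Cmod w <= Cmod (z + w).
Proof.
  generalize (Cmod_triangle (z + w) (- w)). rewrite Cmod_opp.
  replace (z + w + - w)%C with z by ring. lra.
Qed.

Lemma Cmod_pos_RtoC (r : R) : 0 <= r -> Cmod (RtoC r) = r.
Proof. intros H. rewrite Cmod_R. now apply Rabs_pos_eq. Qed.

Lemma Cmod_eps_eq (z w : C) : (forall eps, 0 < eps -> Cmod (z - w) <= eps) -> z = w.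
Proof.
  intros H. assert (Hz : Cmod (z - w) = 0).
  { destruct (Cmod_ge_0 (z - w)) as [Hp|Hp]; [|easy].
    specialize (H (Cmod (z - w) / 2)). lra. }
  apply Cmod_eq_0 in Hz. replace z with (z - w + w)%C by ring. rewrite Hz. ring.
Qed.

Lemma Cexp_plus (z w : C) : Cexp (z + w) = (Cexp z * Cexp w)%C.
Proof.
  apply C_ext; unfold Cexp, Re, Im; simpl;
  rewrite exp_plus, ?cos_plus, ?sin_plus; ring.
Qed.

Lemma Cexp_0 : Cexp 0 = RtoC 1.
Proof. apply C_ext; unfold Cexp; simpl; rewrite exp_0, ?cos_0, ?sin_0; ring. Qed.

Lemma Cmod_Cexp (z : C) : Cmod (Cexp z) = exp (Re z).
Proof.
  unfold Cmod, Cexp; simpl fst; simpl snd.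
  replace ((exp (Re z) * cos (Im z)) ^ 2 + (exp (Re z) * sin (Im z)) ^ 2)
    with (exp (Re z) * exp (Re z) * (Rsqr (sin (Im z)) + Rsqr (cos (Im z))))
    by (unfold Rsqr; ring).
  rewrite sin2_cos2, Rmult_1_r. apply sqrt_square, Rlt_le, exp_pos.
Qed.

Lemma Cexp_neq_0 (z : C) : Cexp z <> 0.
Proof. apply Cmod_gt_0. rewrite Cmod_Cexp. apply exp_pos. Qed.

Lemma Cexp_opp (z : C) : Cexp (- z) = (/ Cexp z)%C.
Proof.
  assert (H : (Cexp (- z) * Cexp z)%C = 1).
  { rewrite <- Cexp_plus, <- Cexp_0. f_equal. ring. }
  replace (/ Cexp z)%C with (Cexp (- z) * Cexp z * / Cexp z)%C
    by (rewrite H; ring).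
  field. apply Cexp_neq_0.
Qed.

Lemma Cexp_RtoC (r : R) : Cexp (RtoC r) = RtoC (exp r).
Proof. apply C_ext; unfold Cexp; simpl; rewrite ?cos_0, ?sin_0; ring. Qed.

Lemma Cexp_nat (z : C) (n : nat) : Cexp (RtoC (INR n) * z) = Cpow (Cexp z) n.
Proof.
  induction n as [|n IH].
  - simpl. replace (RtoC 0 * z)%C with (RtoC 0) by ring. apply Cexp_0.
  - rewrite S_INR. simpl Cpow. rewrite <- IH, <- Cexp_plus. f_equal.
    rewrite RtoC_plus. ring.
Qed.

Lemma Cexp_le (z : C) : Cmod (Cexp z) <= exp (Cmod z).
Proof.
  rewrite Cmod_Cexp. destruct (Re_le_Cmod z) as [H|H].
  - apply Rlt_le, exp_increasing, H.
  - rewrite H. lra.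
Qed.

Lemma exp_le (x y : R) : x <= y -> exp x <= exp y.
Proof. intros [H|H]; [apply Rlt_le, exp_increasing, H | subst; lra]. Qed.

Lemma Carg_bound (z : C) : Rabs (Carg z) <= PI.
Proof.
  unfold Carg. generalize (acos_bound (Re z / Cmod z)). intros H.
  destruct (Rle_dec 0 (Im z)); [|rewrite Rabs_Ropp]; rewrite Rabs_pos_eq; lra.
Qed.

Lemma Re_div_Cmod_bound (z : C) : z <> 0 -> -1 <= Re z / Cmod z <= 1.
Proof.
  intros H. apply Cmod_gt_0 in H. generalize (re_le_Cmod z). intros H1.
  apply Rabs_le_between in H1. split.
  - apply Rle_div_r; lra.
  - apply Rle_div_l; lra.
Qed.

Lemma Cexp_Clog (z : C) : z <> 0 -> Cexp (Clog z) = z.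
Proof.
  intros Hz. assert (Hb := Re_div_Cmod_bound z Hz).
  assert (Hm := proj1 (Cmod_gt_0 z) Hz).
  assert (Hs : sqrt (1 - (Re z / Cmod z)²) = Rabs (Im z) / Cmod z).
  { replace (1 - (Re z / Cmod z)²) with ((Rabs (Im z) / Cmod z)²).
    - apply sqrt_Rsqr. apply Rdiv_le_0_compat; [apply Rabs_pos|easy].
    - rewrite !Rsqr_div'. rewrite <- Rsqr_abs.
      assert (Hc := Cmod2_alt z). unfold Rsqr.
      replace (Im z * Im z) with (Cmod z * Cmod z - Re z * Re z) by nra.
      field. lra. }
  unfold Cexp, Clog, Carg; simpl. rewrite exp_ln by easy.
  apply C_ext; simpl; destruct (Rle_dec 0 (Im z)) as [Hi|Hi].
  - rewrite cos_acos by easy. field. lra.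
  - rewrite cos_neg, cos_acos by easy. field. lra.
  - rewrite sin_acos, Hs, Rabs_pos_eq by easy. field. lra.
  - rewrite sin_neg, sin_acos, Hs, Rabs_left by lra. field. lra.
Qed.

Lemma Carg_Cexp (z : C) : - PI < Im z <= PI -> Carg (Cexp z) = Im z.
Proof.
  intros H. unfold Carg. rewrite Cmod_Cexp. unfold Cexp; simpl.
  assert (He := exp_pos (Re z)).
  replace (exp (Re z) * cos (Im z) / exp (Re z)) with (cos (Im z)) by (field; lra).
  (* The sign of the sine decides the branch. The endpoint [Im z = PI] has sine 0 and falls in the
     first case, where [acos] returns [PI]. *)
  destruct (Rle_dec 0 (exp (Re z) * sin (Im z))) as [Hi|Hi].
  - destruct (Rle_lt_dec 0 (Im z)) as [H0|H0].
    + apply acos_cos. lra.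
    + assert (sin (Im z) < 0) by (apply sin_lt_0_var; lra). nra.
  - destruct (Rle_lt_dec 0 (Im z)) as [H0|H0].
    + assert (0 <= sin (Im z)) by (apply sin_ge_0; lra). nra.
    + rewrite <- cos_neg, acos_cos; lra.
Qed.

Lemma Clog_Cexp (z : C) : - PI < Im z <= PI -> Clog (Cexp z) = z.
Proof.
  intros H. unfold Clog. rewrite Carg_Cexp, Cmod_Cexp, ln_exp by easy.
  now destruct z.
Qed.

Lemma Clog_pos (r : R) : 0 < r -> Clog (RtoC r) = RtoC (ln r).
Proof.
  intros H. rewrite <- (exp_ln r) at 1 by easy. rewrite <- Cexp_RtoC.
  apply Clog_Cexp. simpl. generalize PI_RGT_0. lra.
Qed.

Lemma Carg_right_strict (z : C) : 0 < Re z -> - (PI / 2) < Carg z < PI / 2.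
Proof.
  intros H. assert (Hz : z <> 0) by (intros E; rewrite E in H; simpl in H; lra).
  assert (Hb := Re_div_Cmod_bound z Hz).
  assert (Hm := proj1 (Cmod_gt_0 z) Hz).
  assert (Ha : acos (Re z / Cmod z) < PI / 2).
  { apply Rnot_le_lt. intros Hl. assert (Hc := acos_bound (Re z / Cmod z)).
    assert (Hn : cos (acos (Re z / Cmod z)) <= 0) by (apply cos_le_0; lra).
    rewrite cos_acos in Hn by easy.
    assert (0 < Re z / Cmod z) by now apply Rdiv_lt_0_compat. lra. }
  assert (Hc := acos_bound (Re z / Cmod z)).
  unfold Carg. destruct (Rle_dec 0 (Im z)); lra.
Qed.

(** The value [PI] of [acos] would force [Re z = - Cmod z], hence a point of the cut. The bounds are
    what allows a rotation by [- PI / 2] without leaving the principal branch. *)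
Lemma Carg_upper (z : C) : 0 <= Im z -> ~ on_cut z -> 0 <= Carg z < PI.
Proof.
  intros H Hc. assert (Hz : z <> 0).
  { intros E. apply Hc. rewrite E. split; simpl; lra. }
  assert (Hb := Re_div_Cmod_bound z Hz).
  assert (Hm := proj1 (Cmod_gt_0 z) Hz).
  unfold Carg. destruct (Rle_dec 0 (Im z)); [|lra].
  assert (Ha := acos_bound (Re z / Cmod z)). split; [easy|].
  destruct (Rle_lt_or_eq_dec (acos (Re z / Cmod z)) PI) as [Hl|Hl]; [easy..|].
  exfalso. apply Hc.
  assert (E : Re z / Cmod z = -1) by (rewrite <- (cos_acos (Re z / Cmod z)), Hl by easy; apply cos_PI).
  assert (E' : Re z = - Cmod z).
  { replace (Re z) with (Re z / Cmod z * Cmod z) by (field; lra). rewrite E. ring. }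
  assert (H2 := Cmod2_alt z). split; nra.
Qed.

(* Half-angle formula for the argument, which has no singularity off the cut. *)
Lemma Carg_atan (z : C) : ~ on_cut z -> Carg z = 2 * atan (Im z / (Cmod z + Re z)).
Proof.
  intros Hc.
  assert (Hz : z <> 0).
  { intros E. apply Hc. rewrite E. split; simpl; lra. }
  assert (Hm := proj1 (Cmod_gt_0 z) Hz).
  assert (Hp : 0 < Cmod z + Re z).
  { assert (H2 := Cmod2_alt z).
    destruct (Rlt_le_dec 0 (Cmod z + Re z)) as [|Hn]; [easy|exfalso].
    apply Hc. assert (H3 := re_le_Cmod z). apply Rabs_le_between in H3. split; nra. }
  set (a := atan (Im z / (Cmod z + Re z))).
  assert (Ht : tan a = Im z / (Cmod z + Re z)) by apply tan_atan.
  assert (Hab : - PI / 2 < a < PI / 2) by apply atan_bound.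
  assert (Hcos : 0 < cos a) by (apply cos_gt_0; lra).
  assert (E1 : sin a * (Cmod z + Re z) = cos a * Im z).
  { unfold tan in Ht. apply (Rmult_eq_reg_r (/ (cos a * (Cmod z + Re z)))).
    - transitivity (sin a / cos a); [field; lra|]. rewrite Ht. field. lra.
    - apply Rinv_neq_0_compat. nra. }
  assert (E2 := sin2_cos2 a). unfold Rsqr in E2.
  assert (E3 := Cmod2_alt z).
  (* The half-angle formula for the cosine. With [E1] it identifies [z] with the exponential of
     [(ln |z|, 2 a)]. *)
  assert (E4 : cos a * cos a * (2 * Cmod z) = Cmod z + Re z).
  { apply (Rmult_eq_reg_r (Cmod z + Re z)); [|lra].
    transitivity (cos a * cos a * ((Cmod z + Re z)^2 + Im z^2)); [nra|].
    transitivity ((sin a * (Cmod z + Re z))^2 + (cos a * (Cmod z + Re z))^2).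
    - rewrite E1. ring.
    - transitivity ((sin a * sin a + cos a * cos a) * (Cmod z + Re z)^2); [ring|].
      rewrite E2. ring. }
  assert (E : z = Cexp (ln (Cmod z), 2 * a)).
  { unfold Cexp; simpl. rewrite exp_ln by easy. apply C_ext; simpl.
    - rewrite cos_2a_cos. lra.
    - rewrite sin_2a. apply (Rmult_eq_reg_r (Cmod z + Re z)); [|lra].
      transitivity (2 * Cmod z * cos a * (sin a * (Cmod z + Re z))); [|ring].
      rewrite E1.
      transitivity (Im z * (cos a * cos a * (2 * Cmod z))); [rewrite E4|]; ring. }
  rewrite E at 1. apply Carg_Cexp. simpl. lra.
Qed.

Lemma on_cut_dec_Re (z : C) : 0 <= Re z -> z <> 0 -> ~ on_cut z.
Proof. intros H Hz [H1 H2]. apply Hz, C_ext; simpl; lra. Qed.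

Lemma Cmod_Clog_le (z : C) (d M : R) :
  0 < d -> d <= Cmod z <= M -> Cmod (Clog z) <= Rabs (ln d) + Rabs (ln M) + PI.
Proof.
  intros Hd [H1 H2]. eapply Rle_trans; [apply Cmod_le_abs|].
  unfold Clog; simpl. assert (Hp := Carg_bound z).
  assert (ln d <= ln (Cmod z)) by (apply ln_le; lra).
  assert (ln (Cmod z) <= ln M) by (apply ln_le; lra).
  assert (Rabs (ln (Cmod z)) <= Rabs (ln d) + Rabs (ln M)); [|lra].
  unfold Rabs; repeat destruct Rcase_abs; lra.
Qed.

(** Two applications of the mean value theorem, to [f] and then to [f1]. They give [M] where the
    sharp constant is [M / 2]; only the second order in [y - x] matters later. *)
Lemma taylor2_real (f f1 f2 : R -> R) (x y M : R) :
  (forall z, Rmin x y <= z <= Rmax x y -> is_derive f z (f1 z)) ->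
  (forall z, Rmin x y <= z <= Rmax x y -> is_derive f1 z (f2 z)) ->
  (forall z, Rmin x y <= z <= Rmax x y -> Rabs (f2 z) <= M) ->
  Rabs (f y - f x - (y - x) * f1 x) <= M * (y - x) ^ 2.
Proof.
  intros H1 H2 H3.
  assert (C1 : forall z, Rmin x y <= z <= Rmax x y -> continuity_pt f z).
  { intros z Hz. apply continuity_pt_filterlim.
    apply (ex_derive_continuous f). eexists. now apply H1. }
  assert (C2 : forall z, Rmin x y <= z <= Rmax x y -> continuity_pt f1 z).
  { intros z Hz. apply continuity_pt_filterlim.
    apply (ex_derive_continuous f1). eexists. now apply H2. }
  assert (Hx : Rmin x y <= x <= Rmax x y) by (split; [apply Rmin_l|apply Rmax_l]).
  destruct (MVT_gen f x y f1) as [c [Hc Ec]].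
  { intros z Hz. apply H1. lra. } { easy. }
  assert (Sub : Rmin x y <= Rmin x c /\ Rmax x c <= Rmax x y).
  { split; [apply Rmin_glb|apply Rmax_lub]; lra. }
  destruct (MVT_gen f1 x c f2) as [d [Hd Ed]].
  { intros z Hz. apply H2. lra. } { intros z Hz. apply C2. lra. }
  replace (f y - f x - (y - x) * f1 x) with ((f1 c - f1 x) * (y - x)) by (rewrite Ec; ring).
  rewrite Ed. rewrite !Rabs_mult.
  assert (Hcx : Rabs (c - x) <= Rabs (y - x)).
  { unfold Rmin, Rmax in Hc; destruct (Rle_dec x y);
    unfold Rabs; repeat destruct Rcase_abs; lra. }
  assert (HM := H3 d ltac:(lra)). assert (H0 := Rabs_pos (f2 d)).
  rewrite <- (pow2_abs (y - x)). simpl. rewrite Rmult_1_r, Rmult_assoc.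
  apply Rmult_le_compat; try easy.
  - apply Rmult_le_pos; apply Rabs_pos.
  - apply Rmult_le_compat_r; [apply Rabs_pos|easy].
Qed.

(** Taken componentwise so that the mean value theorem, which fails for complex values, can be
    applied to each part. *)
Definition Cderiv (f : R -> C) (x : R) (d : C) : Prop :=
  is_derive (fun u => Re (f u)) x (Re d) /\ is_derive (fun u => Im (f u)) x (Im d).

Lemma Cderiv_eq (f : R -> C) (x : R) (d d' : C) : Cderiv f x d -> d = d' -> Cderiv f x d'.
Proof. now intros H <-. Qed.

Lemma Cderiv_ext (f g : R -> C) (x : R) (d : C) :
  locally x (fun u => f u = g u) -> Cderiv f x d -> Cderiv g x d.
Proof.
  intros H [H1 H2]. split; [eapply is_derive_ext_loc, H1 | eapply is_derive_ext_loc, H2];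
  (eapply filter_imp, H; intros u Hu; now rewrite Hu).
Qed.

Lemma Cderiv_const (c : C) (x : R) : Cderiv (fun _ => c) x 0.
Proof.
  split; [exact (is_derive_const (Re c) x) | exact (is_derive_const (Im c) x)].
Qed.

Lemma Cderiv_RtoC (f : R -> R) (x d : R) :
  is_derive f x d -> Cderiv (fun u => RtoC (f u)) x (RtoC d).
Proof. intros H. split; [exact H | exact (is_derive_const (0 : R) x)]. Qed.

Lemma Cderiv_plus (f g : R -> C) (x : R) (df dg : C) :
  Cderiv f x df -> Cderiv g x dg -> Cderiv (fun u => f u + g u)%C x (df + dg)%C.
Proof. intros [H1 H2] [H3 H4]. split; now apply @is_derive_plus. Qed.

Lemma Cderiv_mult (f g : R -> C) (x : R) (df dg : C) :
  Cderiv f x df -> Cderiv g x dg ->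
  Cderiv (fun u => f u * g u)%C x (df * g x + f x * dg)%C.
Proof.
  intros [H1 H2] [H3 H4]. split.
  - eapply is_derive_ext; [intros u; symmetry; apply Re_mult|].
    replace (Re (df * g x + f x * dg)) with
      ((Re df * Re (g x) + Re (f x) * Re dg) - (Im df * Im (g x) + Im (f x) * Im dg))
      by (rewrite Re_plus, !Re_mult; ring).
    apply @is_derive_minus; apply @is_derive_mult; try easy; apply Rmult_comm.
  - eapply is_derive_ext; [intros u; symmetry; apply Im_mult|].
    replace (Im (df * g x + f x * dg)) with
      ((Re df * Im (g x) + Re (f x) * Im dg) + (Im df * Re (g x) + Im (f x) * Re dg))
      by (rewrite Im_plus, !Im_mult; ring).
    apply @is_derive_plus; apply @is_derive_mult; try easy; apply Rmult_comm.
Qed.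

Lemma Cderiv_exp (f : R -> C) (x : R) (d : C) :
  Cderiv f x d -> Cderiv (fun u => Cexp (f u)) x (d * Cexp (f x))%C.
Proof.
  intros [H1 H2]. unfold Cexp. split; simpl.
  - eapply is_derive_ext_loc; [apply filter_forall; intros u; reflexivity|].
    evar_last.
    + apply (is_derive_mult (fun u => exp (Re (f u))) (fun u => cos (Im (f u)))).
      * apply (is_derive_comp exp (fun u => Re (f u))); [apply is_derive_exp|apply H1].
      * apply (is_derive_comp cos (fun u => Im (f u))); [apply is_derive_cos|apply H2].
      * apply Rmult_comm.
    + unfold scal, plus, mult, Re, Im; simpl. unfold mult; simpl. ring.
  - evar_last.
    + apply (is_derive_mult (fun u => exp (Re (f u))) (fun u => sin (Im (f u)))).
      * apply (is_derive_comp exp (fun u => Re (f u))); [apply is_derive_exp|apply H1].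
      * apply (is_derive_comp sin (fun u => Im (f u))); [apply is_derive_sin|apply H2].
      * apply Rmult_comm.
    + unfold scal, plus, mult, Re, Im; simpl. unfold mult; simpl. ring.
Qed.

(** The real estimate is applied to both parts; the factor 2 comes from bounding the modulus by the
    sum of their absolute values. *)
Lemma taylor2_C (f f1 f2 : R -> C) (x y M : R) :
  (forall z, Rmin x y <= z <= Rmax x y -> Cderiv f z (f1 z)) ->
  (forall z, Rmin x y <= z <= Rmax x y -> Cderiv f1 z (f2 z)) ->
  (forall z, Rmin x y <= z <= Rmax x y -> Cmod (f2 z) <= M) ->
  Cmod (f y - f x - RtoC (y - x) * f1 x) <= 2 * M * (y - x) ^ 2.
Proof.
  intros H1 H2 H3. eapply Rle_trans; [apply Cmod_le_abs|].
  assert (Hr := taylor2_real (fun u => Re (f u)) (fun u => Re (f1 u)) (fun u => Re (f2 u)) x y M).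
  assert (Hi := taylor2_real (fun u => Im (f u)) (fun u => Im (f1 u)) (fun u => Im (f2 u)) x y M).
  cbv beta in Hr, Hi.
  replace (Re (f y - f x - RtoC (y - x) * f1 x)) with
    (Re (f y) - Re (f x) - (y - x) * Re (f1 x))
    by (unfold Cminus; rewrite !Re_plus, !Re_opp, Re_mult, Re_RtoC, Im_RtoC; ring).
  replace (Im (f y - f x - RtoC (y - x) * f1 x)) with
    (Im (f y) - Im (f x) - (y - x) * Im (f1 x))
    by (unfold Cminus; rewrite !Im_plus, !Im_opp, Im_mult, Re_RtoC, Im_RtoC; ring).
  replace (2 * M * (y - x)^2) with (M * (y - x)^2 + M * (y - x)^2) by ring.
  apply Rplus_le_compat; [apply Hr | apply Hi]; intros z Hz;
    try (now apply H1); try (now apply H2).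
  - eapply Rle_trans; [apply re_le_Cmod|now apply H3].
  - eapply Rle_trans; [apply im_le_Cmod|now apply H3].
Qed.

Lemma Cexp_taylor2 (z : C) : Cmod (Cexp z - 1 - z) <= 2 * (Cmod z ^ 2 * exp (Cmod z)).
Proof.
  (* Taylor's estimate is used along the segment from 0 to [z], with real parameter [u] running over
     [0, 1]. *)
  assert (D : forall u, Cderiv (fun u => Cexp (RtoC u * z)) u (z * Cexp (RtoC u * z))%C).
  { intros u. apply Cderiv_exp. eapply Cderiv_eq.
    - apply Cderiv_mult; [apply Cderiv_RtoC, is_derive_id|apply Cderiv_const].
    - change (RtoC 1 * z + RtoC u * 0 = z)%C. ring. }
  assert (T := taylor2_C (fun u => Cexp (RtoC u * z)) (fun u => z * Cexp (RtoC u * z))%C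
    (fun u => z * (z * Cexp (RtoC u * z)))%C 0 1 (Cmod z ^ 2 * exp (Cmod z))).
  cbv beta in T.
  replace (RtoC 1 * z)%C with z in T by ring.
  replace (RtoC 0 * z)%C with (RtoC 0) in T by ring.
  rewrite Cexp_0 in T. replace (1 - 0) with 1 in T by ring.
  replace (Cexp z - 1 - RtoC 1 * (z * 1))%C with (Cexp z - 1 - z)%C in T by ring.
  replace (2 * (Cmod z ^ 2 * exp (Cmod z))) with
    (2 * (Cmod z ^ 2 * exp (Cmod z)) * 1^2) by ring.
  apply T.
  - intros u _. apply D.
  - intros u _. eapply Cderiv_eq; [apply Cderiv_mult; [apply Cderiv_const|apply D]|cbv beta; ring].
  - intros u Hu. rewrite Rmin_left, Rmax_right in Hu by lra.
    rewrite !Cmod_mult.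
    assert (Cmod (Cexp (RtoC u * z)) <= exp (Cmod z)).
    { eapply Rle_trans; [apply Cexp_le|]. apply exp_le. rewrite Cmod_mult, Cmod_pos_RtoC by lra.
      assert (H0 := Cmod_ge_0 z). nra. }
    assert (H0 := Cmod_ge_0 z). nra.
Qed.

(** * Improper integrals over the half-line *)

Lemma ball_C_of_Cmod (z w : C) (eps : R) : Cmod (w - z) < eps -> ball z eps w.
Proof.
  intros H. split.
  - eapply Rle_lt_trans; [|apply H]. apply (re_le_Cmod (w - z)).
  - eapply Rle_lt_trans; [|apply H]. apply (im_le_Cmod (w - z)).
Qed.

(** Balls of [C] are those of the product [R * R], so they control the two coordinates separately;
    hence the factor 2. *)
Lemma Cmod_of_ball_C (z w : C) (eps : R) : ball z eps w -> Cmod (w - z) < 2 * eps.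
Proof.
  intros [H1 H2]. eapply Rle_lt_trans; [apply Cmod_le_abs|].
  assert (Rabs (Re (w - z)) < eps) by exact H1.
  assert (Rabs (Im (w - z)) < eps) by exact H2. lra.
Qed.

Lemma filterlim_C {T : Type} (F : (T -> Prop) -> Prop) {FF : Filter F} (f : T -> C) (l : C) :
  filterlim f F (locally l) <-> (forall eps, 0 < eps -> F (fun x => Cmod (f x - l) < eps)).
Proof.
  split.
  - intros H eps He.
    assert (He2 : 0 < eps / 2) by lra.
    generalize (proj1 (filterlim_locally f l) H (mkposreal _ He2)).
    apply filter_imp. intros x Hx. apply Cmod_of_ball_C in Hx. simpl in Hx. lra.
  - intros H. apply filterlim_locally. intros eps.
    generalize (H eps (cond_pos eps)). apply filter_imp. intros x.
    apply ball_C_of_Cmod.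
Qed.

Notation is_RInt_C := (@is_RInt C_R_NormedModule).

(** The filter definition in epsilon form. Requiring [d <= 1 <= M] guarantees [a < b] for all
    admissible endpoints, so no orientation has to be discussed. *)
Lemma improper_iff (g : R -> C) (J : C) :
  is_improper_RInt g J <->
  (forall eps, 0 < eps -> exists d M, 0 < d <= 1 /\ 1 <= M /\
     forall a b, 0 < a < d -> M < b ->
     exists y, is_RInt_C g a b y /\ Cmod (y - J) < eps).
Proof.
  unfold is_improper_RInt, is_RInt_gen.
  rewrite (filterlimi_locally (U := C_UniformSpace)). split.
  - intros H eps He. assert (He2 : 0 < eps / 2) by lra.
    destruct (H (mkposreal _ He2)) as [P Q [d Hd] [M HM] HPQ].
    exists (Rmin d 1), (Rmax M 1). split; [|split; [apply Rmax_r|]].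
    { split; [|apply Rmin_r]. apply Rmin_glb_lt; [apply cond_pos|lra]. }
    intros a b [Ha1 Ha2] Hb.
    destruct (HPQ a b) as [y [Hy1 Hy2]].
    + apply Hd; [|easy]. assert (Hl := Rmin_l d 1).
      apply Rabs_def1; unfold minus, plus, opp; simpl; lra.
    + apply HM. assert (Hl := Rmax_l M 1). lra.
    + exists y. split; [exact Hy1|]. apply Cmod_of_ball_C in Hy2. simpl in Hy2. lra.
  - intros H eps. destruct (H eps (cond_pos eps)) as [d [M [Hd [HM HH]]]].
    apply Filter_prod with (fun a => 0 < a < d) (fun b => M < b).
    + exists (mkposreal d (proj1 Hd)). intros y Hy Hy2. split; [easy|].
      apply Rabs_def2 in Hy. unfold minus, plus, opp in Hy; simpl in Hy. lra.
    + now exists M.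
    + intros a b Ha Hb. destruct (HH a b Ha Hb) as [y [Hy1 Hy2]].
      exists y. split; [exact Hy1|]. now apply ball_C_of_Cmod.
Qed.

Lemma is_RInt_C_plus (f g : R -> C) (a b : R) (I J : C) :
  is_RInt_C f a b I -> is_RInt_C g a b J -> is_RInt_C (fun u => f u + g u)%C a b (I + J)%C.
Proof. intros H1 H2. exact (is_RInt_plus f g a b I J H1 H2). Qed.

Lemma is_RInt_C_iff (f : R -> C) (a b : R) (I : C) :
  is_RInt_C f a b I <->
  (is_RInt (fun u => Re (f u)) a b (Re I) /\ is_RInt (fun u => Im (f u)) a b (Im I)).
Proof.
  split.
  - intros H. split.
    + exact (is_RInt_fct_extend_fst f a b I H).
    + exact (is_RInt_fct_extend_snd f a b I H).
  - intros [H1 H2]. destruct I as [I1 I2].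
    exact (is_RInt_fct_extend_pair f a b I1 I2 H1 H2).
Qed.

Lemma is_RInt_R_scal (f : R -> R) (a b k I : R) :
  is_RInt f a b I -> is_RInt (fun u => k * f u) a b (k * I).
Proof. exact (is_RInt_scal f a b k I). Qed.

(** The integral lives in a module over the reals, so a complex factor has to be recombined from the
    integrals of the real and imaginary parts. *)
Lemma is_RInt_C_scal (f : R -> C) (a b : R) (k I : C) :
  is_RInt_C f a b I -> is_RInt_C (fun u => k * f u)%C a b (k * I)%C.
Proof.
  rewrite !is_RInt_C_iff. intros [H1 H2]. split.
  - exact (is_RInt_minus _ _ a b _ _ (is_RInt_R_scal _ a b (Re k) _ H1)
      (is_RInt_R_scal _ a b (Im k) _ H2)).
  - exact (is_RInt_plus _ _ a b _ _ (is_RInt_R_scal _ a b (Re k) _ H2)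
      (is_RInt_R_scal _ a b (Im k) _ H1)).
Qed.

Lemma is_RInt_C_norm_le (f : R -> C) (h : R -> R) (a b : R) (I : C) (H : R) :
  a <= b -> (forall u, a <= u <= b -> Cmod (f u) <= h u) ->
  is_RInt_C f a b I -> is_RInt h a b H -> Cmod I <= H.
Proof.
  intros Hab Hle Hf Hh. rewrite Cmod_norm.
  apply (norm_RInt_le (V := C_R_NormedModule) f h a b I H Hab); try easy.
  intros u Hu. eapply Rle_trans; [right; symmetry; exact (Cmod_norm (f u))|]. now apply Hle.
Qed.

Lemma is_RInt_C_unique (f : R -> C) (a b : R) (I J : C) :
  is_RInt_C f a b I -> is_RInt_C f a b J -> I = J.
Proof.
  intros H1 H2.
  transitivity (@RInt C_R_CompleteNormedModule f a b).
  - symmetry. exact (is_RInt_unique (V := C_R_CompleteNormedModule) f a b I H1).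
  - exact (is_RInt_unique (V := C_R_CompleteNormedModule) f a b J H2).
Qed.

Lemma is_RInt_C_Chasles (f : R -> C) (a b c : R) (I J : C) :
  is_RInt_C f a b I -> is_RInt_C f b c J -> is_RInt_C f a c (I + J)%C.
Proof. exact (is_RInt_Chasles f a b c I J). Qed.

Definition Ccont (f : R -> C) (x : R) : Prop :=
  continuous (fun u => Re (f u)) x /\ continuous (fun u => Im (f u)) x.

Lemma Cderiv_cont (f : R -> C) (x : R) (d : C) : Cderiv f x d -> Ccont f x.
Proof.
  intros [H1 H2]. split.
  - apply (ex_derive_continuous (fun u => Re (f u))). now eexists; apply H1.
  - apply (ex_derive_continuous (fun u => Im (f u))). now eexists; apply H2.
Qed.

Lemma Ccont_continuous (f : R -> C) (x : R) :
  Ccont f x -> @continuous R_UniformSpace C_UniformSpace f x.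
Proof.
  intros [H1 H2]. apply filterlim_locally. intros eps.
  apply filter_and.
  - exact (proj1 (filterlim_locally _ _) H1 eps).
  - exact (proj1 (filterlim_locally _ _) H2 eps).
Qed.

Lemma Ccont_plus (f g : R -> C) (x : R) :
  Ccont f x -> Ccont g x -> Ccont (fun u => f u + g u)%C x.
Proof.
  intros [H1 H2] [H3 H4].
  split; [exact (continuous_plus _ _ _ H1 H3) | exact (continuous_plus _ _ _ H2 H4)].
Qed.

Lemma Ccont_mult (f g : R -> C) (x : R) :
  Ccont f x -> Ccont g x -> Ccont (fun u => f u * g u)%C x.
Proof.
  intros [H1 H2] [H3 H4]. split.
  - exact (continuous_minus _ _ _ (continuous_mult _ _ _ H1 H3) (continuous_mult _ _ _ H2 H4)).
  - exact (continuous_plus _ _ _ (continuous_mult _ _ _ H1 H4) (continuous_mult _ _ _ H2 H3)).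
Qed.

Lemma continuous_Rinv_comp (f : R -> R) (x : R) :
  continuous f x -> f x <> 0 -> continuous (fun u => / f u) x.
Proof.
  intros H H0. apply continuity_pt_filterlim.
  apply (continuity_pt_inv f); [|easy]. now apply continuity_pt_filterlim.
Qed.

Lemma Ccont_inv (f : R -> C) (x : R) :
  Ccont f x -> f x <> 0 -> Ccont (fun u => / f u)%C x.
Proof.
  intros [H1 H2] H0.
  assert (Hn : Re (f x) ^ 2 + Im (f x) ^ 2 <> 0).
  { rewrite <- Cmod2_alt. apply Cmod_gt_0 in H0. nra. }
  assert (Hc : continuous (fun u => / (Re (f u) ^ 2 + Im (f u) ^ 2)) x).
  { apply (continuous_Rinv_comp (fun u => Re (f u) ^ 2 + Im (f u) ^ 2)); [|easy].
    apply (continuous_plus (fun u => Re (f u) ^ 2) (fun u => Im (f u) ^ 2)).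
    - apply (continuous_mult (fun u => Re (f u)) (fun u => Re (f u) * 1)); [easy|].
      apply (continuous_mult (fun u => Re (f u)) (fun _ => 1)); [easy|apply continuous_const].
    - apply (continuous_mult (fun u => Im (f u)) (fun u => Im (f u) * 1)); [easy|].
      apply (continuous_mult (fun u => Im (f u)) (fun _ => 1)); [easy|apply continuous_const]. }
  split.
  - exact (continuous_mult _ _ _ H1 Hc).
  - exact (continuous_mult _ _ _ (continuous_opp _ _ H2) Hc).
Qed.

Lemma Cderiv_is_derive (f : R -> C) (x : R) (d : C) :
  Cderiv f x d -> @is_derive R_AbsRing C_R_NormedModule f x d.
Proof.
  intros [H1 H2].
  assert (D1 := is_derive_scal_l (V := C_R_NormedModule) _ _ _ (RtoC 1) H1).
  assert (D2 := is_derive_scal_l (V := C_R_NormedModule) _ _ _ Ci H2).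
  assert (D := is_derive_plus (V := C_R_NormedModule) _ _ _ _ _ D1 D2).
  (* Every value is decomposed as [Re z * 1 + Im z * i], which turns componentwise derivatives into
     a derivative in the module. *)
  assert (E : forall z : C, @plus C_R_NormedModule (@scal _ C_R_NormedModule (Re z) (RtoC 1))
    (@scal _ C_R_NormedModule (Im z) Ci) = z).
  { intros z. apply C_ext; unfold plus, scal, RtoC, Ci; simpl;
    unfold prod_plus, prod_scal, scal, plus, mult; simpl; unfold mult; simpl; ring. }
  rewrite (E d) in D. eapply is_derive_ext; [|exact D]. intros u. apply E.
Qed.

Lemma is_RInt_C_derive (f df : R -> C) (a b : R) :
  a <= b -> (forall u, a <= u <= b -> Cderiv f u (df u)) ->
  (forall u, a <= u <= b -> Ccont df u) -> is_RInt_C df a b (f b - f a)%C.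
Proof.
  intros Hab H1 H2.
  apply (is_RInt_derive (V := C_R_CompleteNormedModule) f df a b);
  rewrite Rmin_left, Rmax_right by easy; intros u Hu.
  - now apply Cderiv_is_derive, H1.
  - now apply Ccont_continuous, H2.
Qed.

Lemma is_RInt_R_derive (f df : R -> R) (a b : R) :
  a <= b -> (forall u, a <= u <= b -> is_derive f u (df u)) ->
  (forall u, a <= u <= b -> continuous df u) -> is_RInt df a b (f b - f a).
Proof.
  intros Hab H1 H2.
  apply (is_RInt_derive f df a b); rewrite Rmin_left, Rmax_right by easy; easy.
Qed.

Lemma ex_RInt_Ccont (f : R -> C) (a b : R) :
  0 < a -> 0 < b -> (forall u, 0 < u -> Ccont f u) ->
  is_RInt_C f a b (@RInt C_R_CompleteNormedModule f a b).
Proof.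
  intros Ha Hb Hf. apply (RInt_correct (V := C_R_CompleteNormedModule)).
  apply (ex_RInt_continuous (V := C_R_CompleteNormedModule)). intros u Hu.
  apply Ccont_continuous, Hf. destruct Hu as [Hu _].
  eapply Rlt_le_trans; [|apply Hu]. now apply Rmin_glb_lt.
Qed.

Lemma improper_unique (g : R -> C) (I J : C) :
  is_improper_RInt g I -> is_improper_RInt g J -> I = J.
Proof.
  rewrite !improper_iff. intros H1 H2. apply Cmod_eps_eq. intros eps He.
  destruct (H1 (eps / 2)) as [d1 [M1 [Hd1 [HM1 K1]]]]; [lra|].
  destruct (H2 (eps / 2)) as [d2 [M2 [Hd2 [HM2 K2]]]]; [lra|].
  assert (Hm := Rmin_glb_lt d1 d2 0 (proj1 Hd1) (proj1 Hd2)).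
  assert (Hm1 := Rmin_l d1 d2). assert (Hm2 := Rmin_r d1 d2).
  assert (Hx1 := Rmax_l M1 M2). assert (Hx2 := Rmax_r M1 M2).
  destruct (K1 (Rmin d1 d2 / 2) (Rmax M1 M2 + 1)) as [y [Y1 Y2]]; try lra.
  destruct (K2 (Rmin d1 d2 / 2) (Rmax M1 M2 + 1)) as [y' [Y1' Y2']]; try lra.
  rewrite (is_RInt_C_unique _ _ _ _ _ Y1' Y1) in Y2'.
  replace (I - J)%C with ((I - y) + (y - J))%C by ring.
  eapply Rle_trans; [apply Cmod_triangle|]. rewrite (Cmod_minus_sym I y). lra.
Qed.

Lemma improper_ext (f g : R -> C) (J : C) :
  (forall u, 0 < u -> f u = g u) -> is_improper_RInt f J -> is_improper_RInt g J.
Proof.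
  rewrite !improper_iff. intros E H eps He.
  destruct (H eps He) as [d [M [Hd [HM K]]]]. exists d, M. split; [easy|split; [easy|]].
  intros a b Ha Hb. destruct (K a b Ha Hb) as [y [Y1 Y2]]. exists y. split; [|easy].
  eapply (is_RInt_ext (V := C_R_NormedModule)); [|apply Y1].
  intros u Hu. apply E. rewrite Rmin_left in Hu by lra. lra.
Qed.

Lemma improper_plus (f g : R -> C) (I J : C) :
  is_improper_RInt f I -> is_improper_RInt g J ->
  is_improper_RInt (fun u => f u + g u)%C (I + J)%C.
Proof.
  rewrite !improper_iff. intros H1 H2 eps He.
  destruct (H1 (eps / 2)) as [d1 [M1 [Hd1 [HM1 K1]]]]; [lra|].
  destruct (H2 (eps / 2)) as [d2 [M2 [Hd2 [HM2 K2]]]]; [lra|].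
  assert (Hm := Rmin_glb_lt d1 d2 0 (proj1 Hd1) (proj1 Hd2)).
  assert (Hm1 := Rmin_l d1 d2). assert (Hm2 := Rmin_r d1 d2).
  assert (Hx1 := Rmax_l M1 M2). assert (Hx2 := Rmax_r M1 M2).
  exists (Rmin d1 d2), (Rmax M1 M2). split; [lra|split; [lra|]].
  intros a b Ha Hb.
  destruct (K1 a b) as [y [Y1 Y2]]; try lra.
  destruct (K2 a b) as [y' [Y1' Y2']]; try lra.
  exists (y + y')%C. split; [now apply is_RInt_C_plus|].
  replace (y + y' - (I + J))%C with ((y - I) + (y' - J))%C by ring.
  eapply Rle_lt_trans; [apply Cmod_triangle|]. lra.
Qed.

Lemma improper_scal (f : R -> C) (k J : C) :
  is_improper_RInt f J -> is_improper_RInt (fun u => k * f u)%C (k * J)%C.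
Proof.
  rewrite !improper_iff. intros H eps He.
  assert (Hk := Cmod_ge_0 k).
  destruct (H (eps / (Cmod k + 1))) as [d [M [Hd [HM K]]]].
  { apply Rdiv_lt_0_compat; lra. }
  exists d, M. split; [easy|split; [easy|]].
  intros a b Ha Hb. destruct (K a b Ha Hb) as [y [Y1 Y2]].
  exists (k * y)%C. split; [now apply is_RInt_C_scal|].
  replace (k * y - k * J)%C with (k * (y - J))%C by ring. rewrite Cmod_mult.
  apply (Rmult_lt_compat_r (Cmod k + 1)) in Y2; [|lra].
  replace (eps / (Cmod k + 1) * (Cmod k + 1)) with eps in Y2 by (field; lra).
  assert (H0 := Cmod_ge_0 (y - J)). nra.
Qed.

Lemma improper_opp (f : R -> C) (J : C) :
  is_improper_RInt f J -> is_improper_RInt (fun u => - f u)%C (- J)%C.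
Proof.
  intros H. replace (- J)%C with (- (1) * J)%C by ring.
  eapply improper_ext; [|apply improper_scal, H]. intros u _; cbv beta; ring.
Qed.

Lemma improper_minus (f g : R -> C) (I J : C) :
  is_improper_RInt f I -> is_improper_RInt g J ->
  is_improper_RInt (fun u => f u - g u)%C (I - J)%C.
Proof. intros H1 H2. apply improper_plus; [|apply improper_opp]; easy. Qed.

(** The fundamental theorem of calculus on [a, b], with [a] sent to 0 and [b] to infinity. *)
Lemma improper_derive (f df : R -> C) (l0 loo : C) :
  (forall u, 0 < u -> Cderiv f u (df u)) -> (forall u, 0 < u -> Ccont df u) ->
  filterlim f (at_right 0) (locally l0) ->
  filterlim f (Rbar_locally p_infty) (locally loo) ->
  is_improper_RInt df (loo - l0)%C.
Proof.
  intros H1 H2 H3 H4. apply improper_iff. intros eps He.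
  destruct (proj1 (filterlim_C _ f l0) H3 (eps / 2)) as [d Hd]; [lra|].
  destruct (proj1 (filterlim_C _ f loo) H4 (eps / 2)) as [M HM]; [lra|].
  exists (Rmin d 1), (Rmax M 1). assert (Hl := Rmin_l d 1). assert (Hm := Rmax_l M 1).
  split; [|split; [apply Rmax_r|]].
  { split; [|apply Rmin_r]. apply Rmin_glb_lt; [apply cond_pos|lra]. }
  intros a b Ha Hb. exists (f b - f a)%C.
  assert (H5 := Rmin_r d 1). assert (H6 := Rmax_r M 1). split.
  - apply is_RInt_C_derive; [lra| |]; intros u Hu; [apply H1|apply H2]; lra.
  - assert (A : Cmod (f a - l0) < eps / 2).
    { apply Hd; [|easy]. apply Rabs_def1; unfold minus, plus, opp; simpl; lra. }
    assert (B : Cmod (f b - loo) < eps / 2) by (apply HM; lra).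
    replace (f b - f a - (loo - l0))%C with ((f b - loo) - (f a - l0))%C by ring.
    unfold Cminus at 1. eapply Rle_lt_trans; [apply Cmod_triangle|]. rewrite Cmod_opp. lra.
Qed.

(* The majorant [u^(s-1) / (1 + u^s)^2] has the antiderivative
   [- 1 / (s (1 + u^s))], so no gamma integral is needed to compare with it. *)
Definition power_majorant (s u : R) : R := exp ((s - 1) * ln u) / (1 + exp (s * ln u)) ^ 2.

Definition power_majorant_prim (s u : R) : R := - / (s * (1 + exp (s * ln u))).

Lemma power_majorant_derive (s u : R) : 0 < s -> 0 < u ->
  is_derive (power_majorant_prim s) u (power_majorant s u).
Proof.
  intros Hs Hu. unfold power_majorant_prim, power_majorant.
  assert (He := exp_pos (s * ln u)).
  auto_derive.
  - repeat split; try easy. apply Rmult_integral_contrapositive_currified; lra.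
  - replace ((s - 1) * ln u) with (s * ln u + - ln u) by ring.
    rewrite exp_plus, exp_Ropp, exp_ln by easy. field. repeat split; lra.
Qed.

Lemma power_majorant_cont (s u : R) : 0 < u -> continuous (power_majorant s) u.
Proof.
  intros Hu. apply (ex_derive_continuous (power_majorant s)). unfold power_majorant.
  assert (He := exp_pos (s * ln u)). auto_derive. repeat split; try easy. nra.
Qed.

Lemma power_majorant_RInt (s a b : R) :
  0 < s -> 0 < a <= b ->
  is_RInt (power_majorant s) a b (power_majorant_prim s b - power_majorant_prim s a).
Proof.
  intros Hs Hab. apply is_RInt_R_derive; [lra| |]; intros u Hu.
  - apply power_majorant_derive; lra.
  - apply power_majorant_cont; lra.
Qed.

Lemma power_majorant_prim_bounds (s u : R) : 0 < s -> - / s <= power_majorant_prim s u <= 0.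
Proof.
  intros Hs. unfold power_majorant_prim. assert (He := exp_pos (s * ln u)). split.
  - apply Ropp_le_contravar, Rinv_le_contravar; nra.
  - assert (0 < / (s * (1 + exp (s * ln u)))) by (apply Rinv_0_lt_compat; nra). lra.
Qed.

Lemma power_majorant_prim_small (s eps : R) : 0 < s -> 0 < eps ->
  exists d, 0 < d /\ forall a, 0 < a < d -> power_majorant_prim s a + / s <= eps.
Proof.
  (* The witness solves [d^s = eps * s]. *)
  intros Hs He. exists (exp (ln (eps * s) / s)). split; [apply exp_pos|]. intros a [Ha1 Ha2].
  assert (Hes : 0 < eps * s) by nra.
  assert (Hl : exp (s * ln a) <= eps * s).
  { rewrite <- (exp_ln (eps * s)) by easy. apply exp_le.
    apply ln_increasing in Ha2; [|easy]. rewrite ln_exp in Ha2.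
    apply Rlt_le in Ha2. apply (Rmult_le_compat_l s) in Ha2; [|lra].
    replace (s * (ln (eps * s) / s)) with (ln (eps * s)) in Ha2 by (field; lra). easy. }
  unfold power_majorant_prim. assert (H0 := exp_pos (s * ln a)).
  replace (- / (s * (1 + exp (s * ln a))) + / s) with
    (/ s * (exp (s * ln a) / (1 + exp (s * ln a)))) by (field; lra).
  replace eps with (/ s * (eps * s)) by (field; lra).
  apply Rmult_le_compat_l; [left; now apply Rinv_0_lt_compat|].
  apply Rle_div_l; nra.
Qed.

Lemma power_majorant_prim_large (s eps : R) : 0 < s -> 0 < eps ->
  exists M, 0 < M /\ forall b, M < b -> - eps <= power_majorant_prim s b.
Proof.
  (* The witness solves [M^s = 1 / (eps * s)]. *)
  intros Hs He. exists (exp (ln (/ (eps * s)) / s)). split; [apply exp_pos|]. intros b Hb.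
  assert (Hes : 0 < eps * s) by nra.
  assert (Hl : / (eps * s) <= exp (s * ln b)).
  { rewrite <- (exp_ln (/ (eps * s))) by now apply Rinv_0_lt_compat. apply exp_le.
    apply ln_increasing in Hb; [|apply exp_pos]. rewrite ln_exp in Hb.
    apply Rlt_le in Hb. apply (Rmult_le_compat_l s) in Hb; [|lra].
    replace (s * (ln (/ (eps * s)) / s)) with (ln (/ (eps * s))) in Hb by (field; lra). easy. }
  unfold power_majorant_prim. apply Ropp_le_contravar.
  assert (H0 := exp_pos (s * ln b)).
  replace eps with (/ (s * / (eps * s))) by (field; lra).
  assert (0 < / (eps * s)) by now apply Rinv_0_lt_compat.
  apply Rinv_le_contravar; nra.
Qed.

Lemma RInt_C_dominated_piece (g : R -> C) (K s a b : R) (y : C) :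
  0 < s -> (forall u, 0 < u -> Cmod (g u) <= K * power_majorant s u) ->
  0 < a <= b -> is_RInt_C g a b y ->
  Cmod y <= K * (power_majorant_prim s b - power_majorant_prim s a).
Proof.
  intros Hs Hd Hab Hy.
  apply (is_RInt_C_norm_le g (fun u => K * power_majorant s u) a b); try easy.
  - intros u Hu. apply Hd. lra.
  - apply is_RInt_R_scal, power_majorant_RInt; easy.
Qed.

(** The primitive of the majorant rises from [- 1 / s] to 0, so its total mass over the half-line is
    at most [1 / s]. *)
Lemma improper_norm_le (g : R -> C) (K s : R) (J : C) :
  0 < s -> 0 <= K -> (forall u, 0 < u -> Cmod (g u) <= K * power_majorant s u) ->
  is_improper_RInt g J -> Cmod J <= K / s.
Proof.
  intros Hs HK Hd HJ. apply le_epsilon. intros eps He.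
  destruct (proj1 (improper_iff g J) HJ eps He) as [d [M [Hd' [HM KK]]]].
  destruct (KK (d / 2) (M + 1)) as [y [Y1 Y2]]; [lra..|].
  assert (B := RInt_C_dominated_piece g K s (d/2) (M+1) y Hs Hd ltac:(lra) Y1).
  assert (B1 := power_majorant_prim_bounds s (d/2) Hs).
  assert (B2 := power_majorant_prim_bounds s (M+1) Hs).
  assert (T := Cmod_triangle y (J - y)). replace (y + (J - y))%C with J in T by ring.
  rewrite (Cmod_minus_sym J y) in T.
  assert (K * (power_majorant_prim s (M + 1) - power_majorant_prim s (d / 2)) <= K / s).
  { unfold Rdiv. apply Rmult_le_compat_l; lra. }
  lra.
Qed.

Lemma improper_exists (g : R -> C) (K s : R) :
  0 < s -> 0 <= K -> (forall u, 0 < u -> Ccont g u) ->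
  (forall u, 0 < u -> Cmod (g u) <= K * power_majorant s u) ->
  exists J, is_improper_RInt g J.
Proof.
  intros Hs HK Hc Hd.
  set (I := fun ab : R * R => @RInt C_R_CompleteNormedModule g (fst ab) (snd ab)).
  assert (HI : forall a b, 0 < a -> 0 < b -> is_RInt_C g a b (I (a, b))).
  { intros a b Ha Hb. now apply ex_RInt_Ccont. }
  assert (Cau : exists J : C, filterlim I (filter_prod (at_right 0) (Rbar_locally p_infty))
    (@locally C_UniformSpace J)).
  { apply (filterlim_locally_cauchy (U := C_R_CompleteNormedModule)). intros eps.
    (* Two end pieces, each at most [K * e], must add up to less than [eps]. *)
    set (e := eps / (4 * (K + 1))).
    assert (He : 0 < e) by (apply Rdiv_lt_0_compat; [apply cond_pos|lra]).
    destruct (power_majorant_prim_small s e Hs He) as [d [Hd0 Hd1]].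
    destruct (power_majorant_prim_large s e Hs He) as [M [HM0 HM1]].
    exists (fun ab => 0 < fst ab < d /\ M < snd ab). split.
    - apply Filter_prod with (fun a => 0 < a < d) (fun b => M < b).
      + exists (mkposreal d Hd0). intros y Hy Hy2. split; [easy|].
        apply Rabs_def2 in Hy. unfold minus, plus, opp in Hy; simpl in Hy. lra.
      + now exists M.
      + easy.
    - intros [a b] [a' b'] [Ha Hb] [Ha' Hb']. simpl in Ha, Hb, Ha', Hb'.
      (* The endpoints of an end piece come in either order, so the bound is first proved for
         [p <= q] and then transferred by reversing the integral. *)
      assert (P : forall p q, 0 < p -> 0 < q ->
        Rabs (power_majorant_prim s q - power_majorant_prim s p) <= e -> Cmod (I (p, q)) <= K * e).
      { assert (P0 : forall p q, 0 < p <= q ->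
          Rabs (power_majorant_prim s q - power_majorant_prim s p) <= e -> Cmod (I (p, q)) <= K * e).
        { intros p q Hpq Hle. eapply Rle_trans.
          - apply (RInt_C_dominated_piece g K s p q _ Hs Hd Hpq). apply HI; lra.
          - apply Rmult_le_compat_l; [easy|]. eapply Rle_trans; [apply Rle_abs|easy]. }
        intros p q Hp Hq Hle. destruct (Rle_lt_dec p q) as [Hpq|Hpq]; [now apply P0|].
        replace (I (p, q)) with (- I (q, p))%C.
        - rewrite Cmod_opp. apply P0; [lra|]. now rewrite Rabs_minus_sym.
        - apply (is_RInt_C_unique g p q); [|now apply HI].
          exact (is_RInt_swap (V := C_R_NormedModule) g p q _ (HI q p Hq Hp)). }
      (* Cauchy's criterion: the common middle part cancels, and one piece near 0 and one near
         infinity remain. *)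
      assert (E : (I (a', b') - I (a, b))%C = (I (a', a) + I (b, b'))%C).
      { assert (H1 := is_RInt_C_Chasles g a' a b _ _ (HI a' a ltac:(lra) ltac:(lra))
          (HI a b ltac:(lra) ltac:(lra))).
        assert (H2 := is_RInt_C_Chasles g a' b b' _ _ H1 (HI b b' ltac:(lra) ltac:(lra))).
        rewrite (is_RInt_C_unique _ _ _ _ _ (HI a' b' ltac:(lra) ltac:(lra)) H2). ring. }
      apply ball_C_of_Cmod. change (Cmod (I (a', b') - I (a, b)) < eps). rewrite E.
      eapply Rle_lt_trans; [apply Cmod_triangle|].
      assert (B1 : Cmod (I (a', a)) <= K * e).
      { apply P; [lra..|].
        assert (Q1 := Hd1 a Ha). assert (Q2 := Hd1 a' Ha').
        assert (Q3 := power_majorant_prim_bounds s a Hs). assert (Q4 := power_majorant_prim_bounds s a' Hs).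
        apply Rabs_le. lra. }
      assert (B2 : Cmod (I (b, b')) <= K * e).
      { apply P; [lra..|].
        assert (Q1 := HM1 b Hb). assert (Q2 := HM1 b' Hb').
        assert (Q3 := power_majorant_prim_bounds s b Hs). assert (Q4 := power_majorant_prim_bounds s b' Hs).
        apply Rabs_le. lra. }
      assert (E2 : 4 * (K + 1) * e = eps) by (unfold e; field; lra).
      nra. }
  destruct Cau as [J HJ]. exists J.
  unfold is_improper_RInt, is_RInt_gen.
  apply (filterlimi_locally (U := C_UniformSpace)). intros eps.
  assert (HJ' := proj1 (filterlim_locally (U := C_UniformSpace) I J) HJ eps).
  assert (Hpos : filter_prod (at_right 0) (Rbar_locally p_infty)
    (fun ab : R * R => 0 < fst ab /\ 0 < snd ab)).
  { apply Filter_prod with (fun a => 0 < a) (fun b => 0 < b); [|now exists 0|easy].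
    exists (mkposreal 1 Rlt_0_1). easy. }
  generalize (filter_and _ _ HJ' Hpos). apply filter_imp.
  intros [a b] [Hb [Ha1 Ha2]]. exists (I (a, b)). split; [|exact Hb].
  now apply HI.
Qed.

(** * Euler's integral *)

Lemma ln_le_sub_1 (x : R) : 0 < x -> ln x <= x - 1.
Proof.
  intros H. generalize (exp_ineq1_le (ln x)). rewrite exp_ln by easy. lra.
Qed.

(** The inequality [ln y <= y - 1] at [y = c u / a] gives the exact maximum, attained at
    [u = a / c]. The case [a = 0] is separate because of the quotient [c / a]. *)
Lemma power_exp_bound (a c : R) : 0 <= a -> 0 < c ->
  exists B, 0 <= B /\ forall u, 0 < u -> exp (a * ln u - c * u) <= B.
Proof.
  intros [Ha|<-] Hc.
  - exists (exp (- a - a * ln (c / a))). split; [left; apply exp_pos|].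
    intros u Hu. apply exp_le.
    assert (Hca : 0 < c / a) by now apply Rdiv_lt_0_compat.
    assert (H := ln_le_sub_1 (c / a * u) ltac:(nra)).
    rewrite ln_mult in H by easy.
    apply (Rmult_le_compat_l a) in H; [|lra].
    replace (a * (c / a * u - 1)) with (c * u - a) in H by (field; lra). lra.
  - exists 1. split; [lra|]. intros u Hu. rewrite <- exp_0. apply exp_le. nra.
Qed.

(** After multiplication by [(1 + u^s)^2 <= 2 + 2 u^(2s)], it suffices that [u^n e^(-cu)] and
    [u^(n+2s) e^(-cu)] are bounded. The powers [u^n] are needed because each differentiation in the
    parameter brings down a factor [u]. *)
Lemma power_exp_majorant (s c : R) (n : nat) : 0 < s -> 0 < c ->
  exists K, 0 <= K /\ forall u, 0 < u ->
    u ^ n * exp ((s - 1) * ln u - c * u) <= K * power_majorant s u.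
Proof.
  intros Hs Hc. assert (Hn := pos_INR n).
  destruct (power_exp_bound (INR n) c Hn Hc) as [B1 [HB1 K1]].
  destruct (power_exp_bound (INR n + 2 * s) c ltac:(lra) Hc) as [B2 [HB2 K2]].
  exists (2 * B1 + 2 * B2). split; [lra|]. intros u Hu.
  specialize (K1 u Hu). specialize (K2 u Hu).
  assert (Eu : u ^ n = exp (INR n * ln u)).
  { rewrite <- Rpower_pow by easy. reflexivity. }
  unfold power_majorant. set (v := exp (s * ln u)). assert (Hv : 0 < v) by apply exp_pos.
  unfold Rdiv. rewrite <- Rmult_assoc. apply (Rle_div_r _ _ ((1 + v) ^ 2)); [nra|].
  rewrite Eu. set (w := exp (INR n * ln u)). set (z := exp (- (c * u))).
  set (y := exp ((s - 1) * ln u)).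
  replace (exp (INR n * ln u - c * u)) with (w * z) in K1
    by (unfold w, z; rewrite <- exp_plus; f_equal; ring).
  replace (exp ((INR n + 2 * s) * ln u - c * u)) with (w * (v * v) * z) in K2
    by (unfold w, v, z; rewrite <- !exp_plus; f_equal; ring).
  replace (exp ((s - 1) * ln u - c * u)) with (y * z)
    by (unfold y, z; rewrite <- exp_plus; f_equal; ring).
  assert (Hw : 0 < w) by apply exp_pos. assert (Hz : 0 < z) by apply exp_pos.
  assert (Hy : 0 < y) by apply exp_pos.
  assert (H : w * z * (1 + v) ^ 2 <= 2 * B1 + 2 * B2).
  { assert (Hwz : 0 < w * z) by now apply Rmult_lt_0_compat.
    apply Rle_trans with (w * z * (2 + 2 * (v * v))); [|lra].
    apply Rmult_le_compat_l; [lra|]. assert (Hq := pow2_ge_0 (1 - v)). nra. }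
  replace (w * (y * z) * (1 + v) ^ 2) with (w * z * (1 + v) ^ 2 * y) by ring.
  apply Rmult_le_compat_r; lra.
Qed.

(* [u^(s-1) e^(-pu)] *)
Definition gker (s p : C) (u : R) : C := Cexp ((s - 1) * RtoC (ln u) - p * RtoC u).

Lemma Cmod_gker (s p : C) (u : R) :
  Cmod (gker s p u) = exp ((Re s - 1) * ln u - Re p * u).
Proof. unfold gker. rewrite Cmod_Cexp. f_equal. simpl. unfold Re. ring. Qed.

Lemma is_derive_ln' (u : R) : 0 < u -> is_derive ln u (/ u).
Proof. intros H. apply is_derive_Reals. now apply derivable_pt_lim_ln. Qed.

Lemma Cderiv_scal (k : C) (f : R -> C) (x : R) (d : C) :
  Cderiv f x d -> Cderiv (fun u => k * f u)%C x (k * d)%C.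
Proof.
  intros H. eapply Cderiv_eq; [apply Cderiv_mult; [apply Cderiv_const|apply H]|].
  cbv beta. ring.
Qed.

Lemma Cderiv_minus (f g : R -> C) (x : R) (df dg : C) :
  Cderiv f x df -> Cderiv g x dg -> Cderiv (fun u => f u - g u)%C x (df - dg)%C.
Proof. intros [H1 H2] [H3 H4]. split; now apply @is_derive_minus. Qed.

Lemma Cderiv_id (x : R) : Cderiv (fun u => RtoC u) x 1.
Proof. exact (Cderiv_RtoC _ _ _ (is_derive_id x)). Qed.

Lemma Cderiv_affine_log (a p : C) (u : R) : 0 < u ->
  Cderiv (fun u => a * RtoC (ln u) - p * RtoC u)%C u (a * RtoC (/ u) - p)%C.
Proof.
  intros H. eapply Cderiv_eq; [apply Cderiv_minus; apply Cderiv_scal|].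
  - now apply Cderiv_RtoC, is_derive_ln'.
  - apply Cderiv_id.
  - ring.
Qed.

Lemma gker_deriv (s p : C) (u : R) : 0 < u ->
  Cderiv (gker s p) u (((s - 1) * RtoC (/ u) - p) * gker s p u)%C.
Proof. intros H. apply Cderiv_exp. now apply Cderiv_affine_log. Qed.

Lemma gker_cont (s p : C) (u : R) : 0 < u -> Ccont (gker s p) u.
Proof. intros H. eapply Cderiv_cont, gker_deriv, H. Qed.

Lemma Ccont_const (c : C) (u : R) : Ccont (fun _ => c) u.
Proof. exact (Cderiv_cont _ _ _ (Cderiv_const c u)). Qed.

Lemma Ccont_id (u : R) : Ccont (fun u => RtoC u) u.
Proof. exact (Cderiv_cont _ _ _ (Cderiv_RtoC _ _ _ (is_derive_id u))). Qed.

Lemma gker_succ (s p : C) (u : R) : 0 < u -> gker (s + 1) p u = (RtoC u * gker s p u)%C.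
Proof.
  intros H. unfold gker. rewrite <- (exp_ln u) at 3 by easy.
  rewrite <- Cexp_RtoC, <- Cexp_plus. f_equal. ring.
Qed.

Lemma gker_integrable (s p : C) : 0 < Re s -> 0 < Re p ->
  exists J, is_improper_RInt (gker s p) J.
Proof.
  intros Hs Hp. destruct (power_exp_majorant (Re s) (Re p) 0 Hs Hp) as [K [HK0 HK]].
  apply (improper_exists _ K (Re s)); try easy.
  - apply gker_cont.
  - intros u Hu. rewrite Cmod_gker. specialize (HK u Hu). simpl in HK. lra.
Qed.

Lemma RInt_gen_improper (g : R -> C) (J : C) : is_improper_RInt g J ->
  @RInt_gen C_R_CompleteNormedModule g (at_right 0) (Rbar_locally p_infty) = J.
Proof.
  intros H. exact (is_RInt_gen_unique (V := C_R_CompleteNormedModule) g J H).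
Qed.

(** The integrand is the derivative of [u^s e^(-pu)], which vanishes at both ends. The case [p = 1]
    is the functional equation of Gamma; general [p] yields the dependence on the parameter. *)
Lemma gker_boundary (s p : C) : 0 < Re s -> 0 < Re p ->
  is_improper_RInt (fun u => (s - p * RtoC u) * gker s p u)%C 0.
Proof.
  intros Hs Hp. replace (RtoC 0) with (0 - 0)%C by ring.
  assert (M : forall u, Cmod (Cexp (s * RtoC (ln u) - p * RtoC u)) =
    exp (Re s * ln u - Re p * u)).
  { intros u. rewrite Cmod_Cexp. f_equal. simpl. unfold Re. ring. }
  apply (improper_derive (fun u => Cexp (s * RtoC (ln u) - p * RtoC u))).
  - intros u Hu. eapply Cderiv_eq; [apply Cderiv_exp, Cderiv_affine_log, Hu|].
    unfold gker. replace ((s - 1) * RtoC (ln u) - p * RtoC u)%C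
      with ((s * RtoC (ln u) - p * RtoC u) + - RtoC (ln u))%C by ring.
    rewrite Cexp_plus, <- RtoC_opp, Cexp_RtoC, exp_Ropp, exp_ln by easy.
    set (e := Cexp (s * RtoC (ln u) - p * RtoC u)).
    transitivity ((s * RtoC (/ u) - p * (RtoC u * RtoC (/ u))) * e)%C; [|ring].
    rewrite <- RtoC_mult, Rinv_r by lra. ring.
  - intros u Hu. apply Ccont_mult; [|now apply gker_cont].
    apply Ccont_plus; [apply Ccont_const|].
    apply (Cderiv_cont _ _ (0 - p * 1)%C).
    apply (Cderiv_ext (fun u => 0 - p * RtoC u)%C).
    { apply filter_forall. intros v. ring. }
    apply Cderiv_minus; [apply Cderiv_const|apply Cderiv_scal, Cderiv_id].
  - apply (filterlim_C (at_right 0)). intros eps He.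
    (* The radius is [eps^(1 / Re s)]. The exponential factor only helps, since [Re p > 0]. *)
    exists (mkposreal _ (exp_pos (ln eps / Re s))). simpl. intros u Hu Hu0.
    apply Rabs_def2 in Hu. unfold minus, plus, opp in Hu; simpl in Hu.
    replace (Cexp _ - 0)%C with (Cexp (s * RtoC (ln u) - p * RtoC u)) by ring. rewrite M.
    rewrite <- (exp_ln eps) by easy. apply exp_increasing.
    assert (Hl : ln u < ln eps / Re s).
    { rewrite <- (ln_exp (ln eps / Re s)). apply ln_increasing; lra. }
    apply (Rmult_lt_compat_l (Re s)) in Hl; [|easy].
    replace (Re s * (ln eps / Re s)) with (ln eps) in Hl by (field; lra). nra.
  - apply (filterlim_C (Rbar_locally p_infty)). intros eps He.
    (* One extra power of [u] is bounded, so that dividing by it gives decay like [B / u]. *)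
    destruct (power_exp_bound (Re s + 1) (Re p) ltac:(lra) Hp) as [B [HB HB']].
    exists (Rmax 1 (B / eps)). intros u Hu.
    assert (H1 := Rmax_l 1 (B / eps)). assert (H2 := Rmax_r 1 (B / eps)).
    replace (Cexp _ - 0)%C with (Cexp (s * RtoC (ln u) - p * RtoC u)) by ring. rewrite M.
    specialize (HB' u ltac:(lra)).
    replace ((Re s + 1) * ln u - Re p * u) with ((Re s * ln u - Re p * u) + ln u) in HB' by ring.
    rewrite exp_plus, exp_ln in HB' by lra.
    apply (Rmult_lt_reg_r u); [lra|].
    apply Rle_lt_trans with B; [easy|].
    apply (Rmult_lt_reg_r (/ eps)); [now apply Rinv_0_lt_compat|].
    replace (eps * u * / eps) with u by (field; lra).
    change (B / eps < u). lra.
Qed.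

(** Cutting [0, 1] into [n] equal steps bounds the total increment by [n * K / n^2 = K / n]. This
    takes the place of differentiating an improper integral with respect to a parameter. *)
Lemma quadratic_variation_const (f : R -> C) (K : R) :
  (forall x y, 0 <= x <= 1 -> 0 <= y <= 1 -> Cmod (f y - f x) <= K * (y - x) ^ 2) ->
  f 1 = f 0.
Proof.
  intros H. apply Cmod_eps_eq. intros eps He.
  assert (HK : 0 <= K).
  { specialize (H 0 1 ltac:(lra) ltac:(lra)). assert (H0 := Cmod_ge_0 (f 1 - f 0)). lra. }
  destruct (nfloor_ex (K / eps)) as [N [_ HN]]; [apply Rdiv_le_0_compat; lra|].
  rewrite <- S_INR in HN. set (n := S N) in *.
  assert (Hn : 0 < INR n) by apply (lt_0_INR n (Nat.lt_0_succ N)).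
  assert (T : forall k, (k <= n)%nat ->
    Cmod (f (INR k / INR n) - f 0) <= INR k * (K / INR n ^ 2)).
  { intros k. induction k as [|k IH]; intros Hk.
    - change (INR 0) with 0. replace (0 / INR n) with 0 by (field; lra).
      replace (f 0 - f 0)%C with (RtoC 0) by ring. rewrite Cmod_0. lra.
    - assert (Hk' := le_INR _ _ Hk). rewrite S_INR in *. assert (Hk0 := pos_INR k).
      set (r1 := (INR k + 1) / INR n). set (r0 := INR k / INR n) in *.
      assert (B : Cmod (f r1 - f r0) <= K / INR n ^ 2).
      { eapply Rle_trans; [apply H|].
        - split; [apply Rdiv_le_0_compat; lra|apply Rle_div_l; lra].
        - split; [apply Rdiv_le_0_compat; lra|apply Rle_div_l; lra].
        - right. unfold r1, r0. field. lra. }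
      replace (f r1 - f 0)%C with ((f r1 - f r0) + (f r0 - f 0))%C by ring.
      eapply Rle_trans; [apply Cmod_triangle|].
      specialize (IH ltac:(lia)). lra. }
  specialize (T n (Nat.le_refl n)). replace (INR n / INR n) with 1 in T by (field; lra).
  eapply Rle_trans; [apply T|]. replace (INR n * (K / INR n ^ 2)) with (K / INR n) by (field; lra).
  apply Rle_div_l; [easy|]. apply Rlt_le, (Rmult_le_compat_r eps) in HN; [|lra].
  replace (K / eps * eps) with K in HN by (field; lra). lra.
Qed.

(* Along [p = e^(th z)] the integrand [e^(s th z) u^(s-1) e^(-pu)] satisfies
   [d/dth = z d/du (u * integrand)], whose integral over the half-line is 0. *)
Lemma gker_improper_scaling (s p I J : C) : 0 < Re s -> 0 < Re p ->
  is_improper_RInt (gker s 1) I -> is_improper_RInt (gker s p) J ->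
  J = (I * Cexp (- s * Clog p))%C.
Proof.
  intros Hs Hp HI HJ. set (z := Clog p).
  assert (Hp0 : p <> 0) by (intros E; rewrite E in Hp; simpl in Hp; lra).
  assert (Ez : Cexp z = p) by now apply Cexp_Clog.
  assert (Hz := Carg_right_strict p Hp). change (Carg p) with (Im z) in Hz.
  clearbody z.
  set (P := fun th : R => Cexp (RtoC th * z)).
  (* A lower bound for [Re (P th)] along the whole path: [Im z] is the argument of [p], smaller than
     [PI / 2] in absolute value, and [cos] decreases on [0, PI / 2]. *)
  set (c := exp (- Cmod z) * cos (Im z)).
  assert (Hcos : 0 < cos (Im z)) by (apply cos_gt_0; lra).
  assert (Hc : 0 < c) by (apply Rmult_lt_0_compat; [apply exp_pos|easy]).
  assert (Hzm := Cmod_ge_0 z).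
  assert (HPc : forall th, 0 <= th <= 1 -> c <= Re (P th)).
  { intros th Hth. unfold P, Cexp.
    replace (RtoC th * z)%C with ((th * Re z, th * Im z) : C) by (apply C_ext; simpl; unfold Re, Im; ring).
    change (c <= exp (th * Re z) * cos (th * Im z)).
    assert (Hr := re_le_Cmod z). apply Rabs_le_between in Hr.
    assert (Ht : th * (- Cmod z) <= th * Re z) by (apply Rmult_le_compat_l; lra).
    unfold c. apply Rmult_le_compat; [left; apply exp_pos|lra|apply exp_le; nra|].
    assert (cos_Rabs : forall x, cos (Rabs x) = cos x).
    { intros x. unfold Rabs. destruct Rcase_abs; [apply cos_neg|easy]. }
    rewrite <- (cos_Rabs (Im z)), <- (cos_Rabs (th * Im z)).
    assert (Ha : Rabs (Im z) <= PI / 2) by (apply Rabs_le; lra).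
    assert (Hb := Rabs_pos (Im z)). assert (Hpi := PI_RGT_0).
    rewrite Rabs_mult, (Rabs_pos_eq th) by lra.
    apply cos_decr_1; nra. }
  assert (HPQ : forall th, 0 <= th <= 1 -> Cmod (P th) <= exp (Cmod z)).
  { intros th Hth. eapply Rle_trans; [apply Cexp_le|]. apply exp_le.
    rewrite Cmod_mult, Cmod_pos_RtoC by lra. nra. }
  set (E := fun th u => (Cexp (s * (RtoC th * z)) * gker s (P th) u)%C).
  assert (HPs : forall th, 0 <= th <= 1 -> 0 < Re (P th)).
  { intros th Hth. specialize (HPc th Hth). lra. }
  assert (DP : forall th, Cderiv P th (z * P th)%C).
  { intros th. apply Cderiv_exp. eapply Cderiv_eq.
    - apply Cderiv_mult; [apply Cderiv_RtoC; exact (is_derive_id th)|apply Cderiv_const].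
    - change (RtoC 1 * z + RtoC th * 0 = z)%C. ring. }
  assert (DE : forall u th, Cderiv (fun th => E th u) th
    (z * (s - P th * RtoC u) * E th u)%C).
  { intros u th. eapply Cderiv_ext with (f := fun th =>
      Cexp (s * (RtoC th * z) + ((s - 1) * RtoC (ln u) + P th * (- RtoC u)))).
    { apply filter_forall. intros v. unfold E, gker. rewrite <- Cexp_plus. f_equal. ring. }
    eapply Cderiv_eq.
    - apply Cderiv_exp. apply Cderiv_plus; [apply Cderiv_mult; [apply Cderiv_const|]|].
      + apply Cderiv_mult; [apply Cderiv_RtoC; exact (is_derive_id th)|apply Cderiv_const].
      + apply Cderiv_plus; [apply Cderiv_const|].
        apply Cderiv_mult; [apply DP|apply Cderiv_const].
    - unfold E, gker. rewrite <- Cexp_plus. cbv beta. change (RtoC one) with (RtoC 1).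
      replace ((s - 1) * RtoC (ln u) - P th * RtoC u)%C with
        ((s - 1) * RtoC (ln u) + P th * (- RtoC u))%C by ring. ring. }
  set (D1 := fun th u => (z * (s - P th * RtoC u) * E th u)%C).
  (* The factor of [E] in the second derivative in [th]. It is quadratic in [u], which is why
     majorants with [n = 0, 1, 2] are taken below. *)
  set (D2 := fun th u => ((z * (s - P th * RtoC u)) * (z * (s - P th * RtoC u))
    - z * z * P th * RtoC u)%C).
  assert (DD : forall u th, Cderiv (fun th => D1 th u) th (D2 th u * E th u)%C).
  { intros u th. eapply Cderiv_ext with (f := fun th =>
      ((z * s + P th * (- (z * RtoC u))) * E th u)%C).
    { apply filter_forall. intros v. unfold D1. ring. }
    eapply Cderiv_eq.
    - apply Cderiv_mult; [|apply DE]. apply Cderiv_plus; [apply Cderiv_const|].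
      apply Cderiv_mult; [apply DP|apply Cderiv_const].
    - cbv beta. unfold D2. ring. }
  destruct (power_exp_majorant (Re s) c 0 Hs Hc) as [K0 [HK0 K0']].
  destruct (power_exp_majorant (Re s) c 1 Hs Hc) as [K1 [HK1 K1']].
  destruct (power_exp_majorant (Re s) c 2 Hs Hc) as [K2 [HK2 K2']].
  set (Q := exp (Cmod z)). assert (HQ : 0 < Q) by apply exp_pos.
  set (m := Cmod z) in *. set (S0 := exp (Cmod s * m)).
  assert (HS0 : 0 < S0) by apply exp_pos. assert (Hsm := Cmod_ge_0 s).
  set (A0 := m ^ 2 * Cmod s ^ 2). set (A1 := m ^ 2 * (2 * Cmod s * Q + Q)).
  set (A2 := m ^ 2 * Q ^ 2).
  assert (HA0 : 0 <= A0) by (unfold A0; nra).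
  assert (HA1 : 0 <= A1) by (unfold A1; apply Rmult_le_pos; nra).
  assert (HA2 : 0 <= A2) by (unfold A2; nra).
  set (K := S0 * (A0 * K0 + A1 * K1 + A2 * K2)).
  assert (HK : 0 <= K) by (unfold K; apply Rmult_le_pos; [lra|nra]).
  assert (BE : forall th u, 0 <= th <= 1 -> 0 < u ->
    Cmod (E th u) <= S0 * exp ((Re s - 1) * ln u - c * u)).
  { intros th u Hth Hu. unfold E. rewrite Cmod_mult, Cmod_gker.
    apply Rmult_le_compat; [apply Cmod_ge_0|left; apply exp_pos| |].
    - eapply Rle_trans; [apply Cexp_le|]. apply exp_le.
      rewrite !Cmod_mult, Cmod_pos_RtoC by lra. fold m. apply Rmult_le_compat_l; nra.
    - apply exp_le. specialize (HPc th Hth). nra. }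
  assert (BD : forall th u, 0 <= th <= 1 -> 0 < u -> Cmod (D2 th u * E th u) <= K * power_majorant (Re s) u).
  { intros th u Hth Hu. rewrite Cmod_mult.
    assert (HP := HPQ th Hth). fold Q in HP. assert (HP0 := Cmod_ge_0 (P th)).
    assert (B2 : Cmod (D2 th u) <= A0 + A1 * u + A2 * u ^ 2).
    { unfold D2, Cminus at 1. eapply Rle_trans; [apply Cmod_triangle|].
      rewrite Cmod_opp, !Cmod_mult, Cmod_pos_RtoC by lra. fold m.
      assert (T : Cmod (s - P th * RtoC u) <= Cmod s + Q * u).
      { unfold Cminus. eapply Rle_trans; [apply Cmod_triangle|].
        rewrite Cmod_opp, Cmod_mult, Cmod_pos_RtoC by lra. nra. }
      assert (T0 := Cmod_ge_0 (s - P th * RtoC u)).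
      assert (T2 : Cmod (s - P th * RtoC u) * Cmod (s - P th * RtoC u)
        <= (Cmod s + Q * u) * (Cmod s + Q * u)) by (apply Rmult_le_compat; lra).
      assert (T3 : Cmod (P th) * u <= Q * u) by nra.
      assert (Hm2 : 0 <= m * m) by nra.
      apply (Rmult_le_compat_l _ _ _ Hm2) in T2. apply (Rmult_le_compat_l _ _ _ Hm2) in T3.
      unfold A0, A1, A2. nra. }
    specialize (BE th u Hth Hu). specialize (K0' u Hu). specialize (K1' u Hu).
    specialize (K2' u Hu). rewrite pow_1 in K1'. rewrite pow_O, Rmult_1_l in K0'.
    set (e := exp ((Re s - 1) * ln u - c * u)) in *.
    apply Rle_trans with ((A0 + A1 * u + A2 * u ^ 2) * (S0 * e)).
    { apply Rmult_le_compat; [apply Cmod_ge_0|apply Cmod_ge_0|easy|easy]. }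
    apply (Rmult_le_compat_l _ _ _ HA0) in K0'. apply (Rmult_le_compat_l _ _ _ HA1) in K1'.
    apply (Rmult_le_compat_l _ _ _ HA2) in K2'.
    replace ((A0 + A1 * u + A2 * u ^ 2) * (S0 * e)) with
      (S0 * (A0 * e + A1 * (u * e) + A2 * (u ^ 2 * e))) by ring.
    unfold K. rewrite (Rmult_assoc S0). apply Rmult_le_compat_l; [lra|]. lra. }
  set (Psi := fun th : R => (Cexp (s * (RtoC th * z)) *
    @RInt_gen C_R_CompleteNormedModule (gker s (P th)) (at_right 0) (Rbar_locally p_infty))%C).
  assert (HPsi : forall th, 0 <= th <= 1 -> is_improper_RInt (E th) (Psi th)).
  { intros th Hth. apply improper_scal.
    destruct (gker_integrable s (P th) Hs (HPs th Hth)) as [V HV].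
    rewrite (RInt_gen_improper _ _ HV). exact HV. }
  (* Taylor's estimate under the integral: the second-order part is dominated uniformly in [th], and
     the first-order part integrates to 0. *)
  assert (Hend : Psi 1 = Psi 0).
  { apply (quadratic_variation_const Psi (2 * K / Re s)). intros x y Hx Hy.
    replace (2 * K / Re s * (y - x) ^ 2) with (2 * K * (y - x) ^ 2 / Re s) by (field; lra).
    apply (improper_norm_le (fun u => E y u - E x u - RtoC (y - x) * D1 x u)%C); [easy| | |].
    - apply Rmult_le_pos; [lra|apply pow2_ge_0].
    - intros u Hu.
      replace (2 * K * (y - x) ^ 2 * power_majorant (Re s) u) with
        (2 * (K * power_majorant (Re s) u) * (y - x) ^ 2) by ring.
      apply (taylor2_C (fun th => E th u) (fun th => D1 th u) (fun th => D2 th u * E th u)%C).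
      + intros th _. apply DE.
      + intros th _. apply DD.
      + intros th Hth. apply BD; [|easy].
        unfold Rmin, Rmax in Hth. destruct (Rle_dec x y); lra.
    (* The inserted zero is the integral of the first-order Taylor term [D1 x u], by
       [gker_boundary]. *)
    - replace (Psi y - Psi x)%C with (Psi y - Psi x - RtoC (y - x) *
        (z * Cexp (s * (RtoC x * z)) * 0))%C by ring.
      apply improper_minus; [apply improper_minus; now apply HPsi|].
      apply improper_scal.
      eapply improper_ext; [|apply improper_scal, gker_boundary; [apply Hs|apply (HPs x Hx)]].
      intros u _. unfold D1, E. ring. }
  assert (H1 := HPsi 1 ltac:(lra)). assert (H0 := HPsi 0 ltac:(lra)).
  assert (EP1 : P 1 = p) by (unfold P; replace (RtoC 1 * z)%C with z by ring; easy).
  assert (EP0 : P 0 = 1) by (unfold P; replace (RtoC 0 * z)%C with (RtoC 0) by ring; apply Cexp_0).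
  unfold E in H1, H0. rewrite EP1 in H1. rewrite EP0 in H0.
  assert (U1 := improper_unique _ _ _ H1 (improper_scal _ _ _ HJ)).
  assert (U0 := improper_unique _ _ _ H0 (improper_scal _ _ _ HI)).
  rewrite <- Hend, U1 in U0.
  replace (s * (RtoC 0 * z))%C with (RtoC 0) in U0 by ring. rewrite Cexp_0 in U0.
  replace (s * (RtoC 1 * z))%C with (s * z)%C in U0 by ring.
  replace (- s * z)%C with (- (s * z))%C by ring. rewrite Cexp_opp.
  replace I with (1 * I)%C by ring. rewrite <- U0. field. apply Cexp_neq_0.
Qed.

Lemma CGamma_correct (s : C) : 0 < Re s -> is_improper_RInt (gker s 1) (CGamma s).
Proof.
  intros Hs. destruct (gker_integrable s 1 Hs) as [V HV]; [simpl; lra|].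
  replace (CGamma s) with V; [easy|]. symmetry. unfold CGamma. apply RInt_gen_improper.
  eapply improper_ext; [|apply HV]. intros u Hu.
  unfold gker, Cpower. rewrite Clog_pos by easy. rewrite <- Cexp_plus. f_equal. ring.
Qed.

Lemma gker_improper (s p : C) : 0 < Re s -> 0 < Re p ->
  is_improper_RInt (gker s p) (CGamma s * Cpower p (- s))%C.
Proof.
  intros Hs Hp. destruct (gker_integrable s p Hs Hp) as [V HV].
  unfold Cpower.
  rewrite <- (gker_improper_scaling s p (CGamma s) V Hs Hp (CGamma_correct s Hs) HV). easy.
Qed.

Lemma CGamma_succ (s : C) : 0 < Re s -> CGamma (s + 1) = (s * CGamma s)%C.
Proof.
  intros Hs.
  assert (H1 := improper_scal _ s _ (CGamma_correct s Hs)).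
  assert (H2 : is_improper_RInt (gker (s + 1) 1) (CGamma (s + 1))).
  { apply CGamma_correct. rewrite Re_plus, Re_RtoC. lra. }
  assert (H3 := gker_boundary s 1 Hs ltac:(simpl; lra)).
  assert (H4 : is_improper_RInt (fun u => s * gker s 1 u - gker (s + 1) 1 u)%C 0).
  { eapply improper_ext; [|apply H3]. intros u Hu. cbv beta. rewrite gker_succ by easy. ring. }
  assert (H5 := improper_unique _ _ _ H4 (improper_minus _ _ _ _ H1 H2)).
  replace (CGamma (s + 1)) with (s * CGamma s - (s * CGamma s - CGamma (s + 1)))%C by ring.
  rewrite <- H5. ring.
Qed.

(** * Nonvanishing of the gamma function *)

Lemma improper_Re_ge (g : R -> C) (J : C) (m : R) :
  is_improper_RInt g J -> (forall u, 0 < u -> Ccont g u) ->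
  (forall u, 0 < u -> 0 <= Re (g u)) -> (forall u, 1 <= u <= 2 -> m <= Re (g u)) ->
  m <= Re J.
Proof.
  intros HJ Hc H0 Hm. apply le_epsilon. intros eps He.
  destruct (proj1 (improper_iff g J) HJ eps He) as [d [M [Hd [HM KK]]]].
  destruct (KK (d / 2) (M + 2)) as [y [Y1 Y2]]; [lra..|].
  assert (I1 := ex_RInt_Ccont g (d / 2) 1 ltac:(lra) ltac:(lra) Hc).
  assert (I2 := ex_RInt_Ccont g 1 2 ltac:(lra) ltac:(lra) Hc).
  assert (I3 := ex_RInt_Ccont g 2 (M + 2) ltac:(lra) ltac:(lra) Hc).
  assert (E := is_RInt_C_unique _ _ _ _ _ Y1
    (is_RInt_C_Chasles _ _ _ _ _ _ (is_RInt_C_Chasles _ _ _ _ _ _ I1 I2) I3)).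
  apply is_RInt_C_iff in I1. apply is_RInt_C_iff in I2. apply is_RInt_C_iff in I3.
  apply (f_equal Re) in E. rewrite !Re_plus in E.
  apply proj1 in I1. apply proj1 in I2. apply proj1 in I3.
  apply is_RInt_ge_0 in I1; [|lra|intros u Hu; apply H0; lra].
  apply is_RInt_ge_0 in I3; [|lra|intros u Hu; apply H0; lra].
  (* The window [1, 2] has length 1, so the lower bound [m] passes to the integral unchanged;
     outside it nonnegativity is enough. *)
  assert (L2 : (2 - 1) * m <= Re (@RInt C_R_CompleteNormedModule g 1 2)).
  { apply (is_RInt_le (fun _ => m) (fun u => Re (g u)) 1 2 _ _); [lra| |exact I2|].
    - exact (is_RInt_const 1 2 m).
    - intros u Hu. apply Hm. lra. }
  assert (T := re_le_Cmod (y - J)). apply Rabs_le_between in T.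
  unfold Cminus in T; rewrite Re_plus, Re_opp in T. unfold Cminus in Y2. lra.
Qed.

Lemma gker_real (a u : R) : gker (RtoC a) 1 u = RtoC (exp ((a - 1) * ln u - u)).
Proof.
  unfold gker. rewrite <- Cexp_RtoC. f_equal. apply C_ext; simpl; ring.
Qed.

Lemma CGamma_real_pos (a : R) : 0 < a -> 0 < Re (CGamma (RtoC a)).
Proof.
  (* On [1, 2] one has [0 <= ln u <= 1] and [u <= 2], which bounds the exponent below by
     [- |a - 1| - 2]. *)
  intros Ha. apply Rlt_le_trans with (exp (- Rabs (a - 1) - 2)); [apply exp_pos|].
  apply (improper_Re_ge (gker (RtoC a) 1)).
  - now apply CGamma_correct.
  - apply gker_cont.
  - intros u _. rewrite gker_real, Re_RtoC. left. apply exp_pos.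
  - intros u Hu. rewrite gker_real, Re_RtoC. apply exp_le.
    assert (H1 := ln_le_sub_1 u ltac:(lra)).
    assert (H2 : 0 <= ln u) by (rewrite <- ln_1; apply ln_le; lra).
    unfold Rabs; destruct Rcase_abs; nra.
Qed.

Lemma one_minus_cos_le (x : R) : 1 - cos x <= x ^ 2 / 2.
Proof.
  replace x with (2 * (x / 2)) at 1 by field. rewrite cos_2a_sin.
  assert (H : Rabs (sin (x / 2)) <= Rabs (x / 2)).
  { destruct (Rtotal_order (x / 2) 0) as [Hx|[Hx|Hx]].
    - destruct (Rle_lt_dec (-1) (x / 2)) as [Hy|Hy].
      + assert (S1 := sin_lt_x (- (x / 2)) ltac:(lra)). rewrite sin_neg in S1.
        assert (S2 : 0 < sin (- (x / 2))).
        { apply sin_gt_0; generalize PI2_3_2; lra. }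
        rewrite sin_neg in S2. rewrite !Rabs_left; lra.
      + assert (B := SIN_bound (x / 2)). rewrite (Rabs_left (x / 2)) by easy.
        apply Rabs_le. lra.
    - rewrite Hx, sin_0. lra.
    - destruct (Rle_lt_dec (x / 2) 1) as [Hy|Hy].
      + assert (S1 := sin_lt_x (x / 2) Hx).
        assert (S2 : 0 < sin (x / 2)).
        { apply sin_gt_0; generalize PI2_3_2; lra. }
        rewrite !Rabs_pos_eq; lra.
      + assert (B := SIN_bound (x / 2)). rewrite (Rabs_pos_eq (x / 2)) by lra.
        apply Rabs_le. lra. }
  assert (H2 : sin (x / 2) ^ 2 <= (x / 2) ^ 2).
  { rewrite <- (pow2_abs (sin (x / 2))), <- (pow2_abs (x / 2)).
    apply pow_incr. split; [apply Rabs_pos|easy]. }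
  nra.
Qed.

(** With [y = z^2] the right side is [4 (z - 1/z)^2], and [|ln z| <= |z - 1/z|] follows from
    [ln v <= v - 1] at [z] or [1/z]. This form is chosen because [u], 1 and [1/u] integrate against
    a gamma density to shifted values of Gamma. *)
Lemma sqr_ln_le (y : R) : 0 < y -> ln y ^ 2 <= 4 * (y - 2 + / y).
Proof.
  intros Hy. set (z := exp (ln y / 2)). assert (Hz : 0 < z) by apply exp_pos.
  assert (Ey : y = z * z).
  { unfold z. rewrite <- exp_plus. replace (ln y / 2 + ln y / 2) with (ln y) by field.
    now rewrite exp_ln. }
  assert (El : ln y = 2 * ln z) by (unfold z; rewrite ln_exp; field).
  rewrite El, Ey.
  replace (z * z - 2 + / (z * z)) with ((z - / z) ^ 2) by (field; lra).
  assert (L1 := ln_le_sub_1 z Hz).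
  assert (Hi : 0 < / z) by now apply Rinv_0_lt_compat.
  assert (L2 := ln_le_sub_1 (/ z) Hi). rewrite ln_Rinv in L2 by easy.
  assert (Hzi : z * / z = 1) by (field; lra).
  destruct (Rle_lt_dec 1 z) as [H|H].
  - assert (0 <= ln z) by (rewrite <- ln_1; apply ln_le; lra).
    assert (/ z <= 1) by nra. nra.
  - assert (ln z <= 0) by (rewrite <- ln_1; apply ln_le; lra).
    assert (1 <= / z) by nra. nra.
Qed.

(* For large [a] the gamma density of parameter [a] concentrates at [u = a], so
   [(u/a)^(i tau)] integrates against it to something close to 1. *)
Lemma CGamma_neq_0_large (a tau : R) : 1 + 2 * tau ^ 2 < a -> CGamma (a, tau) <> 0.
Proof.
  intros Ha H0.
  assert (Ha1 : 1 < a) by nra.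
  (* From [1 - cos v <= v^2 / 2] at [v = tau ln y] and [ln^2 y <= 4 (y - 2 + 1/y)], the product of
     the constants is [2 tau^2]. *)
  set (k := 2 * tau ^ 2) in *.
  assert (Hk : 0 <= k) by (unfold k; nra).
  (* The constant phase turns [u^(i tau)] into [(u / a)^(i tau)]; the integral, assumed to vanish,
     stays 0. *)
  assert (G1 := improper_scal _ (Cexp (RtoC (- tau * ln a) * Ci)) _
    (CGamma_correct (a, tau) ltac:(simpl; lra))).
  rewrite H0, Cmult_0_r in G1.
  set (g := CGamma (RtoC (a - 1))).
  assert (Hg : 0 < Re g) by (apply CGamma_real_pos; lra).
  assert (A : is_improper_RInt (gker (RtoC (a - 1)) 1) g).
  { apply CGamma_correct. simpl. lra. }
  assert (B : is_improper_RInt (gker (RtoC a) 1) (RtoC (a - 1) * g)%C).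
  { replace (RtoC (a - 1) * g)%C with (CGamma (RtoC a)).
    - apply CGamma_correct. simpl. lra.
    - unfold g. rewrite <- CGamma_succ by (simpl; lra). f_equal.
      rewrite <- RtoC_plus. f_equal. ring. }
  assert (D : is_improper_RInt (gker (RtoC (a + 1)) 1) (RtoC a * (RtoC (a - 1) * g))%C).
  { replace (RtoC a * (RtoC (a - 1) * g))%C with (CGamma (RtoC (a + 1))).
    - apply CGamma_correct. simpl. lra.
    - unfold g. rewrite RtoC_plus, CGamma_succ by (simpl; lra). f_equal.
      rewrite <- CGamma_succ by (simpl; lra). f_equal.
      rewrite <- RtoC_plus. f_equal. ring. }
  (* The difference between the oscillating integrand and its lower bound with cosine replaced by
     [1 - k (u/a - 2 + a/u)]. Its real part is nonnegative, yet by the functional equation it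
     integrates to [- (a - 1 - k) Re g], which is negative. *)
  assert (Tot := improper_minus _ _ _ _ G1
    (improper_minus _ _ _ _ (improper_minus _ _ _ _
      (improper_scal _ (RtoC (1 + 2 * k)) _ B)
      (improper_scal _ (RtoC (k / a)) _ D)) (improper_scal _ (RtoC (k * a)) _ A))).
  cbv beta in Tot.
  assert (R0 := improper_Re_ge _ _ 0 Tot).
  assert (E : Re (0 - (RtoC (1 + 2 * k) * (RtoC (a - 1) * g)
     - RtoC (k / a) * (RtoC a * (RtoC (a - 1) * g)) - RtoC (k * a) * g)) = - ((a - 1 - k) * Re g)).
  { unfold Cminus. rewrite !Re_plus, !Re_opp, !Re_plus, !Re_opp, !Re_mult, !Re_RtoC, !Im_RtoC.
    field. lra. }
  rewrite E in R0.
  assert (P : forall u, 0 < u -> 0 <= Re (Cexp (RtoC (- tau * ln a) * Ci) * gker (a, tau) 1 u -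
     (RtoC (1 + 2 * k) * gker (RtoC a) 1 u - RtoC (k / a) * gker (RtoC (a + 1)) 1 u
      - RtoC (k * a) * gker (RtoC (a - 1)) 1 u))).
  { intros u Hu. rewrite !gker_real. unfold gker. rewrite <- Cexp_plus.
    unfold Cminus at 1. rewrite Re_plus.
    set (h := exp ((a - 1) * ln u - u)). assert (Hh : 0 < h) by apply exp_pos.
    assert (E1 : exp ((a + 1 - 1) * ln u - u) = h * u).
    { transitivity (h * exp (ln u)); [|now rewrite exp_ln].
      unfold h. rewrite <- exp_plus. f_equal. ring. }
    assert (E2 : exp ((a - 1 - 1) * ln u - u) = h * / u).
    { transitivity (h * exp (- ln u)); [|now rewrite exp_Ropp, exp_ln].
      unfold h. rewrite <- exp_plus. f_equal. ring. }
    rewrite E1, E2.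
    assert (Hua : 0 < u / a) by (apply Rdiv_lt_0_compat; lra).
    assert (E3 : Re (Cexp (RtoC (- tau * ln a) * Ci +
        (((a, tau) - 1) * RtoC (ln u) - 1 * RtoC u))) = h * cos (tau * ln (u / a))).
    { unfold Rdiv. rewrite ln_mult, ln_Rinv by (try apply Rinv_0_lt_compat; lra).
      unfold Cexp, h, Re, Im; simpl. f_equal; f_equal; ring. }
    rewrite E3.
    assert (I1 := one_minus_cos_le (tau * ln (u / a))).
    assert (I2 := sqr_ln_le (u / a) Hua).
    assert (I3 : 1 - k * (u / a - 2 + / (u / a)) <= cos (tau * ln (u / a))).
    { unfold k. assert (0 <= tau ^ 2) by nra.
      replace ((tau * ln (u / a)) ^ 2) with (tau ^ 2 * ln (u / a) ^ 2) in I1 by ring. nra. }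
    apply (Rmult_le_compat_l h) in I3; [|lra].
    rewrite Re_opp. unfold Cminus. rewrite !Re_plus, !Re_opp, !Re_mult, !Re_RtoC, !Im_RtoC.
    replace (h * (1 - k * (u / a - 2 + / (u / a)))) with
      ((1 + 2 * k) * h - k / a * (h * u) - k * a * (h * / u)) in I3 by (field; lra).
    lra. }
  assert (Hfin : 0 <= - ((a - 1 - k) * Re g)).
  { apply R0; [|exact P|intros; apply P; lra].
    intros u Hu.
    assert (Cs : forall c s, Ccont (fun u => c * gker s 1 u)%C u).
    { intros c s. apply Ccont_mult; [apply Ccont_const|now apply gker_cont]. }
    assert (Cm : forall f g, Ccont f u -> Ccont g u -> Ccont (fun u => f u - g u)%C u).
    { intros f1 f2 H1 [H2 H3]. apply Ccont_plus; [easy|].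
      split; [exact (continuous_opp _ _ H2)|exact (continuous_opp _ _ H3)]. }
    apply (Cm (fun u => Cexp (RtoC (- tau * ln a) * Ci) * gker (a, tau) 1 u)%C); [apply Cs|].
    apply (Cm (fun u => RtoC (1 + 2 * k) * gker (RtoC a) 1 u
      - RtoC (k / a) * gker (RtoC (a + 1)) 1 u)%C); [|apply Cs].
    apply (Cm (fun u => RtoC (1 + 2 * k) * gker (RtoC a) 1 u)%C); apply Cs. }
  nra.
Qed.

(** The functional equation carries a zero at [s] to every [s + n]. The imaginary part does not
    change, so the threshold [1 + 2 (Im s)^2] for the real part is eventually exceeded. *)
Lemma CGamma_neq_0 (s : C) : 0 < Re s -> CGamma s <> 0.
Proof.
  intros Hs H0.
  assert (H : forall n, CGamma (s + RtoC (INR n)) = 0).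
  { intros n. induction n as [|n IH].
    - simpl. now replace (s + RtoC 0)%C with s by ring.
    - rewrite S_INR, RtoC_plus.
      replace (s + (RtoC (INR n) + RtoC 1))%C with ((s + RtoC (INR n)) + 1)%C by ring.
      rewrite CGamma_succ; [rewrite IH; ring|].
      rewrite Re_plus, Re_RtoC. generalize (pos_INR n); lra. }
  destruct (nfloor_ex (1 + 2 * Im s ^ 2)) as [n [_ Hn]]; [nra|].
  apply (CGamma_neq_0_large (Re s + INR (S n)) (Im s)); [rewrite S_INR; lra|].
  rewrite <- (H (S n)). f_equal. apply C_ext; unfold Re, Im; cbn [fst snd Cplus RtoC]; ring.
Qed.

(** * Series and Taylor expansions *)

(* Sums over [k < n], so that [psum a 0 = 0]. *)
Fixpoint psum (a : nat -> C) (n : nat) : C :=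
  match n with O => RtoC 0 | S k => (psum a k + a k)%C end.

Fixpoint rsum (a : nat -> R) (n : nat) : R :=
  match n with O => 0 | S k => rsum a k + a k end.

Definition has_sum (a : nat -> C) (l : C) : Prop :=
  forall eps, 0 < eps -> exists N, forall n, (N <= n)%nat -> Cmod (psum a n - l) < eps.

Definition bsummable (M : nat -> R) : Prop :=
  (forall k, 0 <= M k) /\ exists B, forall n, rsum M n <= B.

Lemma psum_sum_n (a : nat -> C) (n : nat) : sum_n_C a n = psum a (S n).
Proof.
  induction n as [|n IH].
  - unfold sum_n_C. rewrite sum_O. simpl. ring.
  - unfold sum_n_C in *. rewrite sum_Sn, IH. reflexivity.
Qed.

Lemma rsum_sum_n (a : nat -> R) (n : nat) : sum_n a n = rsum a (S n).
Proof.
  induction n as [|n IH].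
  - rewrite sum_O. simpl. ring.
  - rewrite sum_Sn, IH. reflexivity.
Qed.

Lemma has_sum_filterlim (a : nat -> C) (l : C) :
  filterlim (fun n => sum_n_C a n) eventually (locally l) -> has_sum a l.
Proof.
  intros H eps He. destruct (proj1 (filterlim_C eventually _ l) H eps He) as [N HN].
  exists (S N). intros [|n] Hn; [lia|]. rewrite <- psum_sum_n. apply HN. lia.
Qed.

Lemma has_sum_is_series (a : nat -> C) (l : C) :
  @is_series C_AbsRing C_NormedModule a l -> has_sum a l.
Proof. exact (has_sum_filterlim a l). Qed.

Lemma has_sum_unique (a : nat -> C) (l l' : C) : has_sum a l -> has_sum a l' -> l = l'.
Proof.
  intros H1 H2. apply Cmod_eps_eq. intros eps He.
  destruct (H1 (eps / 2)) as [N1 K1]; [lra|]. destruct (H2 (eps / 2)) as [N2 K2]; [lra|].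
  specialize (K1 (N1 + N2)%nat ltac:(lia)). specialize (K2 (N1 + N2)%nat ltac:(lia)).
  replace (l - l')%C with ((l - psum a (N1 + N2)) + (psum a (N1 + N2) - l'))%C by ring.
  eapply Rle_trans; [apply Cmod_triangle|]. rewrite (Cmod_minus_sym l). lra.
Qed.

Lemma psum_ext (a b : nat -> C) (n : nat) : (forall k, a k = b k) -> psum a n = psum b n.
Proof. intros H. induction n as [|n IH]; simpl; [easy|]. now rewrite IH, H. Qed.

Lemma has_sum_ext (a b : nat -> C) (l : C) : (forall k, a k = b k) -> has_sum a l -> has_sum b l.
Proof.
  intros E H eps He. destruct (H eps He) as [N HN]. exists N. intros n Hn.
  rewrite <- (psum_ext a b n E). now apply HN.
Qed.

Lemma psum_plus (a b : nat -> C) (n : nat) :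
  psum (fun k => a k + b k)%C n = (psum a n + psum b n)%C.
Proof. induction n as [|n IH]; simpl; [ring|]. rewrite IH. ring. Qed.

Lemma psum_scal (c : C) (a : nat -> C) (n : nat) :
  psum (fun k => c * a k)%C n = (c * psum a n)%C.
Proof. induction n as [|n IH]; simpl; [ring|]. rewrite IH. ring. Qed.

Lemma has_sum_plus (a b : nat -> C) (l l' : C) :
  has_sum a l -> has_sum b l' -> has_sum (fun k => a k + b k)%C (l + l')%C.
Proof.
  intros H1 H2 eps He.
  destruct (H1 (eps / 2)) as [N1 K1]; [lra|]. destruct (H2 (eps / 2)) as [N2 K2]; [lra|].
  exists (N1 + N2)%nat. intros n Hn. rewrite psum_plus.
  specialize (K1 n ltac:(lia)). specialize (K2 n ltac:(lia)).
  replace (psum a n + psum b n - (l + l'))%C with ((psum a n - l) + (psum b n - l'))%C by ring.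
  eapply Rle_lt_trans; [apply Cmod_triangle|]. lra.
Qed.

Lemma has_sum_scal (c : C) (a : nat -> C) (l : C) :
  has_sum a l -> has_sum (fun k => c * a k)%C (c * l)%C.
Proof.
  intros H eps He. assert (Hc := Cmod_ge_0 c).
  destruct (H (eps / (Cmod c + 1))) as [N HN]; [apply Rdiv_lt_0_compat; lra|].
  exists N. intros n Hn. specialize (HN n Hn). rewrite psum_scal.
  replace (c * psum a n - c * l)%C with (c * (psum a n - l))%C by ring. rewrite Cmod_mult.
  apply (Rmult_lt_compat_r (Cmod c + 1)) in HN; [|lra].
  replace (eps / (Cmod c + 1) * (Cmod c + 1)) with eps in HN by (field; lra).
  assert (H0 := Cmod_ge_0 (psum a n - l)). nra.
Qed.

Lemma has_sum_minus (a b : nat -> C) (l l' : C) :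
  has_sum a l -> has_sum b l' -> has_sum (fun k => a k - b k)%C (l - l')%C.
Proof.
  intros H1 H2. replace (l - l')%C with (l + (- (1)) * l')%C by ring.
  eapply has_sum_ext; [|apply has_sum_plus; [apply H1|apply has_sum_scal, H2]].
  intros k. cbv beta. ring.
Qed.

Lemma psum_shift (a : nat -> C) (n : nat) : psum a (S n) = (a O + psum (fun k => a (S k)) n)%C.
Proof. induction n as [|n IH]; [simpl; ring|]. simpl in *. rewrite IH. ring. Qed.

Lemma has_sum_shift (a : nat -> C) (l : C) :
  has_sum (fun k => a (S k)) l -> has_sum a (a O + l)%C.
Proof.
  intros H eps He. destruct (H eps He) as [N HN]. exists (S N). intros [|n] Hn; [lia|].
  rewrite psum_shift.
  replace (a O + psum (fun k => a (S k)) n - (a O + l))%C with (psum (fun k => a (S k)) n - l)%C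
    by ring. apply HN. lia.
Qed.

Lemma rsum_le (a b : nat -> R) (n : nat) : (forall k, a k <= b k) -> rsum a n <= rsum b n.
Proof. intros H. induction n as [|n IH]; simpl; [lra|]. specialize (H n). lra. Qed.

Lemma rsum_scal (c : R) (a : nat -> R) (n : nat) : rsum (fun k => c * a k) n = c * rsum a n.
Proof. induction n as [|n IH]; simpl; [ring|]. rewrite IH. ring. Qed.

Lemma rsum_mono (M : nat -> R) (n p : nat) : (forall k, 0 <= M k) -> (n <= p)%nat -> rsum M n <= rsum M p.
Proof. intros H Hnp. induction Hnp as [|p Hp IH]; [lra|]. simpl. specialize (H p). lra. Qed.

Lemma psum_diff_le (a : nat -> C) (M : nat -> R) (n p : nat) :
  (forall k, Cmod (a k) <= M k) -> (n <= p)%nat ->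
  Cmod (psum a p - psum a n) <= rsum M p - rsum M n.
Proof.
  intros H Hnp. induction Hnp as [|p Hp IH].
  - replace (psum a n - psum a n)%C with (RtoC 0) by ring. rewrite Cmod_0. lra.
  - simpl. replace (psum a p + a p - psum a n)%C with ((psum a p - psum a n) + a p)%C by ring.
    eapply Rle_trans; [apply Cmod_triangle|]. specialize (H p). lra.
Qed.

Lemma bsummable_le (a M : nat -> R) :
  (forall k, 0 <= a k <= M k) -> bsummable M -> bsummable a.
Proof.
  intros H [_ [B HB]]. split; [intros k; apply H|]. exists B. intros n.
  eapply Rle_trans; [|apply (HB n)]. apply rsum_le. intros k; apply H.
Qed.

Lemma bsummable_scal (c : R) (M : nat -> R) : 0 <= c -> bsummable M -> bsummable (fun k => c * M k).
Proof.
  intros Hc [H0 [B HB]]. split; [intros k; now apply Rmult_le_pos|]. exists (c * B).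
  intros n. rewrite rsum_scal. now apply Rmult_le_compat_l.
Qed.

Lemma bsummable_geom (q : R) : 0 <= q < 1 -> bsummable (fun k => q ^ k).
Proof.
  intros Hq. split; [intros k; apply pow_le; lra|]. exists (/ (1 - q)).
  assert (E : forall n, rsum (fun k => q ^ k) n = (1 - q ^ n) * / (1 - q)).
  { induction n as [|n IH]; simpl; [ring|]. rewrite IH. field. lra. }
  intros n. rewrite E. assert (0 <= q ^ n) by (apply pow_le; lra).
  assert (0 < / (1 - q)) by (apply Rinv_0_lt_compat; lra). nra.
Qed.

(** Partial sums increase to their supremum [S]; once one exceeds [S - eps], all later ones lie
    within [eps] of each other. *)
Lemma bsummable_tail (M : nat -> R) (eps : R) : bsummable M -> 0 < eps ->
  exists N, forall n p, (N <= n)%nat -> (n <= p)%nat -> rsum M p - rsum M n < eps.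
Proof.
  intros [H0 [B HB]] He.
  destruct (completeness (fun r => exists n, r = rsum M n)) as [S [HS1 HS2]].
  - exists B. intros r [n ->]. apply HB.
  - exists 0. now exists O.
  - destruct (classic (exists N, S - eps < rsum M N)) as [[N HN]|HN].
    + exists N. intros n p Hn Hp.
      assert (rsum M p <= S) by (apply HS1; now exists p).
      assert (rsum M N <= rsum M n) by now apply rsum_mono. lra.
    + exfalso. assert (S <= S - eps); [|lra]. apply HS2. intros r [n ->].
      apply Rnot_lt_le. intros Hn. apply HN. now exists n.
Qed.

Lemma has_sum_dominated (a : nat -> C) (M : nat -> R) :
  (forall k, Cmod (a k) <= M k) -> bsummable M -> exists l, has_sum a l.
Proof.
  intros Ha HM.
  assert (H : exists l : C, filterlim (fun n => psum a n) eventually (@locally C_UniformSpace l)).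
  { apply (filterlim_locally_cauchy (U := C_R_CompleteNormedModule)). intros eps.
    destruct (bsummable_tail M eps HM (cond_pos eps)) as [N HN].
    exists (fun n => (N <= n)%nat). split; [now exists N|].
    assert (W : forall u v, (N <= u)%nat -> (u <= v)%nat -> Cmod (psum a v - psum a u) < eps).
    { intros u v Hu Huv. eapply Rle_lt_trans; [apply psum_diff_le; [apply Ha|easy]|].
      now apply HN. }
    intros u v Hu Hv. apply ball_C_of_Cmod.
    destruct (Nat.le_ge_cases u v) as [Huv|Huv]; [now apply W|].
    change (Cmod (psum a v - psum a u) < eps). rewrite Cmod_minus_sym. now apply W. }
  destruct H as [l Hl]. exists l. intros eps He.
  destruct (proj1 (filterlim_C eventually _ l) Hl eps He) as [N HN]. now exists N.
Qed.

Lemma has_sum_remainder_le (a : nat -> C) (l : C) (n : nat) (e : R) :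
  has_sum a l -> (forall p, (n <= p)%nat -> Cmod (psum a p - psum a n) <= e) ->
  Cmod (psum a n - l) <= e.
Proof.
  intros H1 H2. apply le_epsilon. intros eps He. destruct (H1 eps He) as [N HN].
  specialize (HN (n + N)%nat ltac:(lia)). specialize (H2 (n + N)%nat ltac:(lia)).
  rewrite Cmod_minus_sym in H2.
  replace (psum a n - l)%C with ((psum a n - psum a (n + N)) + (psum a (n + N) - l))%C by ring.
  eapply Rle_trans; [apply Cmod_triangle|]. lra.
Qed.

Lemma has_sum_norm_le (a : nat -> C) (l : C) (M : nat -> R) (B : R) :
  (forall k, Cmod (a k) <= M k) -> (forall n, rsum M n <= B) -> has_sum a l -> Cmod l <= B.
Proof.
  intros Ha HB H. replace l with (- (psum a 0 - l))%C by (simpl; ring). rewrite Cmod_opp.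
  apply (has_sum_remainder_le a l 0 B H). intros p Hp.
  eapply Rle_trans; [apply psum_diff_le; [apply Ha|easy]|]. simpl. specialize (HB p). lra.
Qed.

Lemma psum_filterlim {T : Type} (F : (T -> Prop) -> Prop) {FF : Filter F}
  (f : T -> nat -> C) (g : nat -> C) (n : nat) :
  (forall m eps, 0 < eps -> F (fun x => Cmod (f x m - g m) < eps)) ->
  forall eps, 0 < eps -> F (fun x => Cmod (psum (f x) n - psum g n) < eps).
Proof.
  intros H. induction n as [|n IH]; intros eps He.
  - apply filter_forall. intros x. simpl. replace (0 - 0)%C with (RtoC 0) by ring.
    now rewrite Cmod_0.
  - assert (He2 : 0 < eps / 2) by lra.
    generalize (filter_and _ _ (IH _ He2) (H n _ He2)). apply filter_imp.
    intros x [H1 H2]. simpl.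
    replace (psum (f x) n + f x n - (psum g n + g n))%C with
      ((psum (f x) n - psum g n) + (f x n - g n))%C by ring.
    eapply Rle_lt_trans; [apply Cmod_triangle|]. lra.
Qed.

(* Tannery's theorem *)
Lemma has_sum_limit {T : Type} (F : (T -> Prop) -> Prop) {FF : Filter F}
  (f : T -> nat -> C) (g : nat -> C) (M : nat -> R) (S : T -> C) (G : C) :
  (forall m eps, 0 < eps -> F (fun x => Cmod (f x m - g m) < eps)) ->
  F (fun x => (forall m, Cmod (f x m) <= M m) /\ has_sum (f x) (S x)) ->
  (forall m, Cmod (g m) <= M m) -> has_sum g G -> bsummable M ->
  filterlim S F (locally G).
Proof.
  intros H1 H2 H3 H4 HM. apply filterlim_C; [easy|]. intros eps He.
  assert (He2 : 0 < eps / 4) by lra.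
  destruct (bsummable_tail M _ HM He2) as [N HN].
  (* One cut-off [N] serves every sequence dominated by [M]; only a finite sum is then left to
     converge along the filter. *)
  assert (Tail : forall a l, (forall m, Cmod (a m) <= M m) -> has_sum a l ->
    Cmod (psum a N - l) <= eps / 4).
  { intros a l Ha Hl. apply has_sum_remainder_le; [easy|]. intros p Hp.
    eapply Rle_trans; [apply psum_diff_le; [apply Ha|easy]|].
    left. now apply HN. }
  generalize (filter_and _ _ H2 (psum_filterlim F f g N H1 _ He2)).
  apply filter_imp. intros x [[K1 K2] K3].
  assert (T1 := Tail _ _ K1 K2). assert (T2 := Tail _ _ H3 H4). rewrite Cmod_minus_sym in T1.
  replace (S x - G)%C with ((S x - psum (f x) N) + ((psum (f x) N - psum g N) + (psum g N - G)))%C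
    by ring.
  eapply Rle_lt_trans; [apply Cmod_triangle|].
  assert (T3 := Cmod_triangle (psum (f x) N - psum g N) (psum g N - G)). lra.
Qed.

(** * Taylor series under factorial bounds on the derivatives *)

Lemma is_derive_n_chain (g : nat -> R -> R) (x0 r : R) :
  (forall k y, Rabs (y - x0) < r -> is_derive (g k) y (g (S k) y)) ->
  forall k y, Rabs (y - x0) < r -> is_derive_n (g O) k y (g k y).
Proof.
  intros H k. induction k as [|k IH]; intros y Hy; [reflexivity|].
  simpl. eapply is_derive_ext_loc; [|apply H, Hy].
  assert (Hd : 0 < r - Rabs (y - x0)) by lra.
  exists (mkposreal _ Hd). intros z Hz. symmetry. apply is_derive_n_unique, IH.
  change (Rabs (z - y) < r - Rabs (y - x0)) in Hz.
  replace (z - x0) with ((z - y) + (y - x0)) by ring.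
  eapply Rle_lt_trans; [apply Rabs_triang|]. lra.
Qed.

(** In Lagrange's remainder the factorial cancels against the bound [A k! q^k], leaving a geometric
    quantity. *)
Lemma taylor_remainder_right (g : nat -> R -> R) (x0 r A q h : R) (n : nat) :
  (forall k y, Rabs (y - x0) < r -> is_derive (g k) y (g (S k) y)) ->
  (forall k y, Rabs (y - x0) < r -> Rabs (g k y) <= A * INR (fact k) * q ^ k) ->
  0 < h < r ->
  Rabs (g O (x0 + h) - rsum (fun k => g k x0 * (h ^ k / INR (fact k))) n) <= A * (h * q) ^ n.
Proof.
  intros H1 H2 Hh. destruct n as [|n].
  - simpl. rewrite Rminus_0_r, Rmult_1_r.
    specialize (H2 O (x0 + h)). simpl in H2. rewrite !Rmult_1_r in H2. apply H2.
    replace (x0 + h - x0) with h by ring. rewrite Rabs_pos_eq; lra.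
  - assert (Hin : forall t, x0 <= t <= x0 + h -> Rabs (t - x0) < r).
    { intros t Ht. rewrite Rabs_pos_eq; lra. }
    destruct (Taylor_Lagrange (g O) n x0 (x0 + h)) as [z [Hz Ez]]; [lra| |].
    { intros t Ht k _. destruct k as [|k]; [exact I|].
      exists (g (S k) t). apply (is_derive_n_chain g x0 r H1 (S k)), Hin, Ht. }
    rewrite Ez. replace (x0 + h - x0) with h by ring.
    assert (Es : sum_f_R0 (fun m => h ^ m / INR (fact m) * Derive_n (g O) m x0) n
      = rsum (fun k => g k x0 * (h ^ k / INR (fact k))) (S n)).
    { rewrite <- rsum_sum_n, <- sum_n_Reals. apply sum_n_ext. intros k.
      rewrite (is_derive_n_unique _ _ _ _ (is_derive_n_chain g x0 r H1 k x0
        ltac:(apply Hin; lra))). apply Rmult_comm. }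
    rewrite Es.
    rewrite (is_derive_n_unique _ _ _ _ (is_derive_n_chain g x0 r H1 (S n) z
        ltac:(apply Hin; lra))).
    match goal with |- Rabs (?a + ?b - ?a) <= _ => replace (a + b - a) with b by ring end.
    specialize (H2 (S n) z ltac:(apply Hin; lra)).
    assert (Hf : 0 < INR (fact (S n))) by apply INR_fact_lt_0.
    assert (Hp : 0 <= h ^ S n) by (apply pow_le; lra).
    rewrite Rabs_mult, Rabs_pos_eq by now apply Rdiv_le_0_compat.
    apply Rle_trans with (h ^ S n / INR (fact (S n)) * (A * INR (fact (S n)) * q ^ S n)).
    + apply Rmult_le_compat_l; [now apply Rdiv_le_0_compat|easy].
    + right. rewrite Rpow_mult_distr. field. lra.
Qed.

Lemma taylor_remainder (g : nat -> R -> R) (x0 r A q h : R) (n : nat) :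
  (forall k y, Rabs (y - x0) < r -> is_derive (g k) y (g (S k) y)) ->
  (forall k y, Rabs (y - x0) < r -> Rabs (g k y) <= A * INR (fact k) * q ^ k) ->
  0 <= q -> Rabs h < r -> (0 < n)%nat ->
  Rabs (g O (x0 + h) - rsum (fun k => g k x0 * (h ^ k / INR (fact k))) n) <= A * (Rabs h * q) ^ n.
Proof.
  intros H1 H2 Hq Hh Hn.
  destruct (Rtotal_order h 0) as [Hs|[->|Hs]].
  - rewrite (Rabs_left h) in * by easy.
    (* Negative increments reduce to positive ones by the reflection [y -> - y], which multiplies
       the [k]-th derivative by [(-1)^k]. *)
    assert (T := taylor_remainder_right (fun k y => (-1) ^ k * g k (- y)) (- x0) r A q (- h) n).
    cbv beta in T. simpl pow in T at 1. rewrite Rmult_1_l in T.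
    replace (- (- x0 + - h)) with (x0 + h) in T by ring.
    assert (E : rsum (fun k => (-1) ^ k * g k (- - x0) * ((- h) ^ k / INR (fact k))) n
      = rsum (fun k => g k x0 * (h ^ k / INR (fact k))) n).
    { clear -h. induction n as [|n IH]; simpl; [easy|]. rewrite IH. f_equal.
      rewrite Ropp_involutive. replace (- h) with ((-1) * h) by ring.
      rewrite Rpow_mult_distr.
      transitivity (((-1) ^ n * (-1) ^ n) * (g n x0 * (h ^ n / INR (fact n)))).
      - unfold Rdiv. ring.
      - rewrite <- Rpow_mult_distr. replace (-1 * -1) with 1 by ring. rewrite pow1. ring. }
    rewrite E in T. apply T.
    + intros k y Hy.
      assert (D : is_derive (g k) (- y) (g (S k) (- y))).
      { apply H1. rewrite <- Rabs_Ropp. now replace (- (- y - x0)) with (y - - x0) by ring. }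
      assert (DO : is_derive Ropp y (-1)) by (auto_derive; [easy|ring]).
      assert (Dk := is_derive_scal _ y ((-1) ^ k) _ (is_derive_comp (g k) Ropp y _ _ D DO)).
      replace ((-1) ^ S k * g (S k) (- y)) with ((-1) ^ k * (-1 * g (S k) (- y)))
        by (simpl; ring). exact Dk.
    + intros k y Hy. rewrite Rabs_mult, pow_1_abs, Rmult_1_l. apply H2.
      rewrite <- Rabs_Ropp. now replace (- (- y - x0)) with (y - - x0) by ring.
    + lra.
  - rewrite Rabs_R0, Rmult_0_l, Rplus_0_r, (pow_i n Hn), Rmult_0_r.
    destruct n as [|n]; [lia|].
    assert (E : rsum (fun k => g k x0 * (0 ^ k / INR (fact k))) (S n) = g O x0).
    { clear. induction n as [|n IH]; [simpl; field|].
      simpl rsum in *. rewrite IH. simpl pow. unfold Rdiv. ring. }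
    rewrite E. replace (g O x0 - g O x0) with 0 by ring. rewrite Rabs_R0. lra.
  - rewrite (Rabs_pos_eq h) in * by lra. apply taylor_remainder_right with r; easy.
Qed.

Lemma Re_psum (a : nat -> C) (n : nat) : Re (psum a n) = rsum (fun k => Re (a k)) n.
Proof. induction n as [|n IH]; [easy|]. simpl. now rewrite <- IH. Qed.

Lemma Im_psum (a : nat -> C) (n : nat) : Im (psum a n) = rsum (fun k => Im (a k)) n.
Proof. induction n as [|n IH]; [easy|]. simpl. now rewrite <- IH. Qed.

Lemma taylor_has_sum (f : nat -> R -> C) (x0 r A q h : R) :
  (forall k y, Rabs (y - x0) < r -> Cderiv (f k) y (f (S k) y)) ->
  (forall k y, Rabs (y - x0) < r -> Cmod (f k y) <= A * INR (fact k) * q ^ k) ->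
  0 <= A -> 0 <= q -> Rabs h < r -> Rabs h * q < 1 ->
  has_sum (fun k => f k x0 * RtoC (h ^ k / INR (fact k)))%C (f O (x0 + h)).
Proof.
  intros H1 H2 HA Hq Hh Hhq eps He.
  assert (Hhq0 : 0 <= Rabs h * q) by (apply Rmult_le_pos; [apply Rabs_pos|easy]).
  destruct (pow_lt_1_zero (Rabs h * q) ltac:(rewrite Rabs_pos_eq; lra)
    (eps / (2 * (A + 1)))) as [N HN]; [apply Rdiv_lt_0_compat; lra|].
  exists (S N). intros n Hn. specialize (HN n ltac:(lia)).
  rewrite Rabs_pos_eq in HN by now apply pow_le.
  assert (B : 2 * (A * (Rabs h * q) ^ n) < eps).
  { assert (0 <= (Rabs h * q) ^ n) by now apply pow_le.
    apply (Rmult_lt_compat_l (2 * (A + 1))) in HN; [|lra].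
    replace (2 * (A + 1) * (eps / (2 * (A + 1)))) with eps in HN by (field; lra). nra. }
  rewrite Cmod_minus_sym. eapply Rle_lt_trans; [apply Cmod_le_abs|].
  assert (Tr := taylor_remainder (fun k y => Re (f k y)) x0 r A q h n).
  assert (Ti := taylor_remainder (fun k y => Im (f k y)) x0 r A q h n).
  cbv beta in Tr, Ti. unfold Cminus. rewrite Re_plus, Im_plus, Re_opp, Im_opp, Re_psum, Im_psum.
  assert (Er : rsum (fun k => Re (f k x0 * RtoC (h ^ k / INR (fact k)))) n
    = rsum (fun k => Re (f k x0) * (h ^ k / INR (fact k))) n).
  { clear. induction n as [|n IH]; [easy|]. cbn [rsum]. rewrite IH. f_equal.
    rewrite Re_mult, Re_RtoC, Im_RtoC. ring. }
  assert (Ei : rsum (fun k => Im (f k x0 * RtoC (h ^ k / INR (fact k)))) n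
    = rsum (fun k => Im (f k x0) * (h ^ k / INR (fact k))) n).
  { clear. induction n as [|n IH]; [easy|]. cbn [rsum]. rewrite IH. f_equal.
    rewrite Im_mult, Re_RtoC, Im_RtoC. ring. }
  cbv beta. rewrite Er, Ei. apply Rle_lt_trans with (2 * (A * (Rabs h * q) ^ n)); [|easy].
  replace (2 * (A * (Rabs h * q) ^ n)) with (A * (Rabs h * q) ^ n + A * (Rabs h * q) ^ n) by ring.
  apply Rplus_le_compat; [apply Tr|apply Ti]; try easy; try lia; intros k y Hy.
  - exact (proj1 (H1 k y Hy)).
  - eapply Rle_trans; [apply re_le_Cmod|now apply H2].
  - exact (proj2 (H1 k y Hy)).
  - eapply Rle_trans; [apply im_le_Cmod|now apply H2].
Qed.

(** * Abel's theorem for integrals *)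

Lemma Ccont_exp (f : R -> C) (x : R) : Ccont f x -> Ccont (fun u => Cexp (f u)) x.
Proof.
  intros [H1 H2]. unfold Cexp, Ccont; simpl.
  assert (E : continuous (fun u => exp (Re (f u))) x).
  { apply (continuous_comp (fun u => Re (f u)) exp); [easy|].
    apply (ex_derive_continuous exp). auto_derive. easy. }
  split; apply (continuous_mult (fun u => exp (Re (f u)))); try easy.
  - apply (continuous_comp (fun u => Im (f u)) cos); [easy|apply continuous_cos].
  - apply (continuous_comp (fun u => Im (f u)) sin); [easy|apply continuous_sin].
Qed.

Lemma Ccont_opp (f : R -> C) (x : R) : Ccont f x -> Ccont (fun u => - f u)%C x.
Proof.
  intros [H1 H2]. split; [exact (continuous_opp _ _ H1)|exact (continuous_opp _ _ H2)].
Qed.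

Lemma Cderiv_primitive (g : R -> C) (c u : R) :
  (forall v, 0 < v -> Ccont g v) -> 0 < c -> 0 < u ->
  Cderiv (fun u => @RInt C_R_CompleteNormedModule g c u) u (g u).
Proof.
  intros Hg Hc Hu.
  assert (H : forall v, 0 < v -> is_RInt_C g c v (@RInt C_R_CompleteNormedModule g c v)).
  { intros v Hv. now apply ex_RInt_Ccont. }
  assert (Hl : locally u (fun v => 0 < v)).
  { exists (mkposreal u Hu). intros v Hv. apply Rabs_def2 in Hv.
    unfold minus, plus, opp in Hv; simpl in Hv. lra. }
  split.
  - apply (is_derive_RInt (fun v => Re (g v))
      (fun v => Re (@RInt C_R_CompleteNormedModule g c v)) c u).
    + eapply filter_imp; [|exact Hl]. intros v Hv. exact (proj1 (proj1 (is_RInt_C_iff _ _ _ _) (H v Hv))).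
    + exact (proj1 (Hg u Hu)).
  - apply (is_derive_RInt (fun v => Im (g v))
      (fun v => Im (@RInt C_R_CompleteNormedModule g c v)) c u).
    + eapply filter_imp; [|exact Hl]. intros v Hv. exact (proj2 (proj1 (is_RInt_C_iff _ _ _ _) (H v Hv))).
    + exact (proj2 (Hg u Hu)).
Qed.

Lemma Cderiv_exp_scal (k u : R) :
  Cderiv (fun u => RtoC (exp (k * u))) u (RtoC (k * exp (k * u))).
Proof. apply Cderiv_RtoC. auto_derive; [easy|ring]. Qed.

(* Integration by parts against a primitive [Q] of [g], normalised so that it is
   small at infinity and close to [- J] at [0]. *)
Lemma abel_RInt_estimate (g : R -> C) (J : C) (eta : R) :
  (forall u, 0 < u -> Ccont g u) -> is_improper_RInt g J -> 0 < eta ->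
  exists K, 0 <= K /\ forall eps G, 0 < eps ->
    is_improper_RInt (fun u => RtoC (exp (- eps * u)) * g u)%C G ->
    Cmod (G - J) <= 5 * eta + eps * K.
Proof.
  intros Hg HJ Heta.
  destruct (proj1 (improper_iff g J) HJ eta Heta) as [d [M [Hd [HM KK]]]].
  set (a0 := d / 2). set (b0 := M + 1).
  set (I := fun v => @RInt C_R_CompleteNormedModule g 1 v).
  assert (HI : forall v, 0 < v -> is_RInt_C g 1 v (I v)).
  { intros v Hv. apply ex_RInt_Ccont; [lra|easy|easy]. }
  assert (HIab : forall a b, 0 < a < d -> M < b -> Cmod (I b - I a - J) < eta).
  { intros a b Ha Hb. destruct (KK a b Ha Hb) as [y [Y1 Y2]].
    assert (Hs := is_RInt_C_Chasles _ _ _ _ _ _ (HI a ltac:(lra)) Y1).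
    rewrite (is_RInt_C_unique _ _ _ _ _ (HI b ltac:(lra)) Hs).
    replace (I a + y - I a - J)%C with (y - J)%C by ring. easy. }
  set (Q := fun v => (I v - (I a0 + J))%C).
  assert (Ha0 : 0 < a0 < d) by (unfold a0; lra).
  assert (Hb0 : M < b0) by (unfold b0; lra).
  assert (HQ1 : forall b, M < b -> Cmod (Q b) <= eta).
  { intros b Hb. specialize (HIab a0 b Ha0 Hb). unfold Q.
    replace (I b - (I a0 + J))%C with (I b - I a0 - J)%C by ring. lra. }
  assert (HQ0 : forall a, 0 < a < d -> Cmod (Q a + J) <= 2 * eta).
  { intros a Ha. specialize (HIab a b0 Ha Hb0). specialize (HQ1 b0 Hb0).
    replace (Q a + J)%C with (Q b0 + - (I b0 - I a - J))%C by (unfold Q; ring).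
    eapply Rle_trans; [apply Cmod_triangle|]. rewrite Cmod_opp. lra. }
  assert (DQ : forall u, 0 < u -> Cderiv Q u (g u)).
  { intros u Hu. eapply Cderiv_eq.
    - apply Cderiv_minus; [|apply Cderiv_const]. apply Cderiv_primitive; [easy|lra|easy].
    - ring. }
  assert (CQ : forall u, 0 < u -> Ccont Q u) by (intros u Hu; eapply Cderiv_cont, DQ, Hu).
  (* A continuous majorant of [|Q|] on the compact middle part; its integral [K1] does not involve
     [eps]. *)
  set (Qm := fun u => Rabs (Re (Q u)) + Rabs (Im (Q u))).
  assert (HQm : ex_RInt Qm a0 b0).
  { apply (ex_RInt_continuous (V := R_CompleteNormedModule)). intros u Hu.
    rewrite Rmin_left in Hu by (unfold a0, b0; lra). destruct (CQ u ltac:(lra)) as [C1 C2].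
    apply (continuous_plus (fun u => Rabs (Re (Q u))) (fun u => Rabs (Im (Q u)))).
    - apply (continuous_comp (fun u => Re (Q u)) Rabs); [easy|apply continuous_Rabs].
    - apply (continuous_comp (fun u => Im (Q u)) Rabs); [easy|apply continuous_Rabs]. }
  destruct HQm as [K1 HK1].
  assert (HK1p : 0 <= K1).
  { apply (is_RInt_ge_0 Qm a0 b0 K1); [unfold a0, b0; lra|easy|].
    intros u _. unfold Qm. assert (H1 := Rabs_pos (Re (Q u))). assert (H2 := Rabs_pos (Im (Q u))). lra. }
  assert (HJm := Cmod_ge_0 J).
  (* All contributions carrying a factor [eps]: the part near 0, the middle part, and
     [1 - e^(- eps a)] times [J]. The part near infinity is only bounded by [eta / eps], so it
     contributes [eta] instead. *)
  exists (2 * Cmod J + 2 * eta + K1). split; [lra|].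
  intros eps G Heps HG. apply le_epsilon. intros e He.
  destruct (proj1 (improper_iff _ G) HG e He) as [d' [M' [Hd' [HM' KK']]]].
  set (a := Rmin a0 d' / 2). set (b := Rmax b0 M' + 1).
  assert (La := Rmin_l a0 d'). assert (Lb := Rmin_r a0 d').
  assert (Lc : 0 < Rmin a0 d') by (apply Rmin_glb_lt; lra).
  assert (Ld := Rmax_l b0 M'). assert (Le := Rmax_r b0 M').
  assert (Ha : 0 < a < a0 /\ a < d') by (unfold a; lra).
  assert (Hb : b0 < b /\ M' < b) by (unfold b; lra).
  destruct (KK' a b) as [y [Y1 Y2]]; [lra|lra|].
  set (E := fun u => RtoC (exp (- eps * u))).
  set (k := fun u => (E u * Q u)%C).
  assert (DE : forall u, Cderiv E u (RtoC (- eps * exp (- eps * u)))).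
  { intros u. apply Cderiv_exp_scal. }
  assert (Ck : forall u, 0 < u -> Ccont k u).
  { intros u Hu. apply Ccont_mult; [eapply Cderiv_cont, DE|now apply CQ]. }
  assert (P1 := ex_RInt_Ccont k a a0 ltac:(lra) ltac:(lra) Ck).
  assert (P2 := ex_RInt_Ccont k a0 b0 ltac:(lra) ltac:(lra) Ck).
  assert (P3 := ex_RInt_Ccont k b0 b ltac:(lra) ltac:(lra) Ck).
  set (p1 := @RInt C_R_CompleteNormedModule k a a0) in *.
  set (p2 := @RInt C_R_CompleteNormedModule k a0 b0) in *.
  set (p3 := @RInt C_R_CompleteNormedModule k b0 b) in *.
  assert (PP := is_RInt_C_Chasles _ _ _ _ _ _ (is_RInt_C_Chasles _ _ _ _ _ _ P1 P2) P3).
  (* The product rule for [k = E * Q], whose integrated form is the integration by parts. *)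
  assert (IB : is_RInt_C (fun u => RtoC (- eps) * k u + E u * g u)%C a b (k b - k a)%C).
  { apply is_RInt_C_derive; [lra| |].
    - intros u Hu. eapply Cderiv_eq; [apply Cderiv_mult; [apply DE|apply DQ; lra]|].
      unfold k, E. rewrite RtoC_mult. ring.
    - intros u Hu. apply Ccont_plus; apply Ccont_mult; try apply Ccont_const.
      + apply Ck; lra.
      + eapply Cderiv_cont, DE.
      + apply Hg; lra. }
  assert (Ey : y = ((k b - k a) + RtoC eps * (p1 + p2 + p3))%C).
  { apply (is_RInt_C_unique _ _ _ _ _ Y1).
    eapply (is_RInt_ext (V := C_R_NormedModule)); [|apply (is_RInt_C_plus _ _ _ _ _ _ IB
      (is_RInt_C_scal _ _ _ (RtoC eps) _ PP))].
    intros u _. cbv beta. unfold E. rewrite RtoC_opp.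
    match goal with |- ?l = ?r => change (@eq C l r) end. ring. }
  assert (Eb : forall u, 0 < u -> 0 < exp (- eps * u) <= 1).
  { intros u Hu. split; [apply exp_pos|]. rewrite <- exp_0. apply exp_le. nra. }
  assert (Mk : forall u, Cmod (k u) = exp (- eps * u) * Cmod (Q u)).
  { intros u. unfold k, E. rewrite Cmod_mult, Cmod_pos_RtoC; [easy|left; apply exp_pos]. }
  assert (B1 : Cmod p1 <= (Cmod J + 2 * eta)).
  { apply Rle_trans with ((a0 - a) * (Cmod J + 2 * eta)).
    - apply (is_RInt_C_norm_le k (fun _ => Cmod J + 2 * eta) a a0); [lra| |easy|].
      + intros u Hu. rewrite Mk. specialize (HQ0 u ltac:(lra)).
        assert (T := Cmod_triangle (Q u + J) (- J)). rewrite Cmod_opp in T.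
        replace (Q u + J + - J)%C with (Q u) in T by ring.
        specialize (Eb u ltac:(lra)). assert (Q0 := Cmod_ge_0 (Q u)). nra.
      + exact (is_RInt_const a a0 (Cmod J + 2 * eta)).
    - unfold a0 in *. nra. }
  assert (B2 : Cmod p2 <= K1).
  { apply (is_RInt_C_norm_le k Qm a0 b0); [lra| |easy|easy].
    intros u Hu. rewrite Mk. specialize (Eb u ltac:(lra)). assert (T := Cmod_le_abs (Q u)).
    fold (Qm u) in T. assert (Q0 := Cmod_ge_0 (Q u)). nra. }
  assert (B3 : Cmod p3 <= eta / eps).
  { apply Rle_trans with (- (eta / eps) * exp (- eps * b) - - (eta / eps) * exp (- eps * b0)).
    - apply (is_RInt_C_norm_le k (fun u => eta * exp (- eps * u)) b0 b); [lra| |easy|].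
      + intros u Hu. rewrite Mk. specialize (Eb u ltac:(lra)). specialize (HQ1 u ltac:(lra)). nra.
      + apply (is_RInt_R_derive (fun u => - (eta / eps) * exp (- eps * u))); [lra| |].
        * intros u _. auto_derive; [easy|]. field. lra.
        * intros u _. apply (ex_derive_continuous (fun u => eta * exp (- eps * u))). auto_derive. easy.
    - assert (E1 := Eb b ltac:(lra)). assert (E2 := Eb b0 ltac:(lra)).
      assert (0 < eta / eps) by now apply Rdiv_lt_0_compat. nra. }
  assert (B4 : Cmod (k b) <= eta).
  { rewrite Mk. specialize (Eb b ltac:(lra)). specialize (HQ1 b ltac:(lra)).
    assert (Q0 := Cmod_ge_0 (Q b)). nra. }
  assert (B5 : Cmod (- k a - J) <= 2 * eta + eps * Cmod J).
  { replace (- k a - J)%C with (- (E a * (Q a + J)) + - (RtoC (1 - exp (- eps * a)) * J))%C.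
    - eapply Rle_trans; [apply Cmod_triangle|].
      assert (Ea := Eb a ltac:(lra)).
      rewrite !Cmod_opp, !Cmod_mult, Cmod_pos_RtoC by lra.
      unfold E. rewrite Cmod_pos_RtoC by lra. specialize (HQ0 a ltac:(lra)).
      assert (Ex := exp_ineq1_le (- eps * a)).
      assert (Q0 := Cmod_ge_0 (Q a + J)). unfold a0 in *.
      apply Rplus_le_compat; [nra|]. apply Rmult_le_compat_r; [easy|]. nra.
    - unfold k, E. rewrite RtoC_minus. ring. }
  replace (G - J)%C with ((G - y) + (k b + ((- k a - J) + RtoC eps * (p1 + p2 + p3))))%C
    by (rewrite Ey; ring).
  rewrite Cmod_minus_sym in Y2.
  assert (T1 := Cmod_triangle (G - y) (k b + ((- k a - J) + RtoC eps * (p1 + p2 + p3)))).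
  assert (T2 := Cmod_triangle (k b) ((- k a - J) + RtoC eps * (p1 + p2 + p3))).
  assert (T3 := Cmod_triangle (- k a - J) (RtoC eps * (p1 + p2 + p3))).
  rewrite Cmod_mult, Cmod_pos_RtoC in T3 by lra.
  assert (T4 := Cmod_triangle (p1 + p2) p3). assert (T5 := Cmod_triangle p1 p2).
  assert (T6 : eps * Cmod (p1 + p2 + p3) <= eps * (Cmod J + 2 * eta + K1) + eta).
  { replace (eps * (Cmod J + 2 * eta + K1) + eta) with
      (eps * (Cmod J + 2 * eta + K1 + eta / eps)) by (field; lra).
    apply Rmult_le_compat_l; lra. }
  lra.
Qed.

(** The constant [K] of the estimate depends on [eta], so [eta] is fixed first and [eps] is made
    small afterwards. *)
Lemma abel_RInt_unique (g : R -> C) (G : R -> C) (J J' : C) :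
  (forall u, 0 < u -> Ccont g u) -> is_improper_RInt g J' ->
  (forall eps, 0 < eps -> is_improper_RInt (fun u => RtoC (exp (- eps * u)) * g u)%C (G eps)) ->
  filterlim G (at_right 0) (locally J) -> J = J'.
Proof.
  intros Hg HJ' HG HJ. apply Cmod_eps_eq. intros e He.
  (* Then [5 * eta = e / 2]; the other half is shared by [eps * K] and the distance from [G eps] to
     its limit. *)
  destruct (abel_RInt_estimate g J' (e / 10) Hg HJ' ltac:(lra)) as [K [HK0 HK]].
  destruct (proj1 (filterlim_C (at_right 0) G J) HJ (e / 4) ltac:(lra)) as [d Hd].
  set (eps := Rmin (d / 2) (e / (4 * (K + 1)))).
  assert (He1 : 0 < e / (4 * (K + 1))) by (apply Rdiv_lt_0_compat; lra).
  assert (Hd0 := cond_pos d).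
  assert (Hp : 0 < eps) by (apply Rmin_glb_lt; lra).
  assert (H1 : eps <= d / 2) by apply Rmin_l.
  assert (H2 : eps <= e / (4 * (K + 1))) by apply Rmin_r.
  assert (B1 : Cmod (G eps - J) < e / 4).
  { apply Hd; [|easy]. apply Rabs_def1; unfold minus, plus, opp; simpl; lra. }
  assert (B2 := HK eps (G eps) Hp (HG eps Hp)).
  assert (B3 : eps * K <= e / 4).
  { apply Rle_trans with (e / (4 * (K + 1)) * (K + 1)); [nra|]. right. field. lra. }
  replace (J - J')%C with (- (G eps - J) + (G eps - J'))%C by ring.
  eapply Rle_trans; [apply Cmod_triangle|]. rewrite Cmod_opp. lra.
Qed.

Lemma is_RInt_0_oo_abel (g : R -> C) (G : R -> C) (J : C) :
  (forall u, 0 < u -> Ccont g u) ->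
  (forall eps, 0 < eps -> is_improper_RInt (fun u => RtoC (exp (- eps * u)) * g u)%C (G eps)) ->
  filterlim G (at_right 0) (locally J) -> is_RInt_0_oo g J.
Proof.
  intros Hg HG HJ. destruct (classic (exists J', is_improper_RInt g J')) as [[J' HJ']|HN].
  - left. now rewrite (abel_RInt_unique g G J J').
  - right. split; [easy|]. now exists G.
Qed.

(** A total operator, so that a sum can be treated as a function of the parameters in its terms and
    differentiated; its value means something only for convergent series. *)
Definition Csum (a : nat -> C) : C :=
  (real (Lim_seq (fun n => Re (psum a n))), real (Lim_seq (fun n => Im (psum a n)))).

Lemma Csum_eq (a : nat -> C) (l : C) : has_sum a l -> Csum a = l.
Proof.
  intros H. unfold Csum.
  assert (H1 : is_lim_seq (fun n => Re (psum a n)) (Re l)).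
  { apply is_lim_seq_spec. intros eps. destruct (H eps (cond_pos eps)) as [N HN].
    exists N. intros n Hn. eapply Rle_lt_trans; [|apply (HN n Hn)].
    exact (re_le_Cmod (psum a n - l)). }
  assert (H2 : is_lim_seq (fun n => Im (psum a n)) (Im l)).
  { apply is_lim_seq_spec. intros eps. destruct (H eps (cond_pos eps)) as [N HN].
    exists N. intros n Hn. eapply Rle_lt_trans; [|apply (HN n Hn)].
    exact (im_le_Cmod (psum a n - l)). }
  rewrite (is_lim_seq_unique _ _ H1), (is_lim_seq_unique _ _ H2). now destruct l.
Qed.

Lemma Csum_correct (a : nat -> C) (M : nat -> R) :
  (forall k, Cmod (a k) <= M k) -> bsummable M -> has_sum a (Csum a).
Proof.
  intros H1 H2. destruct (has_sum_dominated a M H1 H2) as [l Hl]. now rewrite (Csum_eq a l Hl).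
Qed.

(** * Summable majorants with exponents of sublinear growth *)

Definition sublinear (L : nat -> R) : Prop :=
  forall eta, 0 < eta -> exists K, forall m, L m <= K + eta * INR m.

(** With slope [y / (2 (A + 1))], the term [A * L m] consumes at most half of the decay [y * m], and
    a geometric series of ratio [e^(- y / 2)] remains. *)
Lemma sublinear_exp_bsummable (L : nat -> R) (A B y : R) :
  sublinear L -> 0 <= A -> 0 < y -> bsummable (fun m => exp (A * L m + B - y * INR m)).
Proof.
  intros HL HA Hy. destruct (HL (y / (2 * (A + 1)))) as [K HK]; [apply Rdiv_lt_0_compat; lra|].
  apply (bsummable_le _ (fun m => exp (A * K + B) * exp (- (y / 2)) ^ m)).
  - intros m. split; [left; apply exp_pos|].
    rewrite <- Rpower_pow by apply exp_pos. unfold Rpower. rewrite ln_exp, <- exp_plus.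
    apply exp_le. specialize (HK m). assert (Hm := pos_INR m).
    apply (Rmult_le_compat_l A) in HK; [|easy].
    assert (A * (y / (2 * (A + 1)) * INR m) <= y / 2 * INR m).
    { rewrite <- Rmult_assoc. apply Rmult_le_compat_r; [easy|].
      apply Rle_trans with ((A + 1) * (y / (2 * (A + 1)))); [|right; field; lra].
      apply Rmult_le_compat_r; [|lra]. left. apply Rdiv_lt_0_compat; lra. }
    lra.
  - apply bsummable_scal; [left; apply exp_pos|]. apply bsummable_geom.
    split; [left; apply exp_pos|]. rewrite <- exp_0. apply exp_increasing. lra.
Qed.

(** Bounds the principal logarithm of a number whose modulus lies between [d] and [A + B m]; [PI]
    accounts for the argument. Complex powers of the frequencies are controlled through it. *)
Definition log_bound (d A B : R) (m : nat) : R := Rabs (ln d) + Rabs (ln (A + B * INR m)) + PI.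

Lemma log_bound_sublinear (d A B : R) : 0 < A -> 0 <= B -> sublinear (log_bound d A B).
Proof.
  intros HA HB eta Heta.
  (* The slope of the linear bound [ln y <= k y - 1 - ln k], chosen so that [k * B <= eta]. *)
  set (k := eta / (B + 1)). assert (Hk : 0 < k) by (apply Rdiv_lt_0_compat; lra).
  exists (Rabs (ln d) + PI + Rabs (ln A) + k * A + Rabs (ln k)). intros m.
  unfold log_bound. assert (Hm := pos_INR m).
  assert (HBm : 0 <= B * INR m) by now apply Rmult_le_pos.
  assert (H1 : ln A <= ln (A + B * INR m)) by (apply ln_le; lra).
  assert (H2 := ln_le_sub_1 (k * (A + B * INR m)) ltac:(apply Rmult_lt_0_compat; lra)).
  rewrite ln_mult in H2 by lra.
  assert (H3 : k * B * INR m <= eta * INR m).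
  { apply Rmult_le_compat_r; [easy|]. apply Rle_trans with (k * (B + 1)); [nra|].
    right. unfold k. field. lra. }
  assert (H4 := Rle_abs (- ln k)). rewrite Rabs_Ropp in H4.
  assert (H5 := Rle_abs (- ln A)). rewrite Rabs_Ropp in H5.
  assert (H6 := Rabs_pos (ln A)). assert (H7 := Rabs_pos (ln k)).
  assert (Rabs (ln (A + B * INR m)) <= Rabs (ln A) + k * A + Rabs (ln k) + eta * INR m); [|lra].
  apply Rabs_le. split; [|nra].
  assert (0 <= k * A) by nra. assert (0 <= eta * INR m) by nra. lra.
Qed.

Lemma log_bound_correct (d A B : R) (m : nat) (z : C) :
  0 < d -> d <= Cmod z <= A + B * INR m -> Cmod (Clog z) <= log_bound d A B m.
Proof. intros H1 H2. now apply Cmod_Clog_le. Qed.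

(** * The Weyl differintegral of the kernel *)

(* [e^(2 pi i t (m + x)) = e^(- t (freq x m))] *)
Definition freq (x : C) (m : nat) : C := (- (2 * RtoC PI * Ci) * (RtoC (INR m) + x))%C.

(** Up to the factor [Gamma(s)], Euler's integral of the [m]-th geometric term under the damping
    [e^(- eps u)]; [eps = 0] is the Abel limit. *)
Definition weyl_term (eps : R) (s x w : C) (m : nat) : C :=
  (Cpower (RtoC eps + freq x m) (- s) * Cexp (- (freq x m * w)))%C.

Definition lerch_kernel (x tau : C) : C :=
  (Cexp (2 * RtoC PI * Ci * tau * x) / (1 - Cexp (2 * RtoC PI * Ci * tau)))%C.

Lemma Re_freq (x : C) (m : nat) : Re (freq x m) = 2 * PI * Im x.
Proof. unfold freq, Re, Im; simpl. ring. Qed.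

Lemma Im_freq (x : C) (m : nat) : Im (freq x m) = - (2 * PI * (INR m + Re x)).
Proof. unfold freq, Re, Im; simpl. ring. Qed.

Lemma shift_Cmod_ge (x : C) : 0 <= Im x -> ~ on_cut x ->
  exists d, 0 < d /\ forall m, d <= Cmod (RtoC (INR m) + x).
Proof.
  intros H Hc. destruct (Rle_lt_or_eq_dec 0 (Im x) H) as [Hi|Hi].
  - exists (Im x). split; [easy|]. intros m.
    eapply Rle_trans; [|apply Im_le_Cmod]. rewrite Im_plus, Im_RtoC. lra.
  - assert (Hr : 0 < Re x).
    { apply Rnot_le_lt. intros Hn. apply Hc. split; lra. }
    exists (Re x). split; [easy|]. intros m.
    eapply Rle_trans; [|apply Re_le_Cmod]. rewrite Re_plus, Re_RtoC. generalize (pos_INR m); lra.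
Qed.

Lemma Cmod_RtoC_plus_ge (r : R) (z : C) : 0 <= r -> 0 <= Re z -> Cmod z <= Cmod (RtoC r + z).
Proof.
  intros Hr Hz. assert (H1 := Cmod2_alt z). assert (H2 := Cmod2_alt (RtoC r + z)).
  rewrite Re_plus, Im_plus, Re_RtoC, Im_RtoC in H2.
  assert (H3 := Cmod_ge_0 z). assert (H4 := Cmod_ge_0 (RtoC r + z)).
  apply Rsqr_incr_0; [unfold Rsqr; nra|easy|easy].
Qed.

Lemma Cmod_2piI (z : C) : Cmod (- (2 * RtoC PI * Ci) * z) = 2 * PI * Cmod z.
Proof.
  assert (H := PI_RGT_0).
  rewrite Cmod_mult, Cmod_opp, !Cmod_mult, Cmod_Ci, !Cmod_pos_RtoC by lra. ring.
Qed.

(** The linear bound on the frequency is meant for use inside exponents, while [e^(L m)] absorbs its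
    powers into the majorants. The logarithm is bounded uniformly for [eps] in [0, 1], as the limit
    [eps -> 0] requires. *)
Lemma freq_bounds (x : C) : 0 <= Im x -> ~ on_cut x ->
  exists (L : nat -> R) (A : R), 0 <= A /\ sublinear L /\
  (forall m, Cmod (freq x m) <= A + 2 * PI * INR m) /\
  (forall m, Cmod (freq x m) <= exp (L m)) /\
  (forall m eps, 0 <= eps <= 1 ->
     (RtoC eps + freq x m)%C <> 0 /\ Cmod (Clog (RtoC eps + freq x m)) <= L m).
Proof.
  intros Hx Hc. destruct (shift_Cmod_ge x Hx Hc) as [d [Hd0 Hd]].
  assert (Hpi := PI_RGT_0). assert (Hxm := Cmod_ge_0 x).
  set (A := 2 * PI * Cmod x). assert (HA : 0 <= A) by (unfold A; nra).
  assert (Hup : forall m, Cmod (freq x m) <= A + 2 * PI * INR m).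
  { intros m. unfold freq, A. rewrite Cmod_2piI.
    assert (T := Cmod_triangle (RtoC (INR m)) x). rewrite Cmod_pos_RtoC in T by apply pos_INR. nra. }
  (* The frequency has nonnegative real part because [Im x >= 0], so adding [eps] cannot decrease
     its modulus. *)
  assert (Hlow : forall m eps, 0 <= eps -> 2 * PI * d <= Cmod (RtoC eps + freq x m)).
  { intros m eps He. eapply Rle_trans; [|apply Cmod_RtoC_plus_ge; [easy|]].
    - unfold freq. rewrite Cmod_2piI. specialize (Hd m). nra.
    - rewrite Re_freq. nra. }
  assert (Hdd : 0 < 2 * PI * d) by nra.
  assert (Hnz : forall m eps, 0 <= eps -> (RtoC eps + freq x m)%C <> 0).
  { intros m eps He. apply Cmod_gt_0. specialize (Hlow m eps He). lra. }
  assert (Hlog : forall m eps, 0 <= eps <= 1 ->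
    Cmod (Clog (RtoC eps + freq x m)) <= log_bound (2 * PI * d) (A + 1) (2 * PI) m).
  { intros m eps He. apply log_bound_correct; [easy|]. split; [apply Hlow; lra|].
    eapply Rle_trans; [apply Cmod_triangle|]. rewrite Cmod_pos_RtoC by lra.
    specialize (Hup m). lra. }
  exists (log_bound (2 * PI * d) (A + 1) (2 * PI)), A.
  split; [easy|]. split; [apply log_bound_sublinear; lra|]. split; [easy|]. split.
  - intros m. specialize (Hlog m 0 ltac:(lra)). specialize (Hnz m 0 ltac:(lra)).
    replace (RtoC 0 + freq x m)%C with (freq x m) in * by ring.
    rewrite <- (Cexp_Clog (freq x m)) at 1 by easy.
    eapply Rle_trans; [apply Cexp_le|]. now apply exp_le.
  - intros m eps He. split; [apply Hnz; lra|now apply Hlog].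
Qed.

Lemma Cmod_Cexp_freq (x w : C) (m : nat) :
  Cmod (Cexp (- (freq x m * w))) = exp (- (2 * PI * Im (x * w)) - 2 * PI * Im w * INR m).
Proof.
  rewrite Cmod_Cexp. f_equal. rewrite Re_opp, Re_mult, Re_freq, Im_freq, Im_mult. ring.
Qed.

Lemma Cpower_le (z w : C) (L : R) : Cmod (Clog z) <= L -> Cmod (Cpower z w) <= exp (Cmod w * L).
Proof.
  intros H. unfold Cpower. eapply Rle_trans; [apply Cexp_le|]. apply exp_le.
  rewrite Cmod_mult. apply Rmult_le_compat_l; [apply Cmod_ge_0|easy].
Qed.

(** The power grows at most like [e^(|s| L m)] with [L] sublinear, and [Im w > 0] supplies
    exponential decay in [m] that beats it. *)
Lemma weyl_term_majorant (s x w : C) : 0 <= Im x -> ~ on_cut x -> 0 < Im w ->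
  exists M, bsummable M /\ forall eps m, 0 <= eps <= 1 -> Cmod (weyl_term eps s x w m) <= M m.
Proof.
  intros Hx Hc Hw. destruct (freq_bounds x Hx Hc) as [L [A [HA [HL [_ [_ HB]]]]]].
  exists (fun m => exp (Cmod s * L m + - (2 * PI * Im (x * w)) - (2 * PI * Im w) * INR m)).
  assert (Hpi := PI_RGT_0). split.
  - apply sublinear_exp_bsummable; [easy|apply Cmod_ge_0|nra].
  - intros eps m He. unfold weyl_term. rewrite Cmod_mult, Cmod_Cexp_freq.
    replace (Cmod s * L m + - (2 * PI * Im (x * w)) - 2 * PI * Im w * INR m) with
      (Cmod (- s) * L m + (- (2 * PI * Im (x * w)) - 2 * PI * Im w * INR m))
      by (rewrite Cmod_opp; ring).
    rewrite exp_plus. apply Rmult_le_compat_r; [left; apply exp_pos|].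
    apply Cpower_le. now apply HB.
Qed.

Lemma weyl_term_sum (s x w : C) : 0 <= Im x -> ~ on_cut x -> 0 < Im w ->
  has_sum (weyl_term 0 s x w) (Csum (weyl_term 0 s x w)).
Proof.
  intros Hx Hc Hw. destruct (weyl_term_majorant s x w Hx Hc Hw) as [M [HM1 HM2]].
  apply (Csum_correct _ M); [|easy]. intros m. apply HM2. lra.
Qed.

Lemma Cexp_2piI_lt_1 (tau : C) : 0 < Im tau ->
  Cmod (Cexp (2 * RtoC PI * Ci * tau)) = exp (- (2 * PI * Im tau)) /\
  exp (- (2 * PI * Im tau)) < 1.
Proof.
  intros H. assert (Hpi := PI_RGT_0). split.
  - rewrite Cmod_Cexp. f_equal. unfold Re, Im; simpl. ring.
  - rewrite <- exp_0. apply exp_increasing. nra.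
Qed.

(** The lower bound depends on [y] alone, hence is uniform along a horizontal ray. *)
Lemma one_minus_Cexp_ge (tau : C) (y : R) : 0 < y -> y <= Im tau ->
  0 < 1 - exp (- (2 * PI * y)) <= Cmod (1 - Cexp (2 * RtoC PI * Ci * tau)).
Proof.
  intros Hy H. assert (Hpi := PI_RGT_0).
  destruct (Cexp_2piI_lt_1 tau) as [E _]; [lra|]. split.
  - assert (exp (- (2 * PI * y)) < exp 0) by (apply exp_increasing; nra).
    rewrite exp_0 in *. lra.
  - assert (T := Cmod_triangle_rev 1 (- Cexp (2 * RtoC PI * Ci * tau))).
    rewrite Cmod_1, Cmod_opp, E in T.
    assert (exp (- (2 * PI * Im tau)) <= exp (- (2 * PI * y))) by (apply exp_le; nra).
    unfold Cminus. lra.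
Qed.

Lemma one_minus_Cexp_neq_0 (tau : C) : 0 < Im tau ->
  (1 - Cexp (2 * RtoC PI * Ci * tau))%C <> 0.
Proof.
  intros H. apply Cmod_gt_0. destruct (one_minus_Cexp_ge tau (Im tau) H (Rle_refl _)). lra.
Qed.

Lemma freq_succ (x w : C) (m : nat) :
  Cexp (- (freq x (S m) * w)) = (Cexp (- (freq x m * w)) * Cexp (2 * RtoC PI * Ci * w))%C.
Proof. rewrite <- Cexp_plus. f_equal. unfold freq. rewrite S_INR, RtoC_plus. ring. Qed.

Lemma Cpower_pos (u : R) (w : C) : 0 < u -> Cpower (RtoC u) w = Cexp (w * RtoC (ln u)).
Proof. intros H. unfold Cpower. now rewrite Clog_pos. Qed.

Lemma Ccont_Cexp_affine (a w : C) (u : R) : Ccont (fun u => Cexp (a * (w + RtoC u))) u.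
Proof.
  apply Ccont_exp, Ccont_mult; [apply Ccont_const|].
  apply Ccont_plus; [apply Ccont_const|apply Ccont_id].
Qed.

Lemma lerch_kernel_cont (x w : C) (u : R) : 0 < Im w -> Ccont (fun u => lerch_kernel x (w + RtoC u)) u.
Proof.
  intros Hw. unfold lerch_kernel.
  apply (Ccont_mult (fun u => Cexp (2 * RtoC PI * Ci * (w + RtoC u) * x))).
  - apply Ccont_exp, Ccont_mult; [|apply Ccont_const].
    apply Ccont_mult; [apply Ccont_const|].
    apply Ccont_plus; [apply Ccont_const|apply Ccont_id].
  - apply Ccont_inv.
    + apply (Ccont_plus (fun _ => RtoC 1)); [apply Ccont_const|].
      apply Ccont_opp, Ccont_Cexp_affine.
    + apply one_minus_Cexp_neq_0. rewrite Im_plus, Im_RtoC. lra.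
Qed.

Lemma Cpower_cont (s : C) (u : R) : 0 < u -> Ccont (fun u => Cpower (RtoC u) s) u.
Proof.
  intros Hu. apply (Cderiv_cont _ _ (s * RtoC (/ u) * Cexp (s * RtoC (ln u)))%C).
  apply (Cderiv_ext (fun u => Cexp (s * RtoC (ln u)))).
  - exists (mkposreal u Hu). intros v Hv. symmetry. apply Cpower_pos.
    apply Rabs_def2 in Hv. unfold minus, plus, opp in Hv; simpl in Hv. lra.
  - apply Cderiv_exp, Cderiv_scal, Cderiv_RtoC. now apply is_derive_ln'.
Qed.

(** Induction on the identity [1 / (1 - q) = 1 + q / (1 - q)]: each step removes one exponential,
    whose integral is an Euler integral. Only finite sums of integrals occur. *)
Lemma kernel_remainder_improper (s x w : C) (eps : R) (J : C) (N : nat) :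
  0 < Re s -> 0 <= Im x -> ~ on_cut x -> 0 < Im w -> 0 < eps ->
  is_improper_RInt (fun u => RtoC (exp (- eps * u)) *
    (Cpower (RtoC u) (s - 1) * lerch_kernel x (w + RtoC u)))%C J ->
  is_improper_RInt (fun u => gker s (RtoC eps) u *
     (Cexp (- (freq x N * (w + RtoC u))) / (1 - Cexp (2 * RtoC PI * Ci * (w + RtoC u)))))%C
    (J - CGamma s * psum (weyl_term eps s x w) N)%C.
Proof.
  intros Hs Hx Hc Hw He HJ. induction N as [|N IH].
  - simpl. replace (J - CGamma s * 0)%C with J by ring.
    eapply improper_ext; [|apply HJ]. intros u Hu. cbv beta.
    rewrite Cpower_pos by easy. unfold gker, lerch_kernel.
    rewrite <- Cexp_RtoC, !Cmult_assoc, <- Cexp_plus. unfold Cdiv. rewrite !Cmult_assoc.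
    f_equal. f_equal; f_equal.
    + rewrite RtoC_mult, RtoC_opp. ring.
    + unfold freq. simpl. ring.
  - assert (Hp : 0 < Re (RtoC eps + freq x N)).
    { rewrite Re_plus, Re_RtoC, Re_freq. assert (H := PI_RGT_0). nra. }
    assert (HG := improper_scal _ (Cexp (- (freq x N * w))) _ (gker_improper s _ Hs Hp)).
    assert (HD := improper_minus _ _ _ _ IH HG).
    replace (J - CGamma s * psum (weyl_term eps s x w) (S N))%C with
      (J - CGamma s * psum (weyl_term eps s x w) N
        - Cexp (- (freq x N * w)) * (CGamma s * Cpower (RtoC eps + freq x N) (- s)))%C
      by (simpl; unfold weyl_term at 3; ring).
    eapply improper_ext; [|apply HD]. intros u Hu. cbv beta. rewrite freq_succ.
    set (q := Cexp (2 * RtoC PI * Ci * (w + RtoC u))).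
    assert (Hq : (1 - q)%C <> 0).
    { apply one_minus_Cexp_neq_0. rewrite Im_plus, Im_RtoC. lra. }
    assert (E : (Cexp (- (freq x N * w)) * gker s (RtoC eps + freq x N) u)%C
      = (gker s (RtoC eps) u * Cexp (- (freq x N * (w + RtoC u))))%C).
    { unfold gker. rewrite <- !Cexp_plus. f_equal. ring. }
    rewrite E. field. exact Hq.
Qed.

Lemma weyl_abel_integral (s x w : C) (eps : R) :
  0 < Re s -> 0 <= Im x -> ~ on_cut x -> 0 < Im w -> 0 < eps ->
  exists S, has_sum (weyl_term eps s x w) S /\
  is_improper_RInt (fun u => RtoC (exp (- eps * u)) *
    (Cpower (RtoC u) (s - 1) * lerch_kernel x (w + RtoC u)))%C (CGamma s * S)%C.
Proof.
  intros Hs Hx Hc Hw He. assert (Hpi := PI_RGT_0).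
  destruct (power_exp_majorant (Re s) eps 0 Hs He) as [K [HK0 HK]].
  set (B := exp (- (2 * PI * Im (x * w)))). assert (HB : 0 < B) by apply exp_pos.
  set (D := 1 - exp (- (2 * PI * Im w))).
  assert (HD := one_minus_Cexp_ge w (Im w) Hw (Rle_refl _)). fold D in HD.
  (* The remainder after [N] terms carries [q^N] with [q = e^(-2 pi Im w)]. Moving along the ray
     adds [u * Im x >= 0] to [Im (x w)], so the numerator does not grow. *)
  assert (Bnd : forall N u, 0 < u ->
    Cmod (gker s (RtoC eps) u * (Cexp (- (freq x N * (w + RtoC u))) /
      (1 - Cexp (2 * RtoC PI * Ci * (w + RtoC u)))))
    <= K * (B * exp (- (2 * PI * Im w)) ^ N / D) * power_majorant (Re s) u).
  { intros N u Hu.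
    assert (Hwu : Im (w + RtoC u) = Im w) by (rewrite Im_plus, Im_RtoC; ring).
    assert (HDu := one_minus_Cexp_ge (w + RtoC u) (Im w) Hw ltac:(lra)). fold D in HDu.
    rewrite Cmod_mult, Cmod_div by (apply one_minus_Cexp_neq_0; lra).
    rewrite Cmod_gker, Cmod_Cexp_freq, Hwu, Re_RtoC.
    specialize (HK u Hu). rewrite pow_O, Rmult_1_l in HK.
    replace (K * (B * exp (- (2 * PI * Im w)) ^ N / D) * power_majorant (Re s) u) with
      ((K * power_majorant (Re s) u) * (B * exp (- (2 * PI * Im w)) ^ N / D)) by ring.
    apply Rmult_le_compat; [left; apply exp_pos| |easy|].
    - apply Rdiv_le_0_compat; [left; apply exp_pos|lra].
    - unfold Rdiv. apply Rmult_le_compat; [left; apply exp_pos| | |].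
      + left. apply Rinv_0_lt_compat. lra.
      + rewrite <- Rpower_pow by apply exp_pos. unfold Rpower, B. rewrite ln_exp, <- exp_plus.
        apply exp_le. rewrite Im_mult, Hwu, Re_plus, Re_RtoC, Im_mult.
        assert (Hxu : 0 <= PI * (Im x * u)) by (apply Rmult_le_pos; [lra|nra]). lra.
      + apply Rinv_le_contravar; lra. }
  (* Convergence of the damped integral is the remainder bound with [N = 0]. *)
  assert (Ex : exists J, is_improper_RInt (fun u => RtoC (exp (- eps * u)) *
    (Cpower (RtoC u) (s - 1) * lerch_kernel x (w + RtoC u)))%C J).
  { apply (improper_exists _ (K * (B * exp (- (2 * PI * Im w)) ^ 0 / D)) (Re s)); [easy| | |].
    - apply Rmult_le_pos; [easy|]. apply Rdiv_le_0_compat; [simpl; lra|lra].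
    - intros u Hu. apply Ccont_mult; [eapply Cderiv_cont, Cderiv_exp_scal|].
      apply Ccont_mult; [now apply Cpower_cont|now apply lerch_kernel_cont].
    - intros u Hu. eapply Rle_trans; [|apply (Bnd O u Hu)]. right. f_equal.
      rewrite Cpower_pos by easy. unfold gker, lerch_kernel.
      rewrite <- Cexp_RtoC, !Cmult_assoc, <- Cexp_plus. unfold Cdiv. rewrite !Cmult_assoc.
      f_equal. f_equal; f_equal.
      + rewrite RtoC_mult, RtoC_opp. ring.
      + unfold freq. simpl. ring. }
  destruct Ex as [J HJ]. exists (/ CGamma s * J)%C.
  assert (HG := CGamma_neq_0 s Hs). split.
  - intros e Hep. assert (Hgm := proj1 (Cmod_gt_0 _) HG).
    set (C0 := K * (B / D) / Re s).
    assert (HC0 : 0 <= C0).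
    { apply Rdiv_le_0_compat; [|easy]. apply Rmult_le_pos; [easy|]. apply Rdiv_le_0_compat; lra. }
    destruct (Cexp_2piI_lt_1 w Hw) as [_ Hq].
    set (q := exp (- (2 * PI * Im w))) in *. assert (Hq0 : 0 < q) by apply exp_pos.
    destruct (pow_lt_1_zero q ltac:(rewrite Rabs_pos_eq; lra) (e * Cmod (CGamma s) / (C0 + 1)))
      as [N HN]; [apply Rdiv_lt_0_compat; nra|].
    exists N. intros n Hn. specialize (HN n Hn).
    rewrite Rabs_pos_eq in HN by (apply pow_le; lra).
    assert (R1 := kernel_remainder_improper s x w eps J n Hs Hx Hc Hw He HJ).
    assert (R2 := improper_norm_le _ _ (Re s) _ Hs
      (Rmult_le_pos _ _ HK0 (Rdiv_le_0_compat (B * q ^ n) D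
        (Rmult_le_pos _ _ (Rlt_le _ _ HB) (pow_le q n (Rlt_le _ _ Hq0))) (proj1 HD)))
      (Bnd n) R1).
    apply (Rmult_lt_reg_l (Cmod (CGamma s))); [easy|].
    rewrite <- Cmod_mult.
    replace (CGamma s * (psum (weyl_term eps s x w) n - / CGamma s * J))%C with
      (- (J - CGamma s * psum (weyl_term eps s x w) n))%C by (field; easy).
    rewrite Cmod_opp. eapply Rle_lt_trans; [apply R2|].
    replace (K * (B * q ^ n / D) / Re s) with (C0 * q ^ n) by (unfold C0; field; lra).
    apply (Rmult_lt_compat_l (C0 + 1)) in HN; [|lra].
    replace ((C0 + 1) * (e * Cmod (CGamma s) / (C0 + 1))) with (Cmod (CGamma s) * e) in HN
      by (field; lra).
    assert (0 <= q ^ n) by (apply pow_le; lra). nra.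
  - replace (CGamma s * (/ CGamma s * J))%C with J by (field; easy). exact HJ.
Qed.

(** The half-angle formula makes the argument smooth up to and including the imaginary axis, where
    the frequencies lie when [x] is real. *)
Lemma Clog_right_cont (z : C) : 0 <= Re z -> z <> 0 ->
  forall eps, 0 < eps -> at_right 0 (fun r => Cmod (Clog (RtoC r + z) - Clog z) < eps).
Proof.
  intros Hz Hz0. set (a := Re z). set (b := Im z).
  set (n := fun r : R => sqrt ((r + a) ^ 2 + b ^ 2)).
  set (lc := fun r : R => ((ln (n r), 2 * atan (b / (n r + (r + a)))) : C)).
  assert (Hab : 0 < (0 + a) ^ 2 + b ^ 2).
  { assert (H := proj1 (Cmod_gt_0 z) Hz0). assert (H2 := Cmod2_alt z). fold a b in H2. nra. }
  assert (Hn0 : 0 < n 0) by now apply sqrt_lt_R0.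
  assert (E : forall r, 0 <= r -> Clog (RtoC r + z) = lc r).
  { intros r Hr. assert (En : Cmod (RtoC r + z) = n r).
    { unfold n, Cmod. f_equal. unfold a, b, Re, Im; simpl. ring. }
    unfold Clog, lc. rewrite Carg_atan.
    - rewrite En, Re_plus, Im_plus, Re_RtoC, Im_RtoC. fold a b. now rewrite Rplus_0_l.
    - apply on_cut_dec_Re; [rewrite Re_plus, Re_RtoC; lra|].
      apply Cmod_gt_0. eapply Rlt_le_trans; [apply (proj1 (Cmod_gt_0 z) Hz0)|].
      now apply Cmod_RtoC_plus_ge. }
  assert (Cl : Ccont lc 0).
  { assert (Hpos : n 0 + (0 + a) <> 0) by (fold a in Hz; lra).
    split; simpl.
    - apply (ex_derive_continuous (fun r => ln (n r))). unfold n in *. auto_derive.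
      simpl in *. repeat split; try lra.
    - apply (ex_derive_continuous (fun r => 2 * atan (b / (n r + (r + a))))).
      unfold n in *. auto_derive. simpl in *. repeat split; try lra. }
  intros eps He.
  assert (H := proj1 (filterlim_C (locally 0) lc (lc 0)) (Ccont_continuous lc 0 Cl) eps He).
  destruct H as [d Hd]. exists d. intros r Hr Hr0. rewrite E by lra.
  replace z with (RtoC 0 + z)%C at 1 by ring. rewrite E by lra. now apply Hd.
Qed.

Lemma weyl_term_right_cont (s x w : C) (m : nat) : 0 <= Im x -> ~ on_cut x ->
  forall eps, 0 < eps ->
  at_right 0 (fun r => Cmod (weyl_term r s x w m - weyl_term 0 s x w m) < eps).
Proof.
  intros Hx Hc eps He.
  assert (Hf0 : freq x m <> 0).
  { destruct (freq_bounds x Hx Hc) as [L [A [_ [_ [_ [_ HB]]]]]].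
    destruct (HB m 0 ltac:(lra)) as [H _]. now replace (RtoC 0 + freq x m)%C with (freq x m) in H by ring. }
  assert (Hfr : 0 <= Re (freq x m)) by (rewrite Re_freq; assert (H := PI_RGT_0); nra).
  set (P := fun r => (Cexp (- s * Clog (RtoC r + freq x m)))).
  set (W := Cmod (P 0)). assert (HW : 0 <= W) by apply Cmod_ge_0.
  set (V := Cmod (Cexp (- (freq x m * w)))). assert (HV : 0 <= V) by apply Cmod_ge_0.
  set (S1 := Cmod s + 1). assert (HS1 : 1 <= S1) by (unfold S1; assert (H := Cmod_ge_0 s); lra).
  set (e1 := exp 1). assert (He1 : 0 < e1) by apply exp_pos.
  set (D := (W + 1) * (V + 1) * (1 + 2 * e1)).
  assert (HD : 0 < D) by (unfold D; repeat apply Rmult_lt_0_compat; lra).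
  set (del := Rmin 1 (eps / D) / S1).
  assert (Hm : 0 < Rmin 1 (eps / D)).
  { apply Rmin_glb_lt; [lra|]. now apply Rdiv_lt_0_compat. }
  assert (Hdel : 0 < del) by (apply Rdiv_lt_0_compat; lra).
  generalize (Clog_right_cont (freq x m) Hfr Hf0 del Hdel). apply filter_imp. intros r Hr.
  (* The quotient of the two powers is [e^h], and [|e^h - 1| <= |h| (1 + 2e)] for [|h| < 1]. The
     constant [D] collects this factor and the moduli of the remaining factors. *)
  set (h := (- s * (Clog (RtoC r + freq x m) - Clog (freq x m)))%C).
  assert (Hh : Cmod h < Rmin 1 (eps / D)).
  { unfold h. rewrite Cmod_mult, Cmod_opp.
    replace (Rmin 1 (eps / D)) with (S1 * del) by (unfold del; field; lra).
    assert (H := Cmod_ge_0 (Clog (RtoC r + freq x m) - Clog (freq x m))).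
    assert (H2 := Cmod_ge_0 s). unfold S1 in *. nra. }
  assert (Hh1 : Cmod h < 1) by (eapply Rlt_le_trans; [apply Hh|apply Rmin_l]).
  assert (Hh2 : Cmod h < eps / D) by (eapply Rlt_le_trans; [apply Hh|apply Rmin_r]).
  assert (Hh0 := Cmod_ge_0 h).
  assert (T := Cexp_taylor2 h).
  assert (T2 : Cmod (Cexp h - 1) <= Cmod h * (1 + 2 * e1)).
  { replace (Cexp h - 1)%C with ((Cexp h - 1 - h) + h)%C by ring.
    eapply Rle_trans; [apply Cmod_triangle|].
    assert (exp (Cmod h) <= e1) by (apply exp_le; lra).
    assert (Cmod h ^ 2 * exp (Cmod h) <= Cmod h * e1); [|lra].
    apply Rmult_le_compat; [nra|left; apply exp_pos|nra|easy]. }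
  unfold weyl_term, Cpower. replace (RtoC 0 + freq x m)%C with (freq x m) by ring.
  replace (- s * Clog (RtoC r + freq x m))%C with (h + (- s * Clog (freq x m)))%C by (unfold h; ring).
  rewrite Cexp_plus.
  replace (Cexp (- s * Clog (freq x m))) with (P 0)
    by (unfold P; now replace (RtoC 0 + freq x m)%C with (freq x m) by ring).
  replace (Cexp h * P 0 * Cexp (- (freq x m * w)) - P 0 * Cexp (- (freq x m * w)))%C with
    ((Cexp h - 1) * (P 0 * Cexp (- (freq x m * w))))%C by ring.
  rewrite !Cmod_mult. fold W V.
  apply Rle_lt_trans with (Cmod h * D).
  - unfold D. replace (Cmod h * ((W + 1) * (V + 1) * (1 + 2 * e1))) with
      (Cmod h * (1 + 2 * e1) * ((W + 1) * (V + 1))) by ring.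
    apply Rmult_le_compat; [apply Cmod_ge_0|nra|easy|nra].
  - apply (Rmult_lt_compat_r D) in Hh2; [|easy].
    now replace (eps / D * D) with eps in Hh2 by (field; lra).
Qed.

(** Tannery's theorem lets [eps] tend to 0 under the sum. The final division uses that Gamma does
    not vanish. *)
Lemma weyl_integral_lerch (s x w : C) :
  0 < Re s -> 0 <= Im x -> ~ on_cut x -> 0 < Im w ->
  is_weyl_integral s (lerch_kernel x) w (Csum (weyl_term 0 s x w)).
Proof.
  intros Hs Hx Hc Hw. exists (CGamma s * Csum (weyl_term 0 s x w))%C. split.
  - apply (is_RInt_0_oo_abel _ (fun eps => CGamma s * Csum (weyl_term eps s x w))%C).
    + intros u Hu. apply Ccont_mult; [now apply Cpower_cont|now apply lerch_kernel_cont].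
    + intros eps He. destruct (weyl_abel_integral s x w eps Hs Hx Hc Hw He) as [S [HS1 HS2]].
      now rewrite (Csum_eq _ _ HS1).
    + destruct (weyl_term_majorant s x w Hx Hc Hw) as [M [HM1 HM2]].
      apply (has_sum_limit (at_right 0) (fun r m => CGamma s * weyl_term r s x w m)%C
        (fun m => CGamma s * weyl_term 0 s x w m)%C (fun m => Cmod (CGamma s) * M m)).
      * intros m eps He. assert (Hg := Cmod_ge_0 (CGamma s)).
        generalize (weyl_term_right_cont s x w m Hx Hc (eps / (Cmod (CGamma s) + 1))
          ltac:(apply Rdiv_lt_0_compat; lra)).
        apply filter_imp. intros r Hr.
        replace (CGamma s * weyl_term r s x w m - CGamma s * weyl_term 0 s x w m)%C with
          (CGamma s * (weyl_term r s x w m - weyl_term 0 s x w m))%C by ring.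
        rewrite Cmod_mult. apply (Rmult_lt_compat_l (Cmod (CGamma s) + 1)) in Hr; [|lra].
        replace ((Cmod (CGamma s) + 1) * (eps / (Cmod (CGamma s) + 1))) with eps in Hr
          by (field; lra).
        assert (H := Cmod_ge_0 (weyl_term r s x w m - weyl_term 0 s x w m)). nra.
      * exists (mkposreal 1 Rlt_0_1). intros r Hr Hr0.
        apply Rabs_def2 in Hr. unfold minus, plus, opp in Hr; simpl in Hr. split.
        -- intros m. rewrite Cmod_mult. apply Rmult_le_compat_l; [apply Cmod_ge_0|].
           apply HM2. lra.
        -- apply has_sum_scal. apply (Csum_correct _ M); [|easy]. intros m. apply HM2. lra.
      * intros m. rewrite Cmod_mult. apply Rmult_le_compat_l; [apply Cmod_ge_0|].
        apply HM2. lra.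
      * apply has_sum_scal. now apply weyl_term_sum.
      * apply bsummable_scal; [apply Cmod_ge_0|easy].
  - field. now apply CGamma_neq_0.
Qed.

(** * Termwise complex differentiation in the upper half-plane *)

Lemma is_derive_C_of_quadratic (f : C -> C) (z l : C) (K r : R) : 0 < r -> 0 <= K ->
  (forall h, Cmod h < r -> Cmod (f (z + h)%C - f z - h * l) <= K * Cmod h ^ 2) ->
  @is_derive C_AbsRing C_NormedModule f z l.
Proof.
  intros Hr HK H. split.
  - apply is_linear_scal_l.
  - intros y Hy.
    assert (Ey := is_filter_lim_locally_unique (V := AbsRing_NormedModule C_AbsRing) z y Hy). subst y.
    intros eps.
    assert (Hd : 0 < Rmin r (eps / (K + 1))).
    { apply Rmin_glb_lt; [easy|]. apply Rdiv_lt_0_compat; [apply cond_pos|lra]. }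
    exists (mkposreal _ Hd). intros y Hy'.
    change (Cmod (y - z) < Rmin r (eps / (K + 1))) in Hy'.
    change (Cmod (f y - f z - (y - z) * l) <= eps * Cmod (y - z)).
    specialize (H (y - z)%C (Rlt_le_trans _ _ _ Hy' (Rmin_l _ _))).
    assert (Ey : forall v : C, (z + (v - z))%C = v) by (intros v; ring). rewrite Ey in H.
    eapply Rle_trans; [apply H|].
    assert (H2 := Rlt_le_trans _ _ _ Hy' (Rmin_r _ _)). assert (H0 := Cmod_ge_0 (y - z)).
    apply (Rmult_lt_compat_l (K + 1)) in H2; [|lra].
    replace ((K + 1) * (eps / (K + 1))) with (pos eps) in H2 by (field; lra). nra.
Qed.

(** Each term has a remainder of second order in [h], and the constants are summable in [m]. Summing
    these remainders gives a quadratic remainder for the sum itself. *)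
Lemma weyl_sum_derive (s x w : C) : 0 <= Im x -> ~ on_cut x -> 0 < Im w ->
  @is_derive C_AbsRing C_NormedModule (fun w => Csum (weyl_term 0 s x w)) w
    (- Csum (weyl_term 0 (s - 1) x w))%C.
Proof.
  intros Hx Hc Hw. destruct (freq_bounds x Hx Hc) as [L [A [HA [HL [HB1 [HB2 HB3]]]]]].
  assert (Hpi := PI_RGT_0).
  (* For [|h| < r] the factor [e^(|c| |h|)] costs at most half of the decay [2 pi Im w * m]; the
     exponent of [M] keeps the other half. *)
  set (r := Im w / 2). assert (Hr : 0 < r) by (unfold r; lra).
  set (M := fun m => exp ((Cmod s + 2) * L m + (- (2 * PI * Im (x * w)) + A * r)
    - (PI * Im w) * INR m)).
  assert (HM : bsummable M).
  { apply sublinear_exp_bsummable; [easy|assert (H := Cmod_ge_0 s); lra|nra]. }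
  destruct HM as [HM0 [B HB]].
  assert (HB0 : 0 <= B) by (apply (HB O)).
  apply (is_derive_C_of_quadratic _ w _ (2 * B) r); [easy|lra|].
  intros h Hh. assert (Hh0 := Cmod_ge_0 h).
  assert (Hwh : 0 < Im (w + h)).
  { rewrite Im_plus. assert (H := im_le_Cmod h). apply Rabs_le_between in H. unfold r in Hh. lra. }
  assert (S1 := has_sum_minus _ _ _ _ (has_sum_minus _ _ _ _
    (weyl_term_sum s x (w + h) Hx Hc Hwh) (weyl_term_sum s x w Hx Hc Hw))
    (has_sum_scal (- h) _ _ (weyl_term_sum (s - 1) x w Hx Hc Hw))).
  replace (h * - Csum (weyl_term 0 (s - 1) x w))%C with
    (- h * Csum (weyl_term 0 (s - 1) x w))%C by ring.
  refine (has_sum_norm_le _ _ (fun m => (2 * Cmod h ^ 2) * M m) _ _ _ S1).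
  - intros m. cbv beta. unfold weyl_term.
    destruct (HB3 m 0 ltac:(lra)) as [Hnz Hlog].
    replace (RtoC 0 + freq x m)%C with (freq x m) in * by ring.
    set (c := freq x m) in *.
    (* This is why differentiation lowers [s] by 1: the factor [c] brought down raises the exponent
       [- s]. *)
    assert (E1 : Cpower c (- (s - 1)) = (Cpower c (- s) * c)%C).
    { unfold Cpower. replace (- (s - 1) * Clog c)%C with (- s * Clog c + Clog c)%C by ring.
      now rewrite Cexp_plus, (Cexp_Clog c). }
    rewrite E1. replace (- (c * (w + h)))%C with (- (c * w) + - (c * h))%C by ring.
    rewrite Cexp_plus.
    replace (Cpower c (- s) * (Cexp (- (c * w)) * Cexp (- (c * h))) -
      Cpower c (- s) * Cexp (- (c * w)) - - h * (Cpower c (- s) * c * Cexp (- (c * w))))%C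
      with (Cpower c (- s) * Cexp (- (c * w)) * (Cexp (- (c * h)) - 1 - - (c * h)))%C by ring.
    rewrite !Cmod_mult. unfold c at 2. rewrite Cmod_Cexp_freq. fold c.
    assert (T := Cexp_taylor2 (- (c * h))). rewrite Cmod_opp, Cmod_mult in T.
    assert (P := Cpower_le c (- s) (L m) Hlog). rewrite Cmod_opp in P.
    assert (Hc0 := Cmod_ge_0 c). assert (Hm := pos_INR m).
    set (X := exp (- (2 * PI * Im (x * w)) - 2 * PI * Im w * INR m)) in *.
    assert (HX : 0 < X) by apply exp_pos.
    assert (T3 : Cmod (Cexp (- (c * h)) - 1 - - (c * h)) <=
      2 * Cmod h ^ 2 * (exp (2 * L m) * exp ((A + 2 * PI * INR m) * r))).
    { eapply Rle_trans; [apply T|].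
      replace (2 * ((Cmod c * Cmod h) ^ 2 * exp (Cmod c * Cmod h))) with
        (2 * Cmod h ^ 2 * (Cmod c ^ 2 * exp (Cmod c * Cmod h))) by ring.
      apply Rmult_le_compat_l; [nra|].
      apply Rmult_le_compat; [nra|left; apply exp_pos| |].
      - replace (2 * L m) with (L m + L m) by ring. rewrite exp_plus.
        specialize (HB2 m). fold c in HB2. nra.
      - apply exp_le. apply Rmult_le_compat; [easy|easy|apply HB1|lra]. }
    apply Rle_trans with (exp (Cmod s * L m) * X *
      (2 * Cmod h ^ 2 * (exp (2 * L m) * exp ((A + 2 * PI * INR m) * r)))).
    + apply Rmult_le_compat; [|apply Cmod_ge_0| |easy].
      * apply Rmult_le_pos; [apply Cmod_ge_0|lra].
      * apply Rmult_le_compat_r; [lra|easy].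
    + right. transitivity (2 * Cmod h ^ 2 *
        (exp (Cmod s * L m) * X * exp (2 * L m) * exp ((A + 2 * PI * INR m) * r))); [ring|].
      f_equal. unfold X, M. rewrite <- !exp_plus. f_equal. unfold r. field.
  - intros n. rewrite rsum_scal. specialize (HB n). assert (0 <= 2 * Cmod h ^ 2) by nra. nra.
Qed.

Lemma is_derive_C_scal (f : C -> C) (z l k : C) :
  @is_derive C_AbsRing C_NormedModule f z l ->
  @is_derive C_AbsRing C_NormedModule (fun w => k * f w)%C z (k * l)%C.
Proof.
  intros [_ H]. split; [apply is_linear_scal_l|]. intros y Hy eps.
  assert (Hk := Cmod_ge_0 k).
  assert (He : 0 < eps / (Cmod k + 1)) by (apply Rdiv_lt_0_compat; [apply cond_pos|lra]).
  generalize (H y Hy (mkposreal _ He)). apply filter_imp. intros v Hv.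
  change (Cmod (f v - f y - (v - y) * l) <= eps / (Cmod k + 1) * Cmod (v - y)) in Hv.
  change (Cmod (k * f v - k * f y - (v - y) * (k * l)) <= eps * Cmod (v - y)).
  assert (E : (k * f v - k * f y - (v - y) * (k * l) = k * (f v - f y - (v - y) * l))%C).
  { generalize (f v) (f y) (v : C) (y : C). intros. ring. }
  rewrite E, Cmod_mult. apply Rle_trans with ((Cmod k + 1) * (eps / (Cmod k + 1) * Cmod (v - y))).
  - apply Rmult_le_compat; [easy|apply Cmod_ge_0|lra|easy].
  - right. field. lra.
Qed.

Lemma locally_upper_half_plane (t : C) : 0 < Im t -> locally t (fun w : C => 0 < Im w).
Proof.
  intros Ht. exists (mkposreal _ Ht). intros w [_ Hw]. apply Rabs_def2 in Hw.
  unfold minus, plus, opp in Hw; simpl in Hw. unfold Im in *. lra.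
Qed.

Lemma weyl_sum_Cderive_n (s x t : C) (n : nat) : 0 <= Im x -> ~ on_cut x -> 0 < Im t ->
  is_Cderive_n n (fun w => Csum (weyl_term 0 s x w)) t
    (Cpow (- (1)) n * Csum (weyl_term 0 (s - RtoC (INR n)) x t))%C.
Proof.
  intros Hx Hc. revert t. induction n as [|n IH]; intros t Ht.
  - simpl. replace (s - RtoC 0)%C with s by ring. ring.
  - cbn [is_Cderive_n].
    exists (fun w => (Cpow (- (1)) n * Csum (weyl_term 0 (s - RtoC (INR n)) x w))%C). split.
    + eapply filter_imp; [|apply locally_upper_half_plane, Ht]. intros w Hw. now apply IH.
    + assert (D := weyl_sum_derive (s - RtoC (INR n)) x t Hx Hc Ht).
      assert (D2 := is_derive_C_scal _ t _ (Cpow (- (1)) n) D).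
      rewrite S_INR, RtoC_plus.
      replace (s - (RtoC (INR n) + 1))%C with (s - RtoC (INR n) - 1)%C by ring.
      replace (Cpow (- (1)) (S n) * Csum (weyl_term 0 (s - RtoC (INR n) - 1) x t))%C with
        (Cpow (- (1)) n * - Csum (weyl_term 0 (s - RtoC (INR n) - 1) x t))%C
        by (simpl; ring). exact D2.
Qed.

Lemma weyl_I_lerch (mu x w : C) :
  0 <= Re mu -> 0 <= Im x -> ~ on_cut x -> 0 < Im w ->
  is_weyl_I mu (lerch_kernel x) w (Csum (weyl_term 0 mu x w)).
Proof.
  intros Hm Hx Hc Hw. destruct (Rle_lt_or_eq_dec 0 (Re mu) Hm) as [Hp|H0].
  - left. split; [easy|]. now apply weyl_integral_lerch.
  - right. split; [easy|].
    exists (fun w => Csum (weyl_term 0 (mu + 1) x w)). split.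
    + eapply filter_imp; [|apply locally_upper_half_plane, Hw]. intros v Hv.
      apply weyl_integral_lerch; try easy. rewrite Re_plus, Re_RtoC. lra.
    + assert (D := weyl_sum_derive (mu + 1) x w Hx Hc Hw).
      now replace (mu + 1 - 1)%C with mu in D by ring.
Qed.

Lemma weyl_D_lerch (s x t : C) : 0 <= Im x -> ~ on_cut x -> 0 < Im t ->
  is_weyl_D (- s) (lerch_kernel x) t (Csum (weyl_term 0 s x t)).
Proof.
  intros Hx Hc Ht. destruct (Rlt_le_dec 0 (Re s)) as [Hs|Hs].
  - left. rewrite Re_opp. split; [lra|].
    replace (- - s)%C with s by ring. apply weyl_I_lerch; try easy. lra.
  - right. rewrite Re_opp. split; [lra|].
    (* The ceiling of [- Re s]. For [Re s = 0] it is 0 and no derivative is taken, the order of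
       integration then having real part 0. *)
    assert (Hn : exists n : nat, INR n - 1 < - Re s <= INR n).
    { destruct (Rle_lt_or_eq_dec (Re s) 0 Hs) as [Hl|H0].
      - destruct (nfloor1_ex (- Re s)) as [n [H1 H2]]; [lra|].
        exists (S n). rewrite S_INR. lra.
      - exists O. simpl. lra. }
    destruct Hn as [n Hn].
    exists n, (fun w => Csum (weyl_term 0 (RtoC (INR n) - - s) x w)),
      (Cpow (- (1)) n * Csum (weyl_term 0 (RtoC (INR n) - - s - RtoC (INR n)) x t))%C.
    split; [easy|]. split; [|split].
    + eapply filter_imp; [|apply locally_upper_half_plane, Ht]. intros w Hw.
      apply weyl_I_lerch; try easy. unfold Cminus.
      rewrite Re_plus, !Re_opp, Re_RtoC. lra.
    + now apply weyl_sum_Cderive_n.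
    (* The sign [(-1)^n] in the Weyl derivative cancels the one produced by [n] differentiations. *)
    + replace (RtoC (INR n) - - s - RtoC (INR n))%C with s by ring.
      rewrite Cmult_assoc, <- Cpow_mult_l.
      replace (- (1) * - (1))%C with (RtoC 1) by ring. rewrite Cpow_1_l. ring.
Qed.

(** * The identity theorem along real lines *)

Definition lerch_term (t x s : C) (m : nat) : C :=
  (Cpower (RtoC (INR m) + x) (- s) * Cexp (2 * RtoC PI * Ci * t * RtoC (INR m)))%C.

(** The frequency is [2 pi e^(- i pi / 2) (m + x)]. Since [m + x] has argument in [0, PI),
    subtracting [PI / 2] stays within the principal range, and the logarithms add without
    correction. *)
Lemma Clog_freq (x : C) (m : nat) : 0 <= Im x -> ~ on_cut x ->
  Clog (freq x m) = (RtoC (ln (2 * PI)) - Ci * RtoC PI / 2 + Clog (RtoC (INR m) + x))%C.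
Proof.
  intros Hx Hc. assert (Hpi := PI_RGT_0). assert (Hm := pos_INR m).
  assert (Hcm : ~ on_cut (RtoC (INR m) + x)).
  { intros [H1 H2]. rewrite Im_plus, Im_RtoC in H1. rewrite Re_plus, Re_RtoC in H2.
    apply Hc. split; lra. }
  assert (Hz : (RtoC (INR m) + x)%C <> 0).
  { intros E. apply Hcm. rewrite E. split; simpl; lra. }
  assert (Ha := Carg_upper (RtoC (INR m) + x) ltac:(rewrite Im_plus, Im_RtoC; lra) Hcm).
  set (z := (RtoC (INR m) + x)%C) in *.
  rewrite <- (Clog_Cexp (RtoC (ln (2 * PI)) - Ci * RtoC PI / 2 + Clog z)).
  - f_equal. rewrite Cexp_plus, Cexp_Clog by easy. unfold freq. fold z. f_equal.
    unfold Cminus. rewrite Cexp_plus, Cexp_RtoC, exp_ln by lra.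
    replace (- (Ci * RtoC PI / 2))%C with ((0, - (PI / 2)) : C).
    + unfold Cexp; simpl. rewrite exp_0, cos_neg, sin_neg, cos_PI2, sin_PI2.
      apply C_ext; simpl; ring.
    + apply C_ext; simpl; field.
  - assert (E : Im (RtoC (ln (2 * PI)) - Ci * RtoC PI / 2 + Clog z) = Carg z - PI / 2).
    { unfold Clog, Im. simpl. field. }
    rewrite E. lra.
Qed.

Lemma lerch_term_weyl (t x s : C) (m : nat) : 0 <= Im x -> ~ on_cut x ->
  lerch_term t x s m =
  (Cpower (2 * RtoC PI) s * Cexp (- (Ci * RtoC PI) * (s / 2 + 2 * t * x))
   * weyl_term 0 s x t m)%C.
Proof.
  intros Hx Hc. assert (Hpi := PI_RGT_0). unfold lerch_term, weyl_term.
  replace (RtoC 0 + freq x m)%C with (freq x m) by ring.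
  unfold Cpower at 3. rewrite Clog_freq by easy.
  replace (2 * RtoC PI)%C with (RtoC (2 * PI)) at 2 by (now rewrite RtoC_mult).
  rewrite Cpower_pos by lra. unfold Cpower. rewrite <- !Cexp_plus. f_equal.
  unfold freq. field.
Qed.

(** A bound on the absolute series at radius [r] is part of the definition, because the identity
    theorem uses it to estimate tails. *)
Definition real_analytic_at (f : R -> C) (x0 : R) : Prop :=
  exists (r : R) (b : nat -> C) (M : R), 0 < r /\
    (forall n, rsum (fun k => Cmod (b k) * r ^ k) n <= M) /\
    (forall h, Rabs h < r -> has_sum (fun k => b k * RtoC (h ^ k))%C (f (x0 + h))).

Lemma real_analytic_minus (f g : R -> C) (x0 : R) :
  real_analytic_at f x0 -> real_analytic_at g x0 ->
  real_analytic_at (fun x => f x - g x)%C x0.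
Proof.
  intros [r1 [b1 [M1 [Hr1 [HM1 H1]]]]] [r2 [b2 [M2 [Hr2 [HM2 H2]]]]].
  assert (L1 := Rmin_l r1 r2). assert (L2 := Rmin_r r1 r2).
  assert (L3 : 0 < Rmin r1 r2) by now apply Rmin_glb_lt.
  exists (Rmin r1 r2), (fun k => b1 k - b2 k)%C, (M1 + M2). split; [easy|]. split.
  - intros n. specialize (HM1 n). specialize (HM2 n).
    apply Rle_trans with (rsum (fun k => Cmod (b1 k) * r1 ^ k) n + rsum (fun k => Cmod (b2 k) * r2 ^ k) n);
      [|lra].
    clear HM1 HM2. induction n as [|n IH]; [simpl; lra|]. cbn [rsum].
    assert (T := Cmod_triangle (b1 n) (- b2 n)). rewrite Cmod_opp in T.
    assert (P1 : Rmin r1 r2 ^ n <= r1 ^ n) by (apply pow_incr; lra).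
    assert (P2 : Rmin r1 r2 ^ n <= r2 ^ n) by (apply pow_incr; lra).
    assert (P0 : 0 <= Rmin r1 r2 ^ n) by (apply pow_le; lra).
    assert (C1 := Cmod_ge_0 (b1 n)). assert (C2 := Cmod_ge_0 (b2 n)).
    assert (Q1 := Rmult_le_compat_l _ _ _ C1 P1). assert (Q2 := Rmult_le_compat_l _ _ _ C2 P2).
    change (b1 n + - b2 n)%C with (b1 n - b2 n)%C in T.
    apply (Rmult_le_compat_r _ _ _ P0) in T. lra.
  - intros h Hh. eapply has_sum_ext; [|apply has_sum_minus; [apply H1|apply H2]; lra].
    intros k. cbv beta. ring.
Qed.

Lemma real_analytic_scal (c : C) (f : R -> C) (x0 : R) :
  real_analytic_at f x0 -> real_analytic_at (fun x => c * f x)%C x0.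
Proof.
  intros [r [b [M [Hr [HM H]]]]]. exists r, (fun k => c * b k)%C, (Cmod c * M).
  split; [easy|]. split.
  - intros n. apply Rle_trans with (Cmod c * rsum (fun k => Cmod (b k) * r ^ k) n).
    + rewrite <- rsum_scal. apply rsum_le. intros k. rewrite Cmod_mult. lra.
    + apply Rmult_le_compat_l; [apply Cmod_ge_0|easy].
  - intros h Hh. eapply has_sum_ext; [|apply has_sum_scal, H, Hh].
    intros k. cbv beta. ring.
Qed.

Lemma real_analytic_ext (f g : R -> C) (x0 : R) :
  (forall x, f x = g x) -> real_analytic_at f x0 -> real_analytic_at g x0.
Proof.
  intros E [r [b [M [Hr [HM H]]]]]. exists r, b, M. split; [easy|]. split; [easy|].
  intros h Hh. rewrite <- E. now apply H.
Qed.

(** Strong induction: if the earlier coefficients vanish, the tail bound gives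
    [|b_k| h^k <= (h / r)^(k+1) M]. Division by [h^k] and [h -> 0] leave [b_k = 0]; positive [h]
    suffice. *)
Lemma power_series_right_zero (b : nat -> C) (r M : R) : 0 < r ->
  (forall n, rsum (fun k => Cmod (b k) * r ^ k) n <= M) ->
  (forall h, 0 < h < r -> has_sum (fun k => b k * RtoC (h ^ k))%C 0) ->
  forall k, b k = 0.
Proof.
  intros Hr HM H k. induction k as [k IH] using (well_founded_induction Wf_nat.lt_wf).
  assert (HM0 : 0 <= M) by exact (HM O).
  assert (Hrk : 0 < r ^ S k) by now apply pow_lt.
  assert (B : forall h, 0 < h < r -> Cmod (b k) <= h * (M / r ^ S k)).
  { intros h Hh. assert (Hhk : 0 < h ^ k) by (apply pow_lt; lra).
    assert (Hq : 0 < h / r < 1).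
    { split; [apply Rdiv_lt_0_compat; lra|apply Rlt_div_l; lra]. }
    set (a := fun j => (b j * RtoC (h ^ j))%C).
    set (A := fun j => Cmod (b j) * r ^ j).
    assert (HA : forall j, 0 <= A j).
    { intros j. apply Rmult_le_pos; [apply Cmod_ge_0|apply pow_le; lra]. }
    assert (Ek : forall n, (n <= k)%nat -> psum a n = 0).
    { intros n. induction n as [|n IHn]; intros Hn; [easy|].
      simpl. rewrite IHn by lia. unfold a. rewrite (IH n) by lia. ring. }
    assert (D : forall p, (S k <= p)%nat ->
      Cmod (psum a p - psum a (S k)) <= (h / r) ^ S k * (rsum A p - rsum A (S k))).
    { intros p Hp. induction Hp as [|p Hp IHp].
      - replace (psum a (S k) - psum a (S k))%C with (RtoC 0) by ring. rewrite Cmod_0. lra.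
      - cbn [psum rsum].
        replace (psum a p + a p - psum a (S k))%C with ((psum a p - psum a (S k)) + a p)%C by ring.
        change (psum a k + a k)%C with (psum a (S k)). change (rsum A k + A k) with (rsum A (S k)).
        replace (psum a p + a p - psum a (S k))%C with ((psum a p - psum a (S k)) + a p)%C by ring.
        eapply Rle_trans; [apply Cmod_triangle|].
        assert (Ha : Cmod (a p) <= (h / r) ^ S k * A p).
        { unfold a, A. rewrite Cmod_mult, Cmod_pos_RtoC by (apply pow_le; lra).
          rewrite <- Rmult_assoc, (Rmult_comm _ (Cmod (b p))), Rmult_assoc.
          apply Rmult_le_compat_l; [apply Cmod_ge_0|].
          replace (h ^ p) with ((h / r) ^ p * r ^ p)
            by (rewrite <- Rpow_mult_distr; f_equal; field; lra).
          apply Rmult_le_compat_r; [apply pow_le; lra|].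
          replace p with ((S k) + (p - S k))%nat by lia. rewrite pow_add.
          assert (0 <= (h / r) ^ S k) by (apply pow_le; lra).
          assert ((h / r) ^ (p - S k) <= 1); [|nra].
          rewrite <- (pow1 (p - S k)). apply pow_incr. lra. }
        lra. }
    assert (R0 := has_sum_remainder_le a 0 (S k) ((h / r) ^ S k * M) (H h Hh)).
    replace (psum a (S k) - 0)%C with (b k * RtoC (h ^ k))%C in R0
      by (cbn [psum]; rewrite Ek by lia; unfold a; ring).
    rewrite Cmod_mult, Cmod_pos_RtoC in R0 by lra.
    assert (Hqk : 0 <= (h / r) ^ S k) by (apply pow_le; lra).
    assert (R1 : Cmod (b k) * h ^ k <= (h / r) ^ S k * M).
    { apply R0. intros p Hp. eapply Rle_trans; [apply D, Hp|].
      apply Rmult_le_compat_l; [easy|].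
      assert (0 <= rsum A (S k)).
      { apply (rsum_mono A 0 (S k) HA). lia. }
      specialize (HM p). unfold A in *. lra. }
    apply (Rmult_le_reg_r (h ^ k)); [easy|]. eapply Rle_trans; [apply R1|]. right.
    unfold Rdiv. rewrite Rpow_mult_distr, pow_inv. simpl. field. split; [|lra].
    apply pow_nonzero. lra. }
  apply Cmod_eq_0. apply Rle_antisym; [|apply Cmod_ge_0].
  apply le_epsilon. intros e He.
  set (K := M / r ^ S k) in *.
  assert (HK : 0 <= K) by (apply Rdiv_le_0_compat; easy).
  set (h := Rmin (r / 2) (e / (K + 1))).
  assert (Hh1 : h <= r / 2) by apply Rmin_l. assert (Hh2 : h <= e / (K + 1)) by apply Rmin_r.
  assert (Hek : 0 < e / (K + 1)) by (apply Rdiv_lt_0_compat; lra).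
  assert (Hh0 : 0 < h) by (apply Rmin_glb_lt; lra).
  specialize (B h ltac:(lra)).
  assert (h * K <= e); [|lra].
  apply Rle_trans with (e / (K + 1) * (K + 1)); [nra|]. right. field. lra.
Qed.

(** Suppose [f] is nonzero somewhere and let [T] be the supremum of such points. The expansion at
    [T] vanishes to the right, hence identically, so [f] vanishes beyond [T - r], contrary to the
    choice of [T]. *)
Lemma real_analytic_identity (f : R -> C) (A : R) :
  (forall x, real_analytic_at f x) -> (forall x, A < x -> f x = 0) -> forall x, f x = 0.
Proof.
  intros Hf HA x. apply NNPP. intros Hx.
  destruct (completeness (fun y => f y <> 0)) as [T [HT1 HT2]].
  - exists A. intros y Hy. apply Rnot_lt_le. intros Hl. now apply Hy, HA.
  - now exists x.
  - destruct (Hf T) as [r [b [M [Hr [HM H]]]]].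
    assert (Hgt : forall y, T < y -> f y = 0).
    { intros y Hy. apply NNPP. intros Hn. specialize (HT1 y Hn). lra. }
    assert (Hb : forall k, b k = 0).
    { apply (power_series_right_zero b r M Hr HM). intros h Hh.
      rewrite <- (Hgt (T + h)) by lra. apply H. rewrite Rabs_pos_eq; lra. }
    assert (T <= T - r); [|lra]. apply HT2. intros y Hy. apply Rnot_lt_le. intros Hl.
    apply Hy. destruct (Rlt_le_dec T y) as [Hty|Hty]; [now apply Hgt|].
    replace y with (T + (y - T)) by ring.
    apply (has_sum_unique (fun k => b k * RtoC ((y - T) ^ k))%C).
    + apply H. apply Rabs_def1; lra.
    + intros e He. exists O. intros n _.
      assert (E : psum (fun k => b k * RtoC ((y - T) ^ k))%C n = 0).
      { clear -Hb. induction n as [|n IH]; [easy|]. simpl. rewrite IH, Hb. ring. }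
      rewrite E. replace (0 - 0)%C with (RtoC 0) by ring. now rewrite Cmod_0.
Qed.

Lemma real_analytic_taylor (f : nat -> R -> C) (x0 r A q : R) :
  0 < r -> 0 <= A -> 0 <= q ->
  (forall k y, Rabs (y - x0) < r -> Cderiv (f k) y (f (S k) y)) ->
  (forall k y, Rabs (y - x0) < r -> Cmod (f k y) <= A * INR (fact k) * q ^ k) ->
  real_analytic_at (f O) x0.
Proof.
  intros Hr HA Hq H1 H2.
  assert (Hq2 : 0 < / (2 * (q + 1))) by (apply Rinv_0_lt_compat; lra).
  (* This radius makes [p * q <= 1 / 2], so the absolute series is dominated by a geometric one of
     ratio 1/2. *)
  set (p := Rmin r (/ (2 * (q + 1)))).
  assert (Hp0 : 0 < p) by now apply Rmin_glb_lt.
  assert (Hp1 : p <= r) by apply Rmin_l.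
  assert (Hp2 : p * q <= / 2).
  { apply Rle_trans with (/ (2 * (q + 1)) * (q + 1)); [|right; field; lra].
    assert (p <= / (2 * (q + 1))) by apply Rmin_r. nra. }
  destruct (bsummable_scal A _ HA (bsummable_geom (/ 2) ltac:(lra))) as [_ [M HM]].
  exists p, (fun k => f k x0 * RtoC (/ INR (fact k)))%C, M. split; [easy|]. split.
  - intros n. eapply Rle_trans; [|apply (HM n)]. apply rsum_le. intros k.
    assert (Hf : 0 < INR (fact k)) by apply INR_fact_lt_0.
    assert (Hfi : 0 < / INR (fact k)) by now apply Rinv_0_lt_compat.
    rewrite Cmod_mult, Cmod_pos_RtoC by lra.
    assert (B := H2 k x0 ltac:(replace (x0 - x0) with 0 by ring; now rewrite Rabs_R0)).
    assert (Pk : 0 <= p ^ k) by (apply pow_le; lra).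
    apply Rle_trans with (A * INR (fact k) * q ^ k * / INR (fact k) * p ^ k).
    + apply Rmult_le_compat_r; [easy|]. apply Rmult_le_compat_r; [lra|easy].
    + replace (A * INR (fact k) * q ^ k * / INR (fact k) * p ^ k) with (A * (p * q) ^ k)
        by (rewrite Rpow_mult_distr; field; lra).
      apply Rmult_le_compat_l; [easy|]. apply pow_incr. split; [nra|easy].
  - intros h Hh.
    assert (T := taylor_has_sum f x0 r A q h H1 H2 HA Hq ltac:(lra)).
    eapply has_sum_ext; [|apply T].
    + intros k. cbv beta. unfold Rdiv. rewrite RtoC_mult. ring.
    + assert (0 <= Rabs h) by apply Rabs_pos. nra.
Qed.

(** * Restriction of a triple power series to a real line in one variable *)

Lemma sum_n_only_0 {G : AbelianMonoid} (f : nat -> G) (n : nat) :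
  (forall k, f (S k) = zero) -> sum_n f n = f O.
Proof.
  intros H. induction n as [|n IH]; [apply sum_O|]. rewrite sum_Sn, IH, H. apply plus_zero_r.
Qed.

Lemma sum_n_zero {G : AbelianMonoid} (f : nat -> G) (n : nat) :
  (forall k, f k = zero) -> sum_n f n = zero.
Proof. intros H. rewrite sum_n_only_0; [apply H|]. intros k. apply H. Qed.

Lemma triple_sum_third {G : AbelianMonoid} (T : nat -> nat -> nat -> G) (n : nat) :
  (forall i j k, T (S i) j k = zero) -> (forall j k, T O (S j) k = zero) ->
  sum_n (fun i => sum_n (fun j => sum_n (fun k => T i j k) n) n) n = sum_n (T O O) n.
Proof.
  intros H1 H2. rewrite sum_n_only_0.
  - rewrite sum_n_only_0; [easy|]. intros j. apply sum_n_zero. intros k. apply H2.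
  - intros i. apply sum_n_zero. intros j. apply sum_n_zero. intros k. apply H1.
Qed.

Lemma triple_sum_second {G : AbelianMonoid} (T : nat -> nat -> nat -> G) (n : nat) :
  (forall i j k, T (S i) j k = zero) -> (forall j k, T O j (S k) = zero) ->
  sum_n (fun i => sum_n (fun j => sum_n (fun k => T i j k) n) n) n = sum_n (fun j => T O j O) n.
Proof.
  intros H1 H2. rewrite sum_n_only_0.
  - apply sum_n_ext. intros j. rewrite sum_n_only_0; [easy|]. apply H2.
  - intros i. apply sum_n_zero. intros j. apply sum_n_zero. intros k. apply H1.
Qed.

(** The bounds for different [h] are unrelated, so the one at [h = r / 2] is kept and the radius is
    halved. *)
Lemma real_analytic_of_series (f : R -> C) (x0 r : R) (b : nat -> C) : 0 < r ->
  (forall h, Rabs h < r ->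
    (exists M, forall n, rsum (fun k => Cmod (b k * RtoC (h ^ k))) (S n) <= M) /\
    has_sum (fun k => b k * RtoC (h ^ k))%C (f (x0 + h))) ->
  real_analytic_at f x0.
Proof.
  intros Hr H. destruct (H (r / 2)) as [[M HM] _]; [rewrite Rabs_pos_eq; lra|].
  exists (r / 2), b, M. split; [lra|]. split.
  - intros n. apply Rle_trans with (rsum (fun k => Cmod (b k) * (r / 2) ^ k) (S n)).
    + apply rsum_mono; [|lia]. intros k. apply Rmult_le_pos; [apply Cmod_ge_0|apply pow_le; lra].
    + eapply Rle_trans; [|apply (HM n)]. apply rsum_le. intros k.
      rewrite Cmod_mult, (Cmod_pos_RtoC ((r / 2) ^ k)) by (apply pow_le; lra). lra.
  - intros h Hh. apply H. lra.
Qed.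

Lemma analytic3_real_s (F : C -> C -> C -> C) (t x s : C) :
  analytic3_at F t x s -> real_analytic_at (fun th => F t x (s + RtoC th)%C) 0.
Proof.
  intros [r [a [Hr H]]]. apply (real_analytic_of_series _ 0 r (fun k => a O O k) Hr).
  intros h Hh.
  assert (H0 : forall z : C, Cmod (z - z) < r).
  { intros z. replace (z - z)%C with (RtoC 0) by ring. now rewrite Cmod_0. }
  assert (Es : (s + RtoC h - s)%C = RtoC h) by ring.
  destruct (H t x (s + RtoC h)%C (H0 t) (H0 x)) as [[M HM] HL]; [rewrite Es, Cmod_R; easy|].
  cbv zeta in HM, HL. rewrite Es in HM, HL.
  replace (t - t)%C with (RtoC 0) in HM, HL by ring.
  replace (x - x)%C with (RtoC 0) in HM, HL by ring.
  (* With [t] and [x] at the centre, the powers of 0 kill every term except those with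
     [i = j = 0]. *)
  set (T := fun i j k => (a i j k * Cpow 0 i * Cpow 0 j * Cpow (RtoC h) k)%C) in *.
  assert (T1 : forall i j k, T (S i) j k = 0) by (intros i j k; unfold T; simpl; ring).
  assert (T2 : forall j k, T O (S j) k = 0) by (intros j k; unfold T; simpl; ring).
  assert (T3 : forall k, T O O k = (a O O k * RtoC (h ^ k))%C).
  { intros k. unfold T. rewrite RtoC_pow. simpl Cpow at 1 2. ring. }
  split.
  - exists M. intros n. eapply Rle_trans; [|apply (HM n)]. right.
    rewrite (triple_sum_third (fun i j k => Cmod (T i j k))).
    + rewrite rsum_sum_n. apply Rle_antisym; apply rsum_le; intros k; rewrite T3; lra.
    + intros i j k. rewrite T1. apply Cmod_0.
    + intros j k. rewrite T2. apply Cmod_0.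
  - rewrite Rplus_0_l. apply (has_sum_ext (T O O)); [easy|]. apply has_sum_filterlim.
    eapply filterlim_ext; [|exact HL]. intros n. exact (triple_sum_third T n T1 T2).
Qed.

Lemma analytic3_real_x (F : C -> C -> C -> C) (t x s : C) :
  analytic3_at F t x s -> real_analytic_at (fun th => F t (x + RtoC th)%C s) 0.
Proof.
  intros [r [a [Hr H]]]. apply (real_analytic_of_series _ 0 r (fun k => a O k O) Hr).
  intros h Hh.
  assert (H0 : forall z : C, Cmod (z - z) < r).
  { intros z. replace (z - z)%C with (RtoC 0) by ring. now rewrite Cmod_0. }
  assert (Es : (x + RtoC h - x)%C = RtoC h) by ring.
  destruct (H t (x + RtoC h)%C s (H0 t)) as [[M HM] HL]; [rewrite Es, Cmod_R; easy|apply H0|].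
  cbv zeta in HM, HL. rewrite Es in HM, HL.
  replace (t - t)%C with (RtoC 0) in HM, HL by ring.
  replace (s - s)%C with (RtoC 0) in HM, HL by ring.
  set (T := fun i j k => (a i j k * Cpow 0 i * Cpow (RtoC h) j * Cpow 0 k)%C) in *.
  assert (T1 : forall i j k, T (S i) j k = 0) by (intros i j k; unfold T; simpl; ring).
  assert (T2 : forall j k, T O j (S k) = 0) by (intros j k; unfold T; simpl; ring).
  assert (T3 : forall j, T O j O = (a O j O * RtoC (h ^ j))%C).
  { intros j. unfold T. rewrite RtoC_pow. simpl. ring. }
  split.
  - exists M. intros n. eapply Rle_trans; [|apply (HM n)]. right.
    rewrite (triple_sum_second (fun i j k => Cmod (T i j k))).
    + rewrite rsum_sum_n. apply Rle_antisym; apply rsum_le; intros k; rewrite T3; lra.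
    + intros i j k. rewrite T1. apply Cmod_0.
    + intros j k. rewrite T2. apply Cmod_0.
  - rewrite Rplus_0_l. apply (has_sum_ext (fun j => T O j O)); [easy|]. apply has_sum_filterlim.
    eapply filterlim_ext; [|exact HL]. intros n. exact (triple_sum_second T n T1 T2).
Qed.

Lemma real_analytic_shift (f : R -> C) (x0 : R) :
  real_analytic_at (fun h => f (x0 + h)) 0 -> real_analytic_at f x0.
Proof.
  intros [r [b [M [Hr [HM H]]]]]. exists r, b, M. split; [easy|]. split; [easy|].
  intros h Hh. specialize (H h Hh). now rewrite Rplus_0_l in H.
Qed.

(** A single term of the exponential series. It converts the [k]-th power of a logarithm into the
    factorial growth required by [real_analytic_taylor], at the price of one factor [e^L]. *)
Lemma pow_le_fact_exp (k : nat) (x : R) : 0 <= x -> x ^ k <= INR (fact k) * exp x.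
Proof.
  revert x. induction k as [|k IH]; intros x Hx.
  - simpl. rewrite Rmult_1_l. rewrite <- exp_0. now apply exp_le.
  - assert (D : forall y, is_derive (fun y => INR (fact (S k)) * exp y - y ^ S k) y
      (INR (fact (S k)) * exp y - INR (S k) * y ^ k)).
    { intros y.
      assert (D1 := is_derive_scal exp y (INR (fact (S k))) _ (is_derive_exp y)).
      assert (D2 := is_derive_pow (fun y => y) (S k) y 1 (is_derive_id y)).
      replace (INR (S k) * y ^ k) with (INR (S k) * 1 * y ^ Nat.pred (S k)) by (rewrite Rmult_1_r; easy).
      exact (is_derive_minus _ _ _ _ _ D1 D2). }
    destruct (MVT_gen (fun y => INR (fact (S k)) * exp y - y ^ S k) 0 x
      (fun y => INR (fact (S k)) * exp y - INR (S k) * y ^ k)) as [c [Hc Ec]].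
    + intros y _. apply D.
    + intros y _. apply continuity_pt_filterlim.
      apply (ex_derive_continuous (fun y => INR (fact (S k)) * exp y - y ^ S k)).
      eexists. apply D.
    + rewrite Rmin_left, Rmax_right in Hc by easy. specialize (IH c (proj1 Hc)).
      rewrite exp_0, pow_i in Ec by lia.
      assert (Hf := INR_fact_lt_0 (S k)).
      assert (HS : 0 <= INR (S k)) by apply pos_INR.
      assert (E : INR (fact (S k)) = INR (S k) * INR (fact k)) by (rewrite fact_simpl; apply mult_INR).
      assert (0 <= INR (fact (S k)) * exp c - INR (S k) * c ^ k).
      { rewrite E. apply (Rmult_le_compat_l _ _ _ HS) in IH. lra. }
      nra.
Qed.

Lemma Cderiv_of_quadratic (f : R -> C) (x r K : R) (l : C) : 0 < r -> 0 <= K ->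
  (forall h, Rabs h < r -> Cmod (f (x + h) - f x - RtoC h * l) <= K * h ^ 2) ->
  Cderiv f x l.
Proof.
  intros Hr HK H.
  assert (D : forall (g : R -> R) (d : R),
    (forall h, Rabs h < r -> Rabs (g (x + h) - g x - h * d) <= K * h ^ 2) -> is_derive g x d).
  { intros g d Hg. apply is_derive_Reals. intros e He.
    assert (Hd : 0 < Rmin r (e / (K + 1))).
    { apply Rmin_glb_lt; [easy|]. apply Rdiv_lt_0_compat; lra. }
    exists (mkposreal _ Hd). intros h Hh0 Hh. simpl in Hh.
    assert (H1 := Rlt_le_trans _ _ _ Hh (Rmin_l _ _)).
    assert (H2 := Rlt_le_trans _ _ _ Hh (Rmin_r _ _)).
    specialize (Hg h H1). assert (Ha : 0 < Rabs h) by now apply Rabs_pos_lt.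
    replace ((g (x + h) - g x) / h - d) with ((g (x + h) - g x - h * d) / h) by (field; easy).
    unfold Rdiv. rewrite Rabs_mult, Rabs_inv.
    apply (Rmult_lt_reg_r (Rabs h)); [easy|].
    rewrite Rmult_assoc, Rinv_l, Rmult_1_r by lra.
    eapply Rle_lt_trans; [apply Hg|]. rewrite <- pow2_abs.
    apply (Rmult_lt_compat_l (K + 1)) in H2; [|lra].
    replace ((K + 1) * (e / (K + 1))) with e in H2 by (field; lra). nra. }
  split; apply D; intros h Hh; (eapply Rle_trans; [|apply (H h Hh)]).
  - assert (E : Re (f (x + h)) - Re (f x) - h * Re l = Re (f (x + h)%R - f x - RtoC h * l)).
    { unfold Cminus. rewrite !Re_plus, !Re_opp, Re_mult, Re_RtoC, Im_RtoC. ring. }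
    rewrite E. apply re_le_Cmod.
  - assert (E : Im (f (x + h)) - Im (f x) - h * Im l = Im (f (x + h)%R - f x - RtoC h * l)).
    { unfold Cminus. rewrite !Im_plus, !Im_opp, Im_mult, Re_RtoC, Im_RtoC. ring. }
    rewrite E. apply im_le_Cmod.
Qed.

(** * Continuation of the Lerch series *)

Lemma lerch_series_analytic_s (t x s : C) (th0 : R) :
  0 < Im t -> 0 <= Im x -> ~ on_cut x ->
  real_analytic_at (fun th => Csum (lerch_term t x (s + RtoC th))) th0.
Proof.
  intros Ht Hx Hc. assert (Hpi := PI_RGT_0).
  destruct (shift_Cmod_ge x Hx Hc) as [d [Hd0 Hd]]. assert (Hxm := Cmod_ge_0 x).
  set (L := log_bound d (Cmod x + 1) 1).
  assert (HL : sublinear L) by (apply log_bound_sublinear; lra).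
  set (l := fun m => Clog (RtoC (INR m) + x)).
  assert (Hl : forall m, Cmod (l m) <= L m).
  { intros m. apply log_bound_correct; [easy|]. split; [apply Hd|].
    eapply Rle_trans; [apply Cmod_triangle|]. rewrite Cmod_pos_RtoC by apply pos_INR. lra. }
  assert (HL0 : forall m, 0 <= L m).
  { intros m. eapply Rle_trans; [apply Cmod_ge_0|apply Hl]. }
  set (T := fun th m => lerch_term t x (s + RtoC th) m).
  (* The candidate derivatives: each differentiation in the exponent brings down [- l m]. *)
  set (f := fun k th => Csum (fun m => Cpow (- l m) k * T th m)%C).
  (* The radius 2 leaves room for a point within 1 of [th0] and a further increment smaller than
     1. *)
  set (S0 := Cmod s + Rabs th0 + 2).
  assert (Hsm := Cmod_ge_0 s). assert (Hth0 := Rabs_pos th0).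
  assert (HT : forall th m, Rabs (th - th0) < 2 ->
    Cmod (T th m) <= exp (S0 * L m + 0 - 2 * PI * Im t * INR m)).
  { intros th m Hth. unfold T, lerch_term. rewrite Cmod_mult, Cmod_Cexp.
    replace (Re (2 * RtoC PI * Ci * t * RtoC (INR m))) with (- (2 * PI * Im t * INR m))
      by (unfold Re, Im; simpl; ring).
    replace (S0 * L m + 0 - 2 * PI * Im t * INR m) with
      (S0 * L m + - (2 * PI * Im t * INR m)) by ring.
    rewrite exp_plus. apply Rmult_le_compat_r; [left; apply exp_pos|].
    eapply Rle_trans; [apply Cpower_le, Hl|]. apply exp_le.
    apply Rmult_le_compat_r; [apply HL0|]. rewrite Cmod_opp.
    eapply Rle_trans; [apply Cmod_triangle|]. rewrite Cmod_R.
    assert (Ht2 := Rabs_triang (th - th0) th0). replace (th - th0 + th0) with th in Ht2 by ring.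
    unfold S0. lra. }
  assert (HLk : forall k m, Cmod (Cpow (- l m) k) <= INR (fact k) * exp (L m)).
  { intros k m. rewrite Cmod_pow, Cmod_opp.
    apply Rle_trans with (L m ^ k); [|now apply pow_le_fact_exp].
    apply pow_incr. split; [apply Cmod_ge_0|apply Hl]. }
  (* One extra [L m] pays for the power of the logarithm. The second one in [M2] pays for the
     exponential factor in the Taylor remainder of [e^(- h l)]. *)
  set (M1 := fun m => exp ((S0 + 1) * L m + 0 - 2 * PI * Im t * INR m)).
  set (M2 := fun m => exp ((S0 + 2) * L m + 0 - 2 * PI * Im t * INR m)).
  assert (HM1 : bsummable M1) by (apply sublinear_exp_bsummable; [easy|unfold S0; lra|nra]).
  assert (HM2 : bsummable M2) by (apply sublinear_exp_bsummable; [easy|unfold S0; lra|nra]).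
  assert (HfT : forall k th m, Rabs (th - th0) < 2 ->
    Cmod (Cpow (- l m) k * T th m) <= INR (fact k) * M1 m).
  { intros k th m Hth. rewrite Cmod_mult.
    replace (INR (fact k) * M1 m) with
      (INR (fact k) * exp (L m) * exp (S0 * L m + 0 - 2 * PI * Im t * INR m)).
    - apply Rmult_le_compat; [apply Cmod_ge_0|apply Cmod_ge_0|apply HLk|now apply HT].
    - unfold M1. rewrite Rmult_assoc, <- exp_plus. f_equal. f_equal. ring. }
  assert (Hsum : forall k th, Rabs (th - th0) < 2 ->
    has_sum (fun m => Cpow (- l m) k * T th m)%C (f k th)).
  { intros k th Hth. apply (Csum_correct _ (fun m => INR (fact k) * M1 m)).
    - intros m. now apply HfT.
    - apply bsummable_scal; [apply pos_INR|easy]. }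
  destruct HM1 as [HM10 [B1 HB1]]. destruct HM2 as [HM20 [B2 HB2]].
  assert (HB20 : 0 <= B2) by exact (HB2 O).
  assert (HA : real_analytic_at (f O) th0).
  { apply (real_analytic_taylor f th0 1 B1 1); [lra|exact (HB1 O)|lra| |].
    - intros k y Hy.
      (* The quadratic remainder adds two powers of the logarithm to the [k] already present, hence
         [(k + 2)!]. *)
      apply (Cderiv_of_quadratic _ _ 1 (2 * INR (fact (k + 2)) * B2)); [lra| |].
      { apply Rmult_le_pos; [|easy]. assert (H := pos_INR (fact (k + 2))). lra. }
      intros h Hh.
      assert (Hyh : Rabs (y + h - th0) < 2).
      { replace (y + h - th0) with ((y - th0) + h) by ring.
        eapply Rle_lt_trans; [apply Rabs_triang|]. lra. }
      assert (SS := has_sum_minus _ _ _ _ (has_sum_minus _ _ _ _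
        (Hsum k (y + h) Hyh) (Hsum k y ltac:(lra)))
        (has_sum_scal (RtoC h) _ _ (Hsum (S k) y ltac:(lra)))).
      refine (has_sum_norm_le _ _ (fun m => (2 * INR (fact (k + 2)) * h ^ 2) * M2 m) _ _ _ SS).
      + intros m. cbv beta.
        assert (ET : T (y + h) m = (T y m * Cexp (- (RtoC h * l m)))%C).
        { unfold T, lerch_term, Cpower. fold (l m).
          replace (- (s + RtoC (y + h)) * l m)%C with
            (- (s + RtoC y) * l m + - (RtoC h * l m))%C by (rewrite RtoC_plus; ring).
          rewrite Cexp_plus. ring. }
        rewrite ET.
        replace (Cpow (- l m) k * (T y m * Cexp (- (RtoC h * l m))) - Cpow (- l m) k * T y m -
          RtoC h * (Cpow (- l m) (S k) * T y m))%C with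
          (Cpow (- l m) k * T y m * (Cexp (- (RtoC h * l m)) - 1 - - (RtoC h * l m)))%C
          by (simpl; ring).
        rewrite Cmod_mult.
        assert (X := Cexp_taylor2 (- (RtoC h * l m))).
        rewrite Cmod_opp, Cmod_mult, Cmod_R in X.
        assert (Hlm := Hl m). assert (Hl0 := Cmod_ge_0 (l m)). assert (Hh0 := Rabs_pos h).
        assert (X2 : Cmod (Cexp (- (RtoC h * l m)) - 1 - - (RtoC h * l m)) <=
          2 * h ^ 2 * (Cmod (l m) ^ 2 * exp (L m))).
        { eapply Rle_trans; [apply X|]. rewrite Rpow_mult_distr, pow2_abs.
          replace (2 * (h ^ 2 * Cmod (l m) ^ 2 * exp (Rabs h * Cmod (l m)))) with
            (2 * h ^ 2 * (Cmod (l m) ^ 2 * exp (Rabs h * Cmod (l m)))) by ring.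
          apply Rmult_le_compat_l; [nra|]. apply Rmult_le_compat_l; [nra|].
          apply exp_le. nra. }
        assert (Y := HLk (k + 2)%nat m).
        rewrite Cmod_pow, Cmod_opp, pow_add in Y.
        rewrite Cmod_mult, Cmod_pow, Cmod_opp.
        assert (Z := HT y m ltac:(lra)).
        set (E0 := exp (S0 * L m + 0 - 2 * PI * Im t * INR m)) in *.
        assert (HE0 : 0 < E0) by apply exp_pos.
        assert (HlK : 0 <= Cmod (l m) ^ k) by now apply pow_le.
        assert (HeL : 0 < exp (L m)) by apply exp_pos.
        apply Rle_trans with (Cmod (l m) ^ k * E0 * (2 * h ^ 2 * (Cmod (l m) ^ 2 * exp (L m)))).
        * apply Rmult_le_compat; [|apply Cmod_ge_0| |easy].
          -- apply Rmult_le_pos; [easy|apply Cmod_ge_0].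
          -- apply Rmult_le_compat_l; easy.
        * replace (Cmod (l m) ^ k * E0 * (2 * h ^ 2 * (Cmod (l m) ^ 2 * exp (L m)))) with
            (2 * h ^ 2 * (Cmod (l m) ^ k * Cmod (l m) ^ 2) * (E0 * exp (L m))) by ring.
          replace (2 * INR (fact (k + 2)) * h ^ 2 * M2 m) with
            (2 * h ^ 2 * (INR (fact (k + 2)) * exp (L m)) * (E0 * exp (L m))).
          -- apply Rmult_le_compat_r; [nra|]. apply Rmult_le_compat_l; [nra|easy].
          -- replace (M2 m) with (E0 * exp (L m) * exp (L m)); [ring|].
             unfold M2, E0. rewrite <- !exp_plus. f_equal. ring.
      + intros n. rewrite rsum_scal. specialize (HB2 n).
        assert (0 <= 2 * INR (fact (k + 2)) * h ^ 2).
        { assert (H := pos_INR (fact (k + 2))). assert (H2 := pow2_ge_0 h). nra. }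
        replace (2 * INR (fact (k + 2)) * B2 * h ^ 2) with (2 * INR (fact (k + 2)) * h ^ 2 * B2) by ring.
        now apply Rmult_le_compat_l.
    - intros k y Hy. rewrite pow1, Rmult_1_r.
      apply (has_sum_norm_le _ _ (fun m => INR (fact k) * M1 m) _
        (fun m => HfT k y m ltac:(lra))); [|apply Hsum; lra].
      intros n. rewrite rsum_scal. rewrite Rmult_comm.
      apply Rmult_le_compat_r; [apply pos_INR|apply HB1]. }
  eapply real_analytic_ext; [|exact HA]. intros th. unfold f, Csum, T.
  f_equal; f_equal; apply Lim_seq_ext; intros n; f_equal; apply psum_ext; intros m; simpl; ring.
Qed.

(** * Complex powers along horizontal lines above the real axis *)

Lemma Carg_upper_atan (z : C) : 0 < Im z -> Carg z = PI / 2 - atan (Re z / Im z).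
Proof.
  intros Hi. set (b := atan (Re z / Im z)).
  assert (Hb : - PI / 2 < b < PI / 2) by apply atan_bound.
  assert (Hc : 0 < cos b) by (apply cos_gt_0; lra).
  assert (Ht : sin b * Im z = cos b * Re z).
  { assert (E : tan b = Re z / Im z) by apply tan_atan. unfold tan in E.
    replace (sin b) with (sin b / cos b * cos b) by (field; lra). rewrite E. field. lra. }
  assert (Hm := Cmod2_alt z). assert (H0 := Cmod_ge_0 z).
  assert (Hs := sin2_cos2 b). unfold Rsqr in Hs.
  assert (E1 : Cmod z * cos b = Im z).
  { apply Rsqr_inj; [nra|lra|]. unfold Rsqr.
    transitivity (Cmod z ^ 2 * (cos b * cos b)); [ring|]. rewrite Hm.
    transitivity ((cos b * Re z) * (cos b * Re z) + Im z * Im z * (cos b * cos b)); [ring|].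
    rewrite <- Ht.
    transitivity (Im z * Im z * (sin b * sin b + cos b * cos b)); [ring|]. rewrite Hs. ring. }
  assert (E2 : Cmod z * sin b = Re z).
  { apply (Rmult_eq_reg_r (cos b)); [|lra].
    transitivity (sin b * (Cmod z * cos b)); [ring|]. rewrite E1. lra. }
  assert (Hp : 0 < Cmod z) by nra.
  assert (E : z = Cexp (ln (Cmod z), PI / 2 - b)).
  { unfold Cexp; simpl. rewrite exp_ln, cos_shift, sin_shift by easy.
    apply C_ext; simpl; lra. }
  rewrite E at 1. apply Carg_Cexp. simpl. generalize PI_RGT_0. lra.
Qed.

(** On a horizontal line [Im] is constant, so both parts of the logarithm are explicit elementary
    functions of [th]; the arctangent of [Re / Im] is easier to differentiate there than the
    half-angle form. *)
Lemma Cderiv_Clog (x : C) (th : R) : 0 < Im x ->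
  Cderiv (fun th => Clog (x + RtoC th)) th (/ (x + RtoC th))%C.
Proof.
  intros Hx.
  apply (Cderiv_ext (fun th => ((/ 2 * ln ((Re x + th) ^ 2 + Im x ^ 2),
    PI / 2 - atan ((Re x + th) / Im x)) : C))).
  - apply filter_forall. intros u.
    assert (Hi : Im (x + RtoC u) = Im x) by (rewrite Im_plus, Im_RtoC; ring).
    assert (Hr : Re (x + RtoC u) = Re x + u) by (now rewrite Re_plus, Re_RtoC).
    unfold Clog. rewrite Carg_upper_atan by lra. rewrite Hi, Hr. f_equal.
    assert (Hm := Cmod2_alt (x + RtoC u)). rewrite Hi, Hr in Hm. rewrite <- Hm.
    assert (0 < Cmod (x + RtoC u)).
    { eapply Rlt_le_trans; [|apply Im_le_Cmod]. lra. }
    replace (Cmod (x + RtoC u) ^ 2) with (Cmod (x + RtoC u) * Cmod (x + RtoC u)) by ring.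
    rewrite ln_mult by easy. field.
  - assert (Hp : 0 < (Re x + th) ^ 2 + Im x ^ 2).
    { apply Rplus_le_lt_0_compat; [apply pow2_ge_0|now apply pow_lt]. }
    split; simpl.
    + auto_derive; [simpl in Hp; lra|]. unfold Re, Im in *. simpl in *. field. nra.
    + auto_derive; [lra|]. unfold Re, Im in *. simpl in *. field. split; nra.
Qed.

(** The falling factorial, the coefficient of [z^(a - k)] in the [k]-th derivative of [z^a]. *)
Fixpoint falling (a : C) (k : nat) : C :=
  match k with O => RtoC 1 | S j => (falling a j * (a - RtoC (INR j)))%C end.

Lemma Cmod_falling_le (a : C) (k : nat) :
  Cmod (falling a k) <= INR (fact k) * (Cmod a + 1) ^ k.
Proof.
  assert (Ha := Cmod_ge_0 a). induction k as [|k IH].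
  - simpl. rewrite Cmod_1. lra.
  - cbn [falling]. rewrite Cmod_mult, fact_simpl, mult_INR.
    assert (H : Cmod (a - RtoC (INR k)) <= INR (S k) * (Cmod a + 1)).
    { unfold Cminus. eapply Rle_trans; [apply Cmod_triangle|].
      rewrite Cmod_opp, Cmod_pos_RtoC by apply pos_INR. rewrite S_INR.
      assert (Hk := pos_INR k). nra. }
    replace (INR (S k) * INR (fact k) * (Cmod a + 1) ^ S k) with
      ((INR (fact k) * (Cmod a + 1) ^ k) * (INR (S k) * (Cmod a + 1))) by (simpl pow; ring).
    apply Rmult_le_compat; try apply Cmod_ge_0; easy.
Qed.

(** The falling factorial is at most [k! (|a| + 1)^k], and [|x + th| >= Im x] on the whole line;
    together they give factorial bounds with ratio [(|a| + 1) / Im x]. *)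
Lemma Cpower_analytic (x a : C) (th0 : R) : 0 < Im x ->
  real_analytic_at (fun th => Cpower (x + RtoC th) a) th0.
Proof.
  intros Hx. assert (Hxm := Cmod_ge_0 x). assert (Hth0 := Rabs_pos th0).
  assert (Ham := Cmod_ge_0 a).
  set (l := fun th => Clog (x + RtoC th)).
  set (M := Cmod x + Rabs th0 + 1).
  set (La := Rabs (ln (Im x)) + Rabs (ln M) + PI).
  assert (Hlow : forall th, Im x <= Cmod (x + RtoC th)).
  { intros th. eapply Rle_trans; [|apply Im_le_Cmod]. rewrite Im_plus, Im_RtoC. lra. }
  assert (Hl : forall th, Rabs (th - th0) < 1 -> Cmod (l th) <= La).
  { intros th Hth. apply Cmod_Clog_le; [easy|]. split; [apply Hlow|].
    eapply Rle_trans; [apply Cmod_triangle|]. rewrite Cmod_R. unfold M.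
    assert (T := Rabs_triang (th - th0) th0). replace (th - th0 + th0) with th in T by ring. lra. }
  assert (Hnz : forall th, (x + RtoC th)%C <> 0).
  { intros th. apply Cmod_gt_0. eapply Rlt_le_trans; [apply Hx|apply Hlow]. }
  set (f := fun k th => (falling a k * Cexp ((a - RtoC (INR k)) * l th))%C).
  assert (HA : real_analytic_at (f O) th0).
  { apply (real_analytic_taylor f th0 1 (exp (Cmod a * La)) ((Cmod a + 1) / Im x)).
    - lra.
    - left. apply exp_pos.
    - apply Rdiv_le_0_compat; lra.
    - intros k y _. unfold f. eapply Cderiv_eq.
      + apply Cderiv_scal, Cderiv_exp, Cderiv_scal, Cderiv_Clog, Hx.
      + cbn [falling]. fold (l y). rewrite S_INR, RtoC_plus.
        replace ((a - (RtoC (INR k) + 1)) * l y)%C with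
          ((a - RtoC (INR k)) * l y + - l y)%C by ring.
        rewrite Cexp_plus, Cexp_opp. unfold l at 3. rewrite Cexp_Clog by apply Hnz. ring.
    - intros k y Hy. unfold f. rewrite Cmod_mult.
      replace ((a - RtoC (INR k)) * l y)%C with (a * l y + - (RtoC (INR k) * l y))%C by ring.
      rewrite Cexp_plus, Cexp_opp, Cexp_nat. unfold l at 2. rewrite Cexp_Clog by apply Hnz.
      rewrite Cmod_mult, Cmod_inv, Cmod_pow by (apply Cpow_nz, Hnz).
      assert (E : Cmod (Cexp (a * l y)) <= exp (Cmod a * La)).
      { eapply Rle_trans; [apply Cexp_le|]. apply exp_le. rewrite Cmod_mult.
        apply Rmult_le_compat_l; [easy|now apply Hl]. }
      assert (P : / Cmod (x + RtoC y) ^ k <= / Im x ^ k).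
      { apply Rinv_le_contravar; [now apply pow_lt|]. apply pow_incr. split; [lra|apply Hlow]. }
      assert (P0 : 0 <= / Cmod (x + RtoC y) ^ k).
      { left. apply Rinv_0_lt_compat, pow_lt, Cmod_gt_0, Hnz. }
      replace (exp (Cmod a * La) * INR (fact k) * ((Cmod a + 1) / Im x) ^ k) with
        ((INR (fact k) * (Cmod a + 1) ^ k) * (exp (Cmod a * La) * / Im x ^ k)).
      + apply Rmult_le_compat; [apply Cmod_ge_0| |apply Cmod_falling_le|].
        * apply Rmult_le_pos; [apply Cmod_ge_0|easy].
        * apply Rmult_le_compat; [apply Cmod_ge_0|easy|easy|easy].
      + unfold Rdiv. rewrite Rpow_mult_distr, pow_inv. ring. }
  eapply real_analytic_ext; [|exact HA]. intros th. unfold f, Cpower. simpl. fold (l th).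
  replace (a - RtoC 0)%C with a by ring. ring.
Qed.

Lemma lerch_term_sum (t x s : C) : 0 < Im t -> 0 <= Im x -> ~ on_cut x ->
  has_sum (lerch_term t x s) (Csum (lerch_term t x s)).
Proof.
  intros Ht Hx Hc. assert (W := has_sum_scal
    (Cpower (2 * RtoC PI) s * Cexp (- (Ci * RtoC PI) * (s / 2 + 2 * t * x)))%C _ _
    (weyl_term_sum s x t Hx Hc Ht)).
  assert (W2 : has_sum (lerch_term t x s)
    (Cpower (2 * RtoC PI) s * Cexp (- (Ci * RtoC PI) * (s / 2 + 2 * t * x))
     * Csum (weyl_term 0 s x t))%C).
  { eapply has_sum_ext; [|exact W]. intros m. symmetry. now apply lerch_term_weyl. }
  now rewrite (Csum_eq _ _ W2).
Qed.

(** The real translates [s + th] with [th > 1 - Re s] lie where the defining series is available,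
    and this half-line is all that the identity theorem asks for. *)
Lemma lerch_zeta_series_right (L : C -> C -> C -> C) (t x s : C) :
  is_lerch_zeta L -> 0 < Im t -> 0 <= Im x -> 0 < Re x ->
  has_sum (lerch_term t x s) (L t x s).
Proof.
  intros [HL1 HL2] Ht Hx Hr.
  assert (Hc : ~ on_cut x) by (intros [_ H]; lra).
  assert (Z := real_analytic_identity
    (fun th => L t x (s + RtoC th) - Csum (lerch_term t x (s + RtoC th)))%C (1 - Re s)).
  assert (Z0 : (L t x (s + RtoC 0) - Csum (lerch_term t x (s + RtoC 0)) = 0)%C).
  { apply (Z) with (x := 0).
    - intros th. apply real_analytic_minus; [|now apply lerch_series_analytic_s].
      apply real_analytic_shift.
      eapply real_analytic_ext; [|apply (analytic3_real_s L t x (s + RtoC th)), HL2; easy].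
      intros h. cbv beta. f_equal. rewrite RtoC_plus. ring.
    - intros th Hth.
      assert (Hs : 1 < Re (s + RtoC th)) by (rewrite Re_plus, Re_RtoC; lra).
      assert (H := has_sum_is_series _ _ (HL1 t x (s + RtoC th)%C Hs Hr (Rlt_le _ _ Ht))).
      assert (E := Csum_eq (lerch_term t x (s + RtoC th)) _ H).
      rewrite E. ring. }
  replace (s + RtoC 0)%C with s in Z0 by ring.
  replace (L t x s) with (L t x s - Csum (lerch_term t x s) + Csum (lerch_term t x s))%C by ring.
  rewrite Z0. replace (0 + Csum (lerch_term t x s))%C with (Csum (lerch_term t x s)) by ring.
  now apply lerch_term_sum.
Qed.

Lemma lerch_term_shift (t x s : C) (m : nat) :
  lerch_term t x s (S m) = (Cexp (2 * RtoC PI * Ci * t) * lerch_term t (x + 1) s m)%C.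
Proof.
  unfold lerch_term. rewrite S_INR, RtoC_plus.
  replace (RtoC (INR m) + 1 + x)%C with (RtoC (INR m) + (x + 1))%C by ring.
  replace (2 * RtoC PI * Ci * t * (RtoC (INR m) + 1))%C with
    (2 * RtoC PI * Ci * t + 2 * RtoC PI * Ci * t * RtoC (INR m))%C by ring.
  rewrite Cexp_plus. ring.
Qed.

Lemma lerch_has_sum_shift (t x s l : C) :
  has_sum (lerch_term t (x + 1) s) l ->
  has_sum (lerch_term t x s) (Cpower x (- s) + Cexp (2 * RtoC PI * Ci * t) * l)%C.
Proof.
  intros H. replace (Cpower x (- s)) with (lerch_term t x s O).
  - apply has_sum_shift. eapply has_sum_ext; [|apply has_sum_scal, H].
    intros m. symmetry. apply lerch_term_shift.
  - unfold lerch_term. simpl INR. replace (RtoC 0 + x)%C with x by ring.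
    replace (2 * RtoC PI * Ci * t * RtoC 0)%C with (RtoC 0) by ring. rewrite Cexp_0. ring.
Qed.

Lemma lerch_zeta_shift (L : C -> C -> C -> C) (t x s : C) :
  is_lerch_zeta L -> 0 < Im t -> 0 < Im x ->
  L t x s = (Cpower x (- s) + Cexp (2 * RtoC PI * Ci * t) * L t (x + 1)%C s)%C.
Proof.
  intros HL Ht Hx.
  assert (Hu : forall z, 0 < Im z -> ~ on_cut z) by (intros z Hz [H _]; lra).
  assert (Z : (L t (x + RtoC 0) s - (Cpower (x + RtoC 0) (- s)
    - - Cexp (2 * RtoC PI * Ci * t) * L t (x + RtoC 0 + 1) s) = 0)%C).
  { apply (real_analytic_identity (fun th => L t (x + RtoC th) s - (Cpower (x + RtoC th) (- s)
      - - Cexp (2 * RtoC PI * Ci * t) * L t (x + RtoC th + 1) s))%C (- Re x)).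
    - intros th. assert (Hi : 0 < Im (x + RtoC th)) by (rewrite Im_plus, Im_RtoC; lra).
      apply real_analytic_minus; [|apply real_analytic_minus].
      + apply real_analytic_shift.
        eapply real_analytic_ext; [|apply (analytic3_real_x L t (x + RtoC th) s),
          (proj2 HL); [easy|now apply Hu]].
        intros h. cbv beta. f_equal. rewrite RtoC_plus. ring.
      + now apply Cpower_analytic.
      + apply real_analytic_scal, real_analytic_shift.
        eapply real_analytic_ext; [|apply (analytic3_real_x L t (x + RtoC th + 1) s),
          (proj2 HL); [easy|apply Hu; rewrite Im_plus, (Im_RtoC 1); lra]].
        intros h. cbv beta. f_equal. rewrite RtoC_plus. ring.
    - intros th Hth.
      assert (Hi : 0 < Im (x + RtoC th)) by (rewrite Im_plus, Im_RtoC; lra).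
      assert (Hr : 0 < Re (x + RtoC th)) by (rewrite Re_plus, Re_RtoC; lra).
      assert (S1 := lerch_zeta_series_right L t (x + RtoC th) s HL Ht (Rlt_le _ _ Hi) Hr).
      assert (S2 := lerch_zeta_series_right L t (x + RtoC th + 1) s HL Ht
        ltac:(rewrite Im_plus, (Im_RtoC 1); lra) ltac:(rewrite Re_plus, (Re_RtoC 1); lra)).
      rewrite (has_sum_unique _ _ _ S1 (lerch_has_sum_shift _ _ _ _ S2)). ring. }
  replace (x + RtoC 0)%C with x in Z by ring.
  set (c := (Cpower x (- s) + Cexp (2 * RtoC PI * Ci * t) * L t (x + 1)%C s)%C).
  replace (L t x s) with (L t x s - (Cpower x (- s)
    - - Cexp (2 * RtoC PI * Ci * t) * L t (x + 1) s) + c)%C by (unfold c; ring).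
  rewrite Z. ring.
Qed.

Lemma lerch_zeta_series (L : C -> C -> C -> C) (t x s : C) :
  is_lerch_zeta L -> 0 < Im t -> 0 <= Im x -> ~ on_cut x ->
  has_sum (lerch_term t x s) (L t x s).
Proof.
  intros HL Ht Hx Hc. destruct (Rle_lt_or_eq_dec 0 (Im x) Hx) as [Hi|H0].
  - clear Hx Hc.
    (* Induction on the number of unit shifts needed to bring the real part above 0; each shift
       removes the first term of the series. *)
    assert (H : forall n x, 0 < Im x -> 0 < Re x + INR n -> has_sum (lerch_term t x s) (L t x s)).
    { intros n. induction n as [|n IH]; intros y Hy Hn.
      - simpl in Hn. apply lerch_zeta_series_right; try easy; lra.
      - rewrite (lerch_zeta_shift L t y s HL Ht Hy). apply lerch_has_sum_shift.
        apply IH; [rewrite Im_plus, Im_RtoC; lra|].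
        rewrite S_INR in Hn. rewrite Re_plus, Re_RtoC. lra. }
    destruct (nfloor_ex (Rabs (Re x))) as [n [_ Hn]]; [apply Rabs_pos|].
    apply (H (S n) x Hi). rewrite S_INR. assert (T := Rle_abs (- Re x)).
    rewrite Rabs_Ropp in T. lra.
  - apply lerch_zeta_series_right; try easy. apply Rnot_le_lt. intros Hn. apply Hc. split; lra.
Qed.

Theorem theorem5 (L : C -> C -> C -> C) (HL : is_lerch_zeta L)
  (s x t : C) (ht : 0 < Im t) (hx : 0 <= Im x) (hcut : ~ on_cut x) :
  exists v : C,
    is_weyl_D (- s)%C
      (fun tau : C =>
         (Cexp (2 * RtoC PI * Ci * tau * x)
          / (1 - Cexp (2 * RtoC PI * Ci * tau)))%C)
      t v /\
    L t x s =
      (Cpower (2 * RtoC PI) s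
       * Cexp (- (Ci * RtoC PI) * (s / 2 + 2 * t * x))
       * v)%C.
Proof.
  exists (Csum (weyl_term 0 s x t)). split; [now apply weyl_D_lerch|].
  (* Both sides are sums of the same series, so no value of the Weyl differintegral has to be
     compared directly. *)
  apply (has_sum_unique (lerch_term t x s)); [now apply lerch_zeta_series|].
  eapply has_sum_ext; [|apply has_sum_scal, weyl_term_sum; easy].
  intros m. symmetry. now apply lerch_term_weyl.
Qed.
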